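(* Let $$z^* := \left((1-b)\mathbf{1}+(a+b-1)\,Z_S^0\,\tilde A_{S,F}\right)\left(I-(a+b-1)\tilde A_F\right)^{-1},\qquad H:=I-(a+b-1)\tilde A_F,\qquad \rho:=\lambda_{\min}(H).$$ Suppose $Z_F^t\to z^*$ almost surely as $t\to\infty$ and $\rho>1/2$. Then $$\sqrt t\,(Z_F^t-z^* )\xrightarrow{d}N(\mathbf 0,\Sigma)\quad\text{as }t\to\infty,$$ with $$\Sigma=\int_0^\infty\left(e^{-(H-\frac12 I)u}\right)^\top(\tilde A^\top\Theta\tilde A)_F\;e^{-(H-\frac12 I)u}\,du,$$ where $\Theta$ is the $N\times N$ diagonal matrix with $$\Theta_{i,i}=\begin{cases}(a+b-1)^2z_i^*(1-z_i^* )&\text{for }i\in F,\\(a+b-1)^2Z_i^0(1-Z_i^0)&\text{for }i\in S.\end{cases}$$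
   Context: Graph. $G=(V,E)$ is a finite directed graph with $V=\{1,\dots,N\}$ and $E\subseteq V\times V$. Write $i\to j$ if $(i,j)\in E$. Let $V(i)=\{j\in V:(j,i)\in E\}$, $d_i^{\mathrm{in}}=|V(i)|$, $d_i^{\mathrm{out}}=|\{j:(i,j)\in E\}|$. There are no isolated vertices (no $i$ with $d_i^{\mathrm{in}}=d_i^{\mathrm{out}}=0$). Put $S=\{i:d_i^{\mathrm{in}}=0\}$ and $F=\{i:d_i^{\mathrm{in}}>0\}$, with vertices ordered so that $F=\{1,\dots,|F|\}$. Urn process. At each vertex $i$ there is an urn with $W_i^t$ white and $B_i^t$ black balls at time $t\ge 0$; the initial configuration is fixed, with $T_i^0:=W_i^0+B_i^0\ge 1$. Fix a positive integer $m$ and $\alpha,\beta\in\{0,1,\dots,m\}$, and put $a=\alpha/m$, $b=\beta/m$. Let $Z_i^t=W_i^t/(W_i^t+B_i^t)$, $Z^t=(Z_1^t,\dots,Z_N^t)$ and $\mathcal F_t=\sigma(Z^0,\dots,Z^t)$. At time $t+1$ a ball is drawn uniformly at random from every urn (and put back); $Y_i^{t+1}$ is the indicator that the ball drawn from urn $i$ is white. Conditionally on $\mathcal F_t$, the $Y_i^{t+1}$, $i\in V$, are independent with $P(Y_i^{t+1}=1\mid\mathcal F_t)=Z_i^t$. Then for every $i\in V$ $$W_i^{t+1}=W_i^t+\sum_{j\in V(i)}\left[\alpha Y_j^{t+1}+(m-\beta)(1-Y_j^{t+1})\right],\qquad B_i^{t+1}=B_i^t+\sum_{j\in V(i)}\left[(m-\alpha)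 Y_j^{t+1}+\beta(1-Y_j^{t+1})\right].$$ In particular urns in $S$ never change. Notation. Vectors are row vectors; $Z^t=(Z_F^t,Z_S^0)$. For an $N\times N$ matrix $M$, $M_F$ is its restriction to $F\times F$. $\mathbf 1$ is an all-ones row vector of appropriate dimension, $\mathbf 0$ a zero vector, $I$ the $|F|\times|F|$ identity matrix. $\tilde A$ is the $N\times N$ scaled adjacency matrix with $\tilde A_{i,j}=1/d_j^{\mathrm{in}}$ if $i\to j$, and $0$ otherwise; $\tilde A_F$ is its $F\times F$ block and $\tilde A_{S,F}$ its block with rows in $S$ and columns in $F$. If $S=\emptyset$, the term $Z_S^0\tilde A_{S,F}$ is $\mathbf 0$. $\lambda_{\min}(M)$ is the minimum of the real parts of the eigenvalues of $M$. $\xrightarrow{d}$ is convergence in distribution and $N(\mu,\Sigma)$ is the normal law with mean $\mu$ and covariance matrix $\Sigma$. *)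

(* Defs.v *)
From HB Require Import structures.
From mathcomp Require Import all_boot all_order all_algebra.
From mathcomp Require Import all_classical all_reals all_analysis.
From mathcomp Require Import complex.
Set Implicit Arguments.
Unset Strict Implicit.
Unset Printing Implicit Defensive.
Import Order.TTheory GRing.Theory Num.Theory.
Import numFieldNormedType.Exports.
Local Open Scope classical_set_scope.
Local Open Scope ring_scope.

Definition expmx (R : realType) (n : nat) (A : 'M[R]_n) : 'M[R]_n :=
  limn (series (fun k : nat => (k`!%:R^-1 : R) *: A ^+ k)).

(* For n > 0 the set below is finite and nonempty, so the infimum is the
   minimum of the real parts of the complex eigenvalues. *)
Definition lambda_min (R : realType) (n : nat) (M : 'M[R]_n) : R :=
  inf [set complex.Re l | l in
        [set l : complex.complex R |
          eigenvalue (map_mx (complex.real_complex R) M) l]].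

(* A directed graph is a relation [e], with [e i j] meaning i -> j. *)

Definition indeg (N : nat) (e : rel 'I_N) (i : 'I_N) : nat :=
  #|[pred j | e j i]|.

Definition outdeg (N : nat) (e : rel 'I_N) (i : 'I_N) : nat :=
  #|[pred j | e i j]|.

Definition scaled_adj (R : realType) (N : nat) (e : rel 'I_N) : 'M[R]_N :=
  \matrix_(i, j) (if e i j then (indeg e j)%:R^-1 else 0).

(* [f] is a version of P(A | G), [G] being a sub-sigma-algebra. *)
Definition cond_prob (R : realType) (d : measure_display)
    (Omega : measurableType d) (P : probability Omega R)
    (G : set (set Omega)) (A : set Omega) (f : Omega -> R) : Prop :=
  [/\ preimage_set_system setT f measurable `<=` G,
      P.-integrable setT (EFin \o f) &
      forall C, G C -> (\int[P]_(w in C) (f w)%:E = P (A `&` C))%E].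

(* Subfamilies are covered by taking [C i = setT]; versions are almost surely
   unique, so it does not matter which ones are used. *)
Definition cond_independent (R : realType) (d d' : measure_display)
    (Omega : measurableType d) (T : measurableType d')
    (P : probability Omega R) (G : set (set Omega))
    (I : finType) (X : I -> Omega -> T) : Prop :=
  forall (C : I -> set T) (f : I -> Omega -> R),
    (forall i, measurable (C i)) ->
    (forall i, cond_prob P G (X i @^-1` C i) (f i)) ->
    cond_prob P G (\bigcap_(i in [set: I]) (X i @^-1` C i))
      (fun w => \prod_i f i w).

Definition white_proportion (R : realType) (w b : nat) : R :=
  w%:R / (w + b)%:R.

Definition urn_state (R : realType) (N : nat) (Omega : Type)
    (W B : nat -> 'I_N -> Omega -> nat) (t : nat) (w : Omega) : 'rV[R]_N :=
  \row_i white_proportion R (W t i w) (B t i w).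

Definition urn_filtration (R : realType) (N : nat) (Omega : Type)
    (W B : nat -> 'I_N -> Omega -> nat) (t : nat) : set (set Omega) :=
  <<s \bigcup_(s in [set s : nat | (s <= t)%N]) \bigcup_(i in [set: 'I_N])
        preimage_set_system setT (fun w => urn_state R W B s w 0 i)
          measurable >>.

(* [Y t.+1 i w] tells whether the ball drawn from urn [i] at time [t.+1] is
   white; [Y 0] is not used.  The natural-number subtractions are exact since
   [alpha] and [beta] are at most [m]. *)
Record urn_process (R : realType) (N : nat) (e : rel 'I_N)
    (m alpha beta : nat) (W0 B0 : 'I_N -> nat)
    (d : measure_display) (Omega : measurableType d) (P : probability Omega R)
    (W B : nat -> 'I_N -> Omega -> nat)
    (Y : nat -> 'I_N -> Omega -> bool) : Prop := UrnProcess {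
  urn_W0 : forall i w, W 0%N i w = W0 i ;
  urn_B0 : forall i w, B 0%N i w = B0 i ;
  urn_measurable_draw : forall t i, measurable_fun setT (Y t.+1 i) ;
  urn_draw_prob : forall t i,
    cond_prob P (urn_filtration R W B t) (Y t.+1 i @^-1` [set true])
      (fun w => urn_state R W B t w 0 i) ;
  urn_draw_indep : forall t,
    cond_independent P (urn_filtration R W B t) (Y t.+1) ;
  urn_W_step : forall t i w,
    W t.+1 i w = (W t i w +
      \sum_(j | e j i) (alpha * Y t.+1 j w
                        + (m - beta) * (1 - Y t.+1 j w)))%N ;
  urn_B_step : forall t i w,
    B t.+1 i w = (B t i w +
      \sum_(j | e j i) ((m - alpha) * Y t.+1 j w
                        + beta * (1 - Y t.+1 j w)))%N
}.

Definition borel_rV (R : realType) (n : nat) :=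
  g_sigma_algebraType (@open 'rV[R]_n).

(* Mean [mu] and variance [v], with N(mu, 0) the point mass; the library's
   [normal_prob] takes the standard deviation and is not meant for 0. *)
Definition normal_law (R : realType) (mu v : R) (A : set R) : \bar R :=
  if v == 0 then \d_mu A else normal_prob mu (Num.sqrt v) A.

(* Possibly degenerate N(mu, Sigma): Sigma is symmetric positive semidefinite
   and every linear form u has law N(<mu, u>, u Sigma u^T) under nu. *)
Definition multivariate_normal (R : realType) (n : nat) (mu : 'rV[R]_n)
    (Sigma : 'M[R]_n) (nu : probability (borel_rV R n) R) : Prop :=
  [/\ Sigma^T = Sigma,
      forall u : 'rV[R]_n, 0 <= (u *m Sigma *m u^T) 0 0 &
      forall (u : 'rV[R]_n) (A : set R), measurable A ->
        nu [set x : 'rV[R]_n | A ((x *m u^T) 0 0)] =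
        normal_law ((mu *m u^T) 0 0) ((u *m Sigma *m u^T) 0 0) A].

Definition cvg_in_law (R : realType) (n : nat) (d : measure_display)
    (Omega : measurableType d) (P : probability Omega R)
    (X : nat -> Omega -> 'rV[R]_n) (nu : probability (borel_rV R n) R) : Prop :=
  forall f : 'rV[R]_n -> R,
    continuous f -> (exists M : R, forall x, `|f x| <= M) ->
    (fun t => \int[P]_w f (X t w)) @ \oo --> \int[nu]_x f x.

Definition cvg_in_law_normal (R : realType) (n : nat) (d : measure_display)
    (Omega : measurableType d) (P : probability Omega R)
    (X : nat -> Omega -> 'rV[R]_n) (mu : 'rV[R]_n) (Sigma : 'M[R]_n) : Prop :=
  exists2 nu : probability (borel_rV R n) R,
    multivariate_normal mu Sigma nu & cvg_in_law P X nu.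

(* From here on the vertices are ['I_(p + q)], the first [p] being F and the
   last [q] being S; [c] stands for a + b - 1 and [Z0] for the initial
   proportions of white balls. *)

Definition urn_H (R : realType) (p q : nat) (e : rel 'I_(p + q)) (c : R) :
    'M[R]_p :=
  1%:M - c *: ulsubmx (scaled_adj R e).

Definition urn_limit (R : realType) (p q : nat) (e : rel 'I_(p + q))
    (a b : R) (Z0 : 'rV[R]_(p + q)) : 'rV[R]_p :=
  ((1 - b) *: const_mx 1
    + (a + b - 1) *: (rsubmx Z0 *m dlsubmx (scaled_adj R e)))
  *m invmx (urn_H e (a + b - 1)).

Definition urn_Theta (R : realType) (p q : nat) (c : R)
    (zstar : 'rV[R]_p) (Z0 : 'rV[R]_(p + q)) : 'M[R]_(p + q) :=
  let z := row_mx zstar (rsubmx Z0) in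
  diag_mx (\row_i (c ^+ 2 * z 0 i * (1 - z 0 i))).

Definition urn_Sigma (R : realType) (p q : nat) (e : rel 'I_(p + q))
    (c : R) (zstar : 'rV[R]_p) (Z0 : 'rV[R]_(p + q)) : 'M[R]_p :=
  let At := scaled_adj R e in
  let E (u : R) := expmx (- (u *: (urn_H e c - (2^-1)%:M))) in
  let Gamma := ulsubmx (At^T *m urn_Theta c zstar Z0 *m At) in
  \matrix_(i, j)
    \int[lebesgue_measure]_(u in `[0, +oo[) ((E u)^T *m Gamma *m E u) i j.

(* Main.v *)
Require Import Defs.
From HB Require Import structures.
From mathcomp Require Import all_boot all_order all_algebra.
From mathcomp Require Import all_classical all_reals all_analysis.
From mathcomp Require Import measurable_realfun complex ring lra zify.
Set Implicit Arguments.
Unset Strict Implicit.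
Unset Printing Implicit Defensive.
Import Order.TTheory GRing.Theory Num.Theory.
Import numFieldNormedType.Exports.
Local Open Scope classical_set_scope.
Local Open Scope ring_scope.

(** Put c = a + b - 1, M = c A_F (A the scaled adjacency matrix),
    kap_i = T_i^0 / (m d_i) and U^t_i = (t + kap_i) (Z^t_i - z*_i).  The urn
    dynamics become the linear recursion
    U^(t+1) = U^t (1 + D_t M) + c (Y^(t+1) - Z^t) A, with
    D_t = diag (1 / (t + kap_i)), so that, for a fixed direction u and horizon
    n, k |-> <U^k, w_(k,n)> / sqrt n is a martingale for the deterministic
    weights w_(k,n) = (1 + D_k M) ... (1 + D_(n-1) M) u^T.  Lindeberg's
    replacement argument, run forwards on E cos(. + phi), needs only that the
    sum of the conditional variances tends to u Sigma u^T, which is a Lyapunov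
    equation, and that the increments are small: the spectral hypothesis
    provides a quadratic form contracted by 1 + D_t M at rate
    1 - (1/2 + eps) / t.  Cosine transforms together with second moment bounds
    determine convergence in law, by Weierstrass approximation, and they also
    identify the Gaussian laws. *)

(** [H] need be neither symmetric nor diagonalisable, so its eigenvalues give no Euclidean estimate
    on [1 + D_t M]; this is why a quadratic form has to be built. Once [rho > 1/2], the share of
    step [k] in the variance at horizon [n] is at most a constant over [k + 1], uniformly in [n],
    and averages against these shares send null sequences to 0. Every error (third order terms,
    replacement of the conditional variance, initial value) is bounded through such an average. The
    offsets [kap_i] come from the total [T_i^t = m d_i (t + kap_i)], which is deterministic; they
    make the recursion exact but differ between urns, so [D_t] need not commute with [M] and
    products of gains are controlled only through the form. Almost sure convergence serves to
    replace [Z_j (1 - Z_j)] by its limit in mean and to place [z*] in the unit cube. At each time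
    the state takes finitely many values, so conditioning reduces to finite Bernoulli sums. A free
    phase in the cosine lets real integrals do the work of characteristic functions. *)

Definition bform (R : pzRingType) (n : nat) (Q : 'M[R]_n) (x y : 'rV[R]_n) : R :=
  (x *m Q *m y^T) 0 0.

(** * Quadratic Lyapunov forms from the spectrum *)

Section complex_aux.
Context {R : rcfType}.
Implicit Types z v : complex.complex R.
Notation Re := complex.Re.
Notation Im := complex.Im.

(** The real part of [z] times the conjugate of [v]: the Euclidean inner product of the plane. *)
Definition redot z v : R := Re z * Re v + Im z * Im v.

Lemma redotDl z z' v : redot (z + z') v = redot z v + redot z' v.
Proof. by case: z z' v => [a b] [c d] [e f]; rewrite /redot /=; ring. Qed.

Lemma redot_suml (I : finType) (F : I -> complex.complex R) v :
  redot (\sum_i F i) v = \sum_i redot (F i) v.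
Proof.
elim/big_rec2: _ => [|i y x _ <-]; last by rewrite redotDl.
by rewrite /redot /= !mul0r addr0.
Qed.

Lemma redot_ge0 z : 0 <= redot z z.
Proof. by rewrite /redot addr_ge0 // -expr2 sqr_ge0. Qed.

Lemma redotMll z v : redot (v * z) v = Re z * redot v v.
Proof. by case: z v => [a b] [c d]; rewrite /redot /=; ring. Qed.

(** Young's inequality with a free parameter [k] on each of the four real products. The unequal
    split between [z] and [v] is what a weighted sum of squares can absorb. *)
Lemma redotM_le (r z v s : complex.complex R) (k : R) : 0 < k ->
  - redot (z * s) v <= (`|Re s| + `|Im s|) / 2 * (redot z z / k + k * redot v v).
Proof.
case: z s v => [a b] [c d] [e f]; rewrite /redot /= => k0.
have amgm (x y u : R) : - (x * u * y) <= `|u| / 2 * (x ^+ 2 / k + k * y ^+ 2).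
  have h : `|x| * `|y| <= (x ^+ 2 / k + k * y ^+ 2) / 2.
    have nK (w : R) : `|w| ^+ 2 = w ^+ 2 by rewrite real_normK ?num_real.
    have := sqr_ge0 (`|x| - k * `|y|).
    rewrite sqrrB exprMn !nK => hh.
    rewrite ler_pdivlMr// -(ler_pM2r k0) [leRHS]mulrDl divfK ?gt_eqF//.
    by lra.
  apply: (le_trans (ler_norm _)); rewrite normrN !normrM.
  rewrite (_ : `|x| * `|u| * `|y| = `|u| * (`|x| * `|y|)); last by ring.
  rewrite (_ : _ / 2 * _ = `|u| * ((x ^+ 2 / k + k * y ^+ 2) / 2)); last by ring.
  by rewrite ler_wpM2l.
have := amgm a e c; have := amgm b f c.
have := amgm b (- e) d; have := amgm a f d.
rewrite !sqrrN; set A := `|c|; set B := `|d|.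
rewrite !mulrDl !mulrDr; lra.
Qed.

End complex_aux.

Section lyapunov.
Context {R : realType}.
Local Notation C := (complex.complex R).
Local Open Scope sesquilinear_scope.
Local Notation toC := (map_mx (complex.real_complex R)).
Notation Re := complex.Re.
Notation Im := complex.Im.

Lemma bformDl n (Q : 'M[R]_n) x x' y : bform Q (x + x') y = bform Q x y + bform Q x' y.
Proof. by rewrite /bform !mulmxDl mxE. Qed.

Lemma bformDr n (Q : 'M[R]_n) x y y' : bform Q x (y + y') = bform Q x y + bform Q x y'.
Proof. by rewrite /bform linearD mulmxDr mxE. Qed.

Lemma bformZl n (Q : 'M[R]_n) a x y : bform Q (a *: x) y = a * bform Q x y.
Proof. by rewrite /bform -!scalemxAl mxE. Qed.

Lemma bformZr n (Q : 'M[R]_n) a x y : bform Q x (a *: y) = a * bform Q x y.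
Proof. by rewrite /bform linearZ -scalemxAr mxE. Qed.

Lemma bform_mulmx n (Q A : 'M[R]_n) x y :
  bform Q (x *m A) (y *m A) = bform (A *m Q *m A^T) x y.
Proof. by rewrite /bform trmx_mul !mulmxA. Qed.

Lemma bformC n (Q : 'M[R]_n) x y : Q^T = Q -> bform Q x y = bform Q y x.
Proof.
by move=> QT; rewrite /bform -[in LHS](trmxK (x *m Q *m y^T)) mxE !trmx_mul trmxK QT mulmxA.
Qed.

(** The way back from complex to real: for a real row [x] the real and imaginary parts of [x S] are
    [x A] and [x B], so a weighted Hermitian form in the coordinates given by [S] restricts to a
    real symmetric matrix. *)
Lemma weighted_bformE n (w : 'I_n -> R) (S : 'M[C]_n) (x y : 'rV[R]_n) :
  let A := map_mx (@Re R) S in let B := map_mx (@Im R) S in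
  let D := diag_mx (\row_i w i) in
  bform (A *m D *m A^T + B *m D *m B^T) x y =
  \sum_j w j * redot ((toC x *m S) 0 j) ((toC y *m S) 0 j).
Proof.
move=> A B D.
have ReE (u : 'rV[R]_n) j : Re ((toC u *m S) 0 j) = (u *m A) 0 j.
  rewrite !mxE raddf_sum; apply: eq_bigr => i _.
  by rewrite !mxE; case: (S i j) => a b /=; ring.
have ImE (u : 'rV[R]_n) j : Im ((toC u *m S) 0 j) = (u *m B) 0 j.
  rewrite !mxE raddf_sum; apply: eq_bigr => i _.
  by rewrite !mxE; case: (S i j) => a b /=; ring.
have diagE (M : 'M[R]_n) :
    (x *m (M *m D *m M^T) *m y^T) 0 0 = \sum_j w j * ((x *m M) 0 j * (y *m M) 0 j).
  rewrite -!mulmxA -trmx_mul mulmxA mulmxA mul_mx_diag mxE.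
  by apply: eq_bigr => j _; rewrite !mxE; ring.
rewrite /bform mulmxDr mulmxDl mxE !diagE -big_split; apply: eq_bigr => j _ /=.
by rewrite /redot !ReE !ImE mulrDr.
Qed.

(** [T] is lower triangular, so coordinate [j] of [y T] involves only the [y_i] with [i >= j]. For
    [i > j] Young's inequality with parameter [r] costs [a_i / r + r a_j]; since the weights grow by
    the factor [r^-2] at each index, multiplying by [w_j] leaves at most [r (w_i a_i + w_j a_j)]. *)
Lemma trig_weighted_dissipative n (T : 'M[C]_n) (mu : R) : 0 < mu ->
  is_trig_mx T -> (forall j, mu <= Re (T j j)) ->
  exists2 w : 'I_n -> R, (forall j, 1 <= w j) & forall y : 'rV[C]_n,
    mu / 2 * (\sum_j w j * redot (y 0 j) (y 0 j)) <=
    \sum_j w j * redot ((y *m T) 0 j) (y 0 j).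
Proof.
move=> mu0 Ttrig muT.
pose t := \sum_i \sum_j (`|Re (T i j)| + `|Im (T i j)|) / 2.
have tge0 : 0 <= t.
  by apply: sumr_ge0 => i _; apply: sumr_ge0 => j _; rewrite divr_ge0 ?addr_ge0.
have tij i j : (`|Re (T i j)| + `|Im (T i j)|) / 2 <= t.
  rewrite /t (bigD1 i)//= (bigD1 j)//= -addrA lerDl addr_ge0//.
    by apply: sumr_ge0 => k _; rewrite divr_ge0 ?addr_ge0.
  by apply: sumr_ge0 => k _; apply: sumr_ge0 => l _; rewrite divr_ge0 ?addr_ge0.
(* The off-diagonal terms add up to at most [2 n t r] times the weighted square; this [r] keeps that
   below [mu / 2]. *)
pose r : R := Num.min 1 (mu / (4 * (1 + t) * (1 + n%:R))).
have t1 : 0 < 1 + t by rewrite ltr_pwDl.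
have n1 : 0 < 1 + n%:R :> R by rewrite ltr_pwDl.
have r0 : 0 < r by rewrite /r lt_min ltr01/= divr_gt0// !mulr_gt0.
have r1 : r <= 1 by rewrite /r ge_min lexx.
have rt : t * r * n%:R * 2 <= mu / 2.
  have : r <= mu / (4 * (1 + t) * (1 + n%:R)) by rewrite /r ge_min lexx orbT.
  rewrite ler_pdivlMr ?mulr_gt0// => h.
  have : t * n%:R <= (1 + t) * (1 + n%:R).
    by apply: ler_pM => //; rewrite lerDr.
  rewrite -(ler_pM2l r0) => h2; lra.
have rV1 : 1 <= r^-1 by rewrite -[leLHS]invr1 lef_pV2 ?posrE.
pose w (j : 'I_n) : R := r^-1 ^+ (2 * j).
have w0 j : 0 < w j by rewrite exprn_gt0 ?invr_gt0.
have wij (i j : 'I_n) : (j < i)%N -> w j / r ^+ 2 <= w i.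
  move=> ji; rewrite /w -exprVn -exprD ler_weXn2l//.
  by rewrite -[X in (_ + X)%N]muln1 -mulnDr leq_mul2l /= addn1.
exists w => [j|y]; first by rewrite exprn_ege1.
pose a j := redot (y 0 j) (y 0 j).
have a0 j : 0 <= a j by exact: redot_ge0.
pose s := \sum_j w j * a j.
have s0 : 0 <= s by apply: sumr_ge0 => j _; rewrite mulr_ge0// ltW.
have off (i j : 'I_n) : (j < i)%N ->
    - (w j * redot (y 0 i * T i j) (y 0 j)) <= t * r * (w i * a i + w j * a j).
  move=> ji; rewrite -mulrN.
  have h := redotM_le (y 0 j) (y 0 i) (y 0 j) (T i j) r0.
  rewrite -/(a i) -/(a j) in h.
  have h3 : w j * (a i / r + r * a j) <= r * (w i * a i + w j * a j).
    have h4 := ler_wpM2r (a0 i) (wij _ _ ji).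
    have -> : w j * (a i / r + r * a j) = r * (w j / r ^+ 2 * a i + w j * a j).
      by field; rewrite gt_eqF.
    by rewrite ler_wpM2l ?(ltW r0)// lerD2r.
  rewrite -mulrA; apply: le_trans (ler_wpM2l tge0 h3).
  rewrite [leRHS]mulrCA ler_wpM2l ?(ltW (w0 j))//.
  apply: (le_trans h); rewrite ler_wpM2r ?tij//.
  by rewrite addr_ge0// ?mulr_ge0 ?invr_ge0 ?(ltW r0).
have row_bound j : mu * (w j * a j) - \sum_i t * r * (w i * a i + w j * a j) <=
    w j * redot ((y *m T) 0 j) (y 0 j).
  rewrite mxE redot_suml [X in _ <= _ * X](bigD1 j)//= redotMll -/(a j) [leRHS]mulrDr.
  apply: lerD; first by rewrite mulrCA ler_wpM2l ?(ltW (w0 j))// ler_wpM2r// muT.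
  rewrite mulr_sumr -sumrN [leLHS](bigD1 j)//= -[leRHS]add0r.
  apply: lerD.
    by rewrite oppr_le0 !mulr_ge0 ?(ltW r0)// addr_ge0// mulr_ge0// ltW.
  apply: ler_sum => i ij; rewrite lerNl.
  have [ji|] := ltnP j i; first exact: off.
  rewrite leq_eqVlt (negbTE (_ : (i : nat) != j))//= => ltij.
  move/is_trig_mxP : Ttrig => /(_ i j ltij) ->; rewrite mulr0.
  rewrite /redot /= !mul0r addr0 mulr0 oppr0.
  by rewrite !mulr_ge0 ?(ltW r0)// addr_ge0// mulr_ge0// ltW.
apply: le_trans (ler_sum _ (fun j _ => row_bound j)).
rewrite sumrB -mulr_sumr -/s.
have -> : \sum_j \sum_i t * r * (w i * a i + w j * a j) = t * r * n%:R * 2 * s.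
  under eq_bigr do rewrite -mulr_sumr big_split /= -/s sumr_const card_ord -mulr_natl.
  rewrite -mulr_sumr big_split /= -mulr_sumr -/s sumr_const card_ord -mulr_natl.
  by ring.
have := ler_wpM2r s0 rt; lra.
Qed.

Lemma eigenvalue_similar (F : fieldType) n (A B S : 'M[F]_n) a :
  S \in unitmx -> A *m S = S *m B -> eigenvalue B a -> eigenvalue A a.
Proof.
move=> Su AS /eigenvalueP[v vB v0]; apply/eigenvalueP; exists (v *m invmx S).
  rewrite -(mulmxK Su (v *m invmx S *m A)) -(mulmxA _ A) AS !mulmxA mulmxKV// vB.
  by rewrite -scalemxAl.
by apply: contraNneq v0 => h; rewrite -(mulmxKV Su v) h mul0mx.
Qed.

(* After a unitary Schur triangularisation, weights growing fast along the diagonal make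
   the off-diagonal part negligible. *)
Lemma lyapunov_form n (K : 'M[R]_n) (mu : R) : 0 < mu ->
  (forall l : C, eigenvalue (toC K) l -> mu <= Re l) ->
  exists Q : 'M[R]_n, [/\ Q^T = Q,
    forall x, bform 1%:M x x <= bform Q x x &
    forall x, mu / 2 * bform Q x x <= bform Q (x *m K) x].
Proof.
move=> mu0 eigK.
case: n => [|n] in K eigK *.
  exists 0; split; first exact: trmx0.
  - by move=> x; rewrite /bform !mxE !big_ord0.
  - by move=> x; rewrite /bform !mxE !big_ord0 mulr0.
have [P Pu Ptrig] := Schur (toC K) (ltn0Sn n).
have Punit := unitarymx_unit Pu.
pose S := invmx P; pose T := conjmx P (toC K).
have Su : S \in unitmx by rewrite unitmx_inv.
have KS : toC K *m S = S *m T.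
  by rewrite /T conjumx// /S !mulmxA mulVmx// mul1mx.
have muT j : mu <= Re (T j j).
  apply: eigK; apply: (eigenvalue_similar Su KS).
  rewrite eigenvalue_root_char char_poly_trig//.
  by rewrite /root horner_prod (bigD1 j)//= !hornerE subrr mul0r.
have [w w1 wP] := trig_weighted_dissipative mu0 Ptrig muT.
have w0 j : 0 <= w j by rewrite (le_trans _ (w1 j)).
pose A := map_mx (@Re R) S; pose B := map_mx (@Im R) S.
pose D := diag_mx (\row_i w i).
pose Q := A *m D *m A^T + B *m D *m B^T.
exists Q; split.
- by rewrite linearD /= !trmx_mul !trmxK !tr_diag_mx !mulmxA.
- move=> x; rewrite weighted_bformE.
  (* [S] is unitary, so the unweighted form is the Euclidean one; weights at least 1 then give the
     lower bound on [Q]. *)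
  have nrm : (toC x *m S) *m (toC x *m S)^t* = toC (x *m x^T).
    have toCJ : map_mx Num.conj (toC x)^T = toC x^T.
      by apply/matrixP => i j; rewrite !mxE; exact: conjc_real.
    rewrite trmx_mul map_mxM toCJ mulmxA -(mulmxA (toC x)) /S invmx_unitary//.
    rewrite trmxCK -invmx_unitary// mulVmx// mulmx1.
    by rewrite -map_mxM.
  have -> : bform 1%:M x x = \sum_j redot ((toC x *m S) 0 j) ((toC x *m S) 0 j).
    rewrite /bform mulmx1 -[LHS]/(Re (complex.real_complex R ((x *m x^T) 0 0))).
    have -> : complex.real_complex R ((x *m x^T) 0 0) = toC (x *m x^T) 0 0 by rewrite [RHS]mxE.
    rewrite -nrm mxE raddf_sum; apply: eq_bigr => j _.
    rewrite [_^t* _ _]mxE [X in Num.conj X]mxE.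
    rewrite /redot; set z := (_ *m _) 0 j; change (z^*) with (conjc z).
    by case: z => u v /=; ring.
  by apply: ler_sum => j _; rewrite ler_peMl ?redot_ge0.
- move=> x; rewrite !weighted_bformE; have := wP (toC x *m S).
  by rewrite map_mxM /= -!mulmxA -KS.
Qed.

End lyapunov.

Section lambda_min_aux.
Context {R : realType}.
Local Notation C := (complex.complex R).
Local Notation toC := (map_mx (complex.real_complex R)).
Notation Re := complex.Re.

(** An infimum bounds from below only when the set has a lower bound: here minus the sum of the
    absolute real parts of all roots of the characteristic polynomial. *)
Lemma lambda_min_le n (M : 'M[R]_n) (l : C) :
  eigenvalue (toC M) l -> lambda_min M <= Re l.
Proof.
move=> Ml; apply: ge_inf; last by exists l.
have [r pE] := closed_field_poly_normal (char_poly (toC M)).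
exists (- \sum_(z <- r) `|Re z|) => _ [z /= zM <-].
have zr : z \in r.
  move: zM; rewrite eigenvalue_root_char pE rootZ ?root_prod_XsubC//.
  by rewrite (monicP (char_poly_monic _)) oner_eq0.
rewrite lerNl; apply: le_trans (ler_norm _) _; rewrite normrN.
by rewrite (big_rem z)//= lerDl sumr_ge0.
Qed.

Lemma eigenvalue_sub_scalar n (M : 'M[R]_n) (s : R) (l : C) :
  eigenvalue (toC (M - s%:M)) l ->
  eigenvalue (toC M) (l + complex.real_complex R s).
Proof.
move=> /eigenvalueP[v vM v0]; apply/eigenvalueP; exists v => //.
move: vM; rewrite map_mxB map_scalar_mx mulmxBr mul_mx_scalar => /eqP.
by rewrite subr_eq -scalerDl => /eqP.
Qed.

(** Applied with [s] equal to 1/2. The rate [eps] is half the spectral gap; the other half has paid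
    for the off-diagonal part. *)
Lemma lyapunov_form_shift n (H : 'M[R]_n) (s : R) : s < lambda_min H ->
  exists Q : 'M[R]_n, exists2 eps : R, 0 < eps & [/\ Q^T = Q,
    forall x : 'rV[R]_n, bform 1%:M x x <= bform Q x x &
    forall x, eps * bform Q x x <= bform Q (x *m (H - s%:M)) x].
Proof.
move=> sH; have mu0 : 0 < lambda_min H - s by rewrite subr_gt0.
have eigK (l : C) : eigenvalue (toC (H - s%:M)) l -> lambda_min H - s <= Re l.
  move=> /eigenvalue_sub_scalar/lambda_min_le; rewrite raddfD /=; lra.
have [Q [QT Q1 Qd]] := lyapunov_form mu0 eigK.
by exists Q, ((lambda_min H - s) / 2); [rewrite divr_gt0|split].
Qed.

End lambda_min_aux.

(** * Entrywise limits and derivatives of matrices *)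

Section matrix_limits.
Context {R : realType}.

Lemma cvg_mx (T : Type) (F : set_system T) (FF : Filter F) m n (f : T -> 'M[R]_(m, n))
    (l : 'M[R]_(m, n)) :
  (forall i j, (fun t => f t i j) @ F --> l i j) -> f @ F --> l.
Proof.
move=> fl A [P Pl PA].
have : \forall t \near F, forall ij, P ij.1 ij.2 (f t ij.1 ij.2).
  by apply: filter_forall => -[i j]; exact: (fl i j _ (Pl i j)).
by apply: filterS => t Pt; apply: PA => i j; exact: (Pt (i, j)).
Qed.

Lemma cvg_sumr (T : Type) (F : set_system T) (FF : Filter F) (I : Type) (r : seq I)
    (P : pred I) (f : I -> T -> R) (l : I -> R) :
  (forall i, P i -> f i @ F --> l i) ->
  (fun t => \sum_(i <- r | P i) f i t) @ F --> \sum_(i <- r | P i) l i.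
Proof.
move=> fl; elim: r => [|i r ih].
  by rewrite big_nil; under eq_fun do rewrite big_nil; exact: cvg_cst.
rewrite big_cons; under eq_fun do rewrite big_cons.
by case: ifPn => // Pi; apply: cvgD => //; exact: fl.
Qed.

Lemma cvg_coord (T : Type) (F : set_system T) m n (f : T -> 'M[R]_(m, n))
    (l : 'M[R]_(m, n)) i j : f @ F --> l -> (fun t => f t i j) @ F --> l i j.
Proof. by move=> fl; exact: (cvg_comp f (fun M : 'M[R]_(m, n) => M i j) fl (@coord_continuous R m n i j l)). Qed.

Lemma cvg_mulmx (T : Type) (F : set_system T) (FF : Filter F) m n k
    (f : T -> 'M[R]_(m, n)) (g : T -> 'M[R]_(n, k)) (A : 'M[R]_(m, n)) (B : 'M[R]_(n, k)) :
  f @ F --> A -> g @ F --> B -> (fun t => f t *m g t) @ F --> A *m B.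
Proof.
move=> fA gB; apply: cvg_mx => i j; rewrite mxE.
under eq_fun do rewrite mxE.
by apply: cvg_sumr => l _; apply: cvgM; exact: cvg_coord.
Qed.

Lemma mx_sumE (I : Type) (r : seq I) (P : pred I) m n (F : I -> 'M[R]_(m, n)) i j :
  (\sum_(k <- r | P k) F k) i j = \sum_(k <- r | P k) F k i j.
Proof. by rewrite summxE. Qed.

(** Entrywise, so that monotonicity, constancy and the fundamental theorem of calculus apply to real
    functions of one variable. *)
Definition mxder m n (f : R -> 'M[R]_(m, n)) (t : R) (df : 'M[R]_(m, n)) :=
  forall i j, is_derive t 1 (fun u => f u i j) (df i j).

Lemma mxder_cst m n (A : 'M[R]_(m, n)) t : mxder (fun=> A) t 0.
Proof. by move=> i j; rewrite mxE; exact: is_derive_cst. Qed.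

Lemma mxder_tr m n (f : R -> 'M[R]_(m, n)) t df : mxder f t df ->
  mxder (fun u => (f u)^T) t df^T.
Proof.
move=> h i j; rewrite mxE; under [X in is_derive _ _ X]eq_fun do rewrite mxE.
exact: h.
Qed.

Lemma mxderM m n k (f : R -> 'M[R]_(m, n)) (g : R -> 'M[R]_(n, k)) t df dg :
  mxder f t df -> mxder g t dg ->
  mxder (fun u => f u *m g u) t (df *m g t + f t *m dg).
Proof.
move=> hf hg i j.
have -> : (fun u => (f u *m g u) i j) =
    \sum_(l < n) ((fun u => f u i l) * (fun u => g u l j)).
  by apply/funext => u; rewrite mxE fct_sumE; apply: eq_bigr.
have -> : (df *m g t + f t *m dg) i j =
    \sum_(l < n) (f t i l *: dg l j + g t l j *: df i l).
  rewrite !mxE -big_split; apply: eq_bigr => l _ /=.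
  by rewrite addrC [g t l j *: _]mulrC.
apply: is_derive_sum => l.
by have hf' := hf i l; have hg' := hg l j; exact: is_deriveM.
Qed.

End matrix_limits.

(** * The matrix exponential as an entrywise power series *)

Section matrix_exponential.
Context {R : realType}.

(** The entrywise l1 norm, chosen because it is submultiplicative for all formats. *)
Definition mxabs m n (A : 'M[R]_(m, n)) : R := \sum_i \sum_j `|A i j|.

Lemma mxabs_ge0 m n (A : 'M[R]_(m, n)) : 0 <= mxabs A.
Proof. by apply: sumr_ge0 => i _; exact: sumr_ge0. Qed.

Lemma ler_mxabs m n (A : 'M[R]_(m, n)) i j : `|A i j| <= mxabs A.
Proof.
rewrite /mxabs (bigD1 i)//= (bigD1 j)//= -addrA lerDl addr_ge0 ?sumr_ge0//.
by move=> k _; exact: sumr_ge0.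
Qed.

Lemma mxabsM m n k (A : 'M[R]_(m, n)) (B : 'M[R]_(n, k)) :
  mxabs (A *m B) <= mxabs A * mxabs B.
Proof.
rewrite /mxabs mulr_suml; apply: ler_sum => i _.
rewrite mulr_suml.
apply: (@le_trans _ _ (\sum_j \sum_l `|A i l| * `|B l j|)).
  apply: ler_sum => j _; rewrite mxE; apply: (le_trans (ler_norm_sum _ _ _)).
  by apply: ler_sum => l _; rewrite normrM.
rewrite exchange_big /=; apply: ler_sum => l _.
rewrite -mulr_sumr ler_wpM2l// [leRHS](bigD1 l)//= lerDl sumr_ge0// => ? _.
exact: sumr_ge0.
Qed.

Lemma mxabsX n (A : 'M[R]_n) k : mxabs (A ^+ k) <= mxabs (1%:M : 'M[R]_n) * mxabs A ^+ k.
Proof.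
elim: k => [|k ih]; first by rewrite !expr0 mulr1.
rewrite !exprSr mulrA; apply: (le_trans (mxabsM _ _)).
by rewrite ler_wpM2r ?mxabs_ge0.
Qed.

Lemma exprmxZ n (u : R) (B : 'M[R]_n) k : (u *: B) ^+ k = u ^+ k *: B ^+ k.
Proof.
elim: k => [|k ih]; first by rewrite !expr0 scale1r.
rewrite !exprS ih; change (u *: B *m (u ^+ k *: B ^+ k) = u * u ^+ k *: (B *m B ^+ k)).
by rewrite -scalemxAl -scalemxAr scalerA.
Qed.

(** Coefficients of entry [(i, j)] of [D *m expmx (u *: B)] as a power series in [u]. The left
    factor [D] makes the family closed under differentiation, which replaces [D] by [D B]. *)
Definition exp_coeff_mx m n (D : 'M[R]_(m, n)) (B : 'M[R]_n) i j (k : nat) : R :=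
  k`!%:R^-1 * (D *m B ^+ k) i j.

Lemma is_cvg_exp_coeff_mx m n (D : 'M[R]_(m, n)) (B : 'M[R]_n) i j u :
  cvgn (pseries (exp_coeff_mx D B i j) u).
Proof.
apply: (@normed_cvg _ R^o).
apply: (@series_le_cvg _ _
  (fun k => mxabs D * mxabs (1%:M : 'M[R]_n) * exp_coeff (mxabs B * `|u|) k)) => k.
- exact: normr_ge0.
- by rewrite /exp_coeff /= mulr_ge0 ?mulr_ge0 ?mxabs_ge0 ?invr_ge0 ?exprn_ge0 ?mulr_ge0 ?mxabs_ge0.
- rewrite /= /exp_coeff_mx /exp_coeff /= !normrM normfV normr_nat normrX.
  rewrite (_ : mxabs D * _ * _ =
      k`!%:R^-1 * (mxabs D * (mxabs (1%:M : 'M[R]_n) * mxabs B ^+ k)) * `|u| ^+ k); last first.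
    by rewrite exprMn; ring.
  rewrite ler_wpM2r ?exprn_ge0// ler_wpM2l ?invr_ge0//.
  apply: (le_trans (ler_mxabs _ i j)); apply: (le_trans (mxabsM _ _)).
  by rewrite ler_wpM2l ?mxabs_ge0// mxabsX.
have := @is_cvg_seriesZ _ _ (mxabs D * mxabs (1%:M : 'M[R]_n)) (is_cvg_series_exp_coeff (mxabs B * `|u|)).
exact.
Qed.

Lemma pseries_diffs_exp_coeff_mx m n (D : 'M[R]_(m, n)) (B : 'M[R]_n) i j :
  pseries_diffs (exp_coeff_mx D B i j) = exp_coeff_mx (D *m B) B i j.
Proof.
apply/funext => k; rewrite /pseries_diffs /exp_coeff_mx exprS -mulmxA.
by rewrite factS natrM invfM mulrA mulrA divff ?mul1r// pnatr_eq0.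
Qed.

Lemma expmx_mulE m n (D : 'M[R]_(m, n)) (B : 'M[R]_n) u :
  D *m expmx (u *: B) =
  \matrix_(i, j) limn (pseries (exp_coeff_mx D B i j) u).
Proof.
have cE : series (fun k => (k`!%:R^-1 : R) *: (u *: B) ^+ k) @ \oo -->
    \matrix_(i, j) limn (pseries (exp_coeff_mx 1%:M B i j) u).
  apply: cvg_mx => i j; rewrite mxE.
  rewrite (_ : (fun t => _) = pseries (exp_coeff_mx 1%:M B i j) u).
    exact: is_cvg_exp_coeff_mx.
  apply/funext => t; rewrite /pseries /series /= mx_sumE.
  apply: eq_bigr => k _; rewrite exprmxZ !mxE /exp_coeff_mx mul1mx; ring.
rewrite /expmx (cvg_lim _ cE)//; apply/matrixP => i j; rewrite !mxE.
apply/esym/cvg_lim => //.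
rewrite (_ : pseries _ _ = (fun t => \sum_l D i l * pseries (exp_coeff_mx 1%:M B l j) u t)).
  apply: cvg_sumr => l _; rewrite mxE; apply: cvgMr.
  exact: is_cvg_exp_coeff_mx.
apply/funext => t; under [RHS]eq_bigr do rewrite mulr_sumr.
rewrite exchange_big /=; apply: eq_bigr => k _.
rewrite /exp_coeff_mx mul1mx /= mxE mulr_sumr mulr_suml; apply: eq_bigr => l _; ring.
Qed.

Lemma expmx0 n : expmx (0 : 'M[R]_n) = 1%:M.
Proof.
rewrite -[LHS]mul1mx -(scale0r (1%:M : 'M[R]_n)) expmx_mulE.
apply/matrixP => i j; rewrite mxE; apply/cvg_lim => //.
apply: cvg_near_cst; exists 1%N => // -[//|t] _.
rewrite /pseries /series /= big_nat_recl//= big1 => [|k _].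
  by rewrite expr0 addr0 mulr1 /exp_coeff_mx expr0 mul1mx invr1 mul1r.
by rewrite expr0n mulr0.
Qed.

Lemma mxder_mul_expmx m n (D : 'M[R]_(m, n)) (B : 'M[R]_n) u :
  mxder (fun u => D *m expmx (u *: B)) u (D *m B *m expmx (u *: B)).
Proof.
move=> i j; rewrite !expmx_mulE mxE.
under [X in is_derive _ _ X]eq_fun do rewrite expmx_mulE mxE.
rewrite -pseries_diffs_exp_coeff_mx.
apply: (@pseries_snd_diffs _ _ (`|u| + 1)).
- exact: is_cvg_exp_coeff_mx.
- by rewrite pseries_diffs_exp_coeff_mx; exact: is_cvg_exp_coeff_mx.
- by rewrite !pseries_diffs_exp_coeff_mx; exact: is_cvg_exp_coeff_mx.
- by rewrite [ltRHS]ger0_norm ?addr_ge0// ltrDl.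
Qed.

Lemma expmx_comm n (B : 'M[R]_n) u : B *m expmx (u *: B) = expmx (u *: B) *m B.
Proof.
rewrite expmx_mulE -[X in _ = X *m _]mul1mx expmx_mulE.
apply/matrixP => i j; rewrite !mxE; apply/cvg_lim => //.
rewrite (_ : pseries _ _ = (fun t => \sum_l pseries (exp_coeff_mx 1%:M B i l) u t * B l j)).
  apply: cvg_sumr => l _; rewrite mxE; apply: cvgMl.
  exact: is_cvg_exp_coeff_mx.
apply/funext => t; under [RHS]eq_bigr do rewrite mulr_suml.
rewrite exchange_big /=; apply: eq_bigr => k _.
rewrite /exp_coeff_mx /= (_ : B *m B ^+ k = B ^+ k *m B); last by rewrite -[LHS]exprS exprSr.
rewrite mxE mulr_sumr mulr_suml.
by apply: eq_bigr => l _; rewrite mul1mx; ring.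
Qed.

Lemma mxder_expmx n (B : 'M[R]_n) u :
  mxder (fun u => expmx (u *: B)) u (B *m expmx (u *: B)).
Proof.
have := @mxder_mul_expmx _ _ 1%:M B u.
by rewrite mul1mx; under [X in mxder X]eq_fun do rewrite mul1mx.
Qed.

End matrix_exponential.

(** * Exponential decay, the Lyapunov equation and its integral solution *)

Section lyapunov_decay.
Context {R : realType} (n : nat) (K Q : 'M[R]_n) (eps : R).
Hypothesis eps0 : 0 < eps.
Hypothesis Q1 : forall x : 'rV[R]_n, bform 1%:M x x <= bform Q x x.
Hypothesis Qd : forall x : 'rV[R]_n, eps * bform Q x x <= bform Q (x *m K) x.
Hypothesis QT : Q^T = Q.

Let E (u : R) := expmx (- (u *: K)).

Let EE u : E u = expmx (u *: - K).
Proof. by rewrite /E scalerN. Qed.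

Let E0 : E 0 = 1%:M.
Proof. by rewrite EE scale0r expmx0. Qed.

Let derE (u : R) : mxder E u (- K *m E u).
Proof.
rewrite EE (_ : E = fun u => expmx (u *: - K)); last exact/funext/EE.
exact: mxder_expmx.
Qed.

(** Gronwall's argument: along the flow [y = x E] the form has derivative [- 2 bform Q (y K) y], at
    most [- 2 eps] times the form, so its product with [expR (2 eps t)] is nonincreasing. *)
Lemma bform_expmx_decay (x : 'rV[R]_n) (u : R) : 0 <= u ->
  bform Q (x *m E u) (x *m E u) <= expR (- (u * (2 * eps))) * bform Q x x.
Proof.
move=> u0.
have dx t : mxder (fun t => x *m E t) t (x *m E t *m - K).
  have := @mxder_mul_expmx R _ _ x (- K) t.
  rewrite -mulmxA expmx_comm mulmxA -EE.
  by rewrite (_ : (fun u0 => _) = (fun t => x *m E t))//; apply/funext => ?; rewrite EE.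
pose h t := bform Q (x *m E t) (x *m E t).
have dh (t : R) : is_derive t 1 h (- 2 * bform Q (x *m E t *m K) (x *m E t)).
  have dM := mxderM (mxderM (dx t) (@mxder_cst R _ _ Q t)) (mxder_tr (dx t)).
  apply: (is_derive_eq (dM 0 0)).
  rewrite mulmx0 addr0; move: (x *m E t) => y.
  have -> : (y *m - K *m Q *m y^T + y *m Q *m (y *m - K)^T) 0 0 =
      bform Q (y *m - K) y + bform Q y (y *m - K) by rewrite mxE.
  rewrite (bformC y _ QT) mulmxN -scaleN1r bformZl; ring.
pose g t := expR (t * (2 * eps)) * h t.
have dg (t : R) : is_derive t 1 g
    (expR (t * (2 * eps)) * (2 * eps * h t - 2 * bform Q (x *m E t *m K) (x *m E t))).
  have d1 : is_derive t 1 (expR \o (fun s : R => s * (2 * eps))) (expR (t * (2 * eps)) * (2 * eps)).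
    have d0 : is_derive t 1 (fun s : R => s * (2 * eps)) (2 * eps).
      apply: (is_derive_eq (is_deriveM (is_derive_id t 1) (is_derive_cst (2 * eps) t 1))).
      by rewrite scaler0 add0r /GRing.scale /= mulr1.
    exact: (is_derive1_comp _ d0).
  apply: (is_derive_eq (is_deriveM d1 (dh t))).
  by rewrite /GRing.scale /=; ring.
have g_nincr : g u <= g 0.
  have g'le0 (t : R) : t \in `]0, u[ -> derive1 g t <= 0.
    move=> _; rewrite derive1E derive_val.
    rewrite mulr_ge0_le0 ?expR_ge0// subr_le0 -mulrA ler_pM2l//.
    exact: Qd.
  have cg : {within `[0, u], continuous g} by exact: derivable_within_continuous.
  have der (t : R) : t \in `]0, u[ -> derivable g t 1 by [].
  by apply: (ler0_derive1_le_cc der g'le0 cg); rewrite ?in_itv /= ?lexx ?u0.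
move: g_nincr; rewrite /g /h mul0r expR0 mul1r E0 mulmx1.
by move=> hu; rewrite expRN [leRHS]mulrC ler_pdivlMr ?expR_gt0// [leLHS]mulrC.
Qed.

Lemma expmx_cvg0 : E u @[u --> +oo] --> (0 : 'M[R]_n).
Proof.
apply: cvg_mx => i j; rewrite mxE.
pose x : 'rV[R]_n := delta_mx 0 i.
pose c := Num.sqrt (bform Q x x).
have bd u : 0 <= u -> `|E u i j| <= c * expR (- (u * eps)).
  move=> u0; rewrite -ler_sqr ?nnegrE ?mulr_ge0 ?sqrtr_ge0 ?expR_ge0//.
  have Qx : 0 <= bform Q x x.
    apply: le_trans (Q1 x); rewrite /bform mulmx1 mxE sumr_ge0// => k _.
    by rewrite [x^T _ _]mxE -expr2 sqr_ge0.
  rewrite exprMn sqr_sqrtr// real_normK ?num_real//.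
  rewrite -expRM_natl.
  rewrite (_ : 2 * - (u * eps) = - (u * (2 * eps))); last by ring.
  rewrite mulrC; apply: le_trans (bform_expmx_decay x u0).
  apply: le_trans (Q1 _); rewrite /bform mulmx1 /x -rowE mxE (bigD1 j)//= !mxE -expr2.
  by rewrite lerDl sumr_ge0// => k _; rewrite !mxE -expr2 sqr_ge0.
have c0 : c * expR (- (u * eps)) @[u --> +oo] --> (0 : R).
  rewrite -(mulr0 c); apply: cvgMr.
  apply: (cvg_comp (fun u => u * eps) (fun v => expR (- v)) _ (@cvgr_expR R)).
  by apply: gt0_cvgMly => //; exact: cvg_id.
apply/norm_cvg0P.
apply: (@squeeze_cvgr _ _ _ _ (cst 0) _ _ _ _ _ c0) => //; last exact: cvg_cst.
by near=> u; rewrite /= normr_ge0 /=; apply: bd; near: u; exact: nbhs_pinfty_ge.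
Unshelve. all: by end_near. Qed.

(** Up to sign, the sandwich of [X] is a primitive of the sandwich of [K^T X + X K]. Both the
    uniqueness of Lyapunov solutions and the value of the integral come from this identity. *)
Lemma mxder_expmx_sandwich X (u : R) : mxder (fun u => (E u)^T *m X *m E u) u
  (- ((E u)^T *m (K^T *m X + X *m K) *m E u)).
Proof.
have := mxderM (mxderM (mxder_tr (derE u)) (@mxder_cst R _ _ X u)) (derE u).
congr mxder.
rewrite mulmx0 addr0 trmx_mul linearN /= !(mulNmx, mulmxN, mulmxDl, mulmxDr) !mulmxA.
by rewrite opprD.
Qed.

Lemma expmx_sandwich_cvg0 X : (E u)^T *m X *m E u @[u --> +oo] --> (0 : 'M[R]_n).
Proof.
rewrite -(mulmx0 _ (0^T *m X)); apply: cvg_mulmx expmx_cvg0.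
apply: cvg_mulmx; last exact: cvg_cst.
apply: cvg_mx => i j; rewrite trmx0.
have h := @cvg_coord _ _ _ _ _ _ _ j i expmx_cvg0; rewrite mxE in h.
by rewrite mxE; under eq_fun do rewrite mxE.
Qed.

(** The sandwich of [X] is then constant in [u]; it equals [X] at 0 and vanishes at infinity. *)
Lemma lyapunov_eq0 X : K^T *m X + X *m K = 0 -> X = 0.
Proof.
move=> KX; apply/matrixP => i j.
have cst (u : R) : ((E u)^T *m X *m E u) i j = X i j.
  transitivity (((E 0)^T *m X *m E 0) i j); last by rewrite E0 trmx1 mul1mx mulmx1.
  have der0 (t : R) : is_derive t 1 (fun t => ((E t)^T *m X *m E t) i j) 0.
    by have := mxder_expmx_sandwich X t i j; rewrite KX mulmx0 mul0mx oppr0 mxE.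
  exact: (is_derive_0_is_cst u 0 der0).
have := @cvg_coord _ _ _ _ _ _ _ i j (expmx_sandwich_cvg0 X).
under eq_fun do rewrite cst.
move/cvg_lim => <- //.
by apply/esym/cvg_lim => //; exact: cvg_cst.
Qed.

(** The Lyapunov operator is injective on a finite-dimensional space, hence onto. Existence thus
    precedes any integral, and the solution supplies the primitive that computes it. *)
Lemma lyapunov_solution G : exists X, K^T *m X + X *m K = G.
Proof.
pose f (X : 'M[R]_n) := K^T *m X + X *m K.
have flin : linear f.
  move=> a A B; rewrite /f !(mulmxDr, mulmxDl) -!scalemxAl -!scalemxAr scalerDr.
  by rewrite addrACA.
pose fL : {linear 'M[R]_n -> 'M[R]_n} := HB.pack f (GRing.isLinear.Build _ _ _ _ f flin).
have free : row_free (lin_mx fL).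
  apply: inj_row_free => v; rewrite -[v]vec_mxK mul_vec_lin /= => h.
  rewrite (@lyapunov_eq0 (vec_mx v)) ?linear0//.
  by apply: (can_inj mxvecK); rewrite h linear0.
exists (vec_mx (mxvec G *m invmx (lin_mx fL))).
rewrite -/(f _) -[f _]/(fL _) -(mxvecK (fL _)) -mul_vec_lin vec_mxK mulmxKV ?mxvecK//.
by rewrite -row_free_unit.
Qed.

End lyapunov_decay.

Section lyapunov_integral.
Context {R : realType} (n : nat) (K Q : 'M[R]_n) (eps : R).
Hypothesis eps0 : 0 < eps.
Hypothesis Q1 : forall x : 'rV[R]_n, bform 1%:M x x <= bform Q x x.
Hypothesis Qd : forall x : 'rV[R]_n, eps * bform Q x x <= bform Q (x *m K) x.
Hypothesis QT : Q^T = Q.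
Variable G : 'M[R]_n.
Hypothesis GT : G^T = G.
Hypothesis G0 : forall x : 'rV[R]_n, 0 <= bform G x x.

Local Notation mu := (@lebesgue_measure R).

Let E (u : R) := expmx (- (u *: K)).
Let F (u : R) := (E u)^T *m G *m E u.

Let bform_derive (A : R -> 'M[R]_n) (A' : 'M[R]_n) (x : 'rV[R]_n) (u : R) :
  mxder A u A' -> is_derive u 1 (fun u => bform (A u) x x) (bform A' x x).
Proof.
move=> dA.
have /(_ 0 0) dM := mxderM (mxderM (@mxder_cst R _ _ x u) dA) (@mxder_cst R _ _ x^T u).
apply: (is_derive_eq dM).
by rewrite mul0mx add0r mulmx0 addr0.
Qed.

Let bform_cvg (T : Type) (H : set_system T) (FH : Filter H) (A : T -> 'M[R]_n)
    (B : 'M[R]_n) (x : 'rV[R]_n) :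
  A @ H --> B -> (fun t => bform (A t) x x) @ H --> bform B x x.
Proof.
move=> AB.
apply: (@cvg_coord _ _ _ _ _ (fun t => x *m A t *m x^T)).
apply: cvg_mulmx; last exact: cvg_cst.
by apply: cvg_mulmx; first exact: cvg_cst.
Qed.

Let F_ge0 x u : 0 <= bform (F u) x x.
Proof.
have := G0 (x *m (E u)^T).
by rewrite /bform trmx_mul trmxK !mulmxA.
Qed.

Let F_cont x : continuous (fun u => bform (F u) x x).
Proof.
move=> u; apply/differentiable_continuous/derivable1_diffP.
by have := bform_derive x (mxder_expmx_sandwich K G u).
Qed.

(** The integrand is nonnegative, so the fundamental theorem on the half-line yields its value
    before integrability is known; integrability is then the finiteness of this value. *)
Let integral_bform X (x : 'rV[R]_n) : K^T *m X + X *m K = G ->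
  (\int[mu]_(u in `[0%R, +oo[) (bform (F u) x x)%:E = (bform X x x)%:E)%E.
Proof.
move=> KX.
pose H u := - bform ((E u)^T *m X *m E u) x x.
have dH (u : R) : is_derive u 1 H (bform (F u) x x).
  have d := bform_derive x (mxder_expmx_sandwich K X u).
  apply: (is_derive_eq (is_deriveN d)); rewrite KX /bform.
  by rewrite mulmxN mulNmx mxE opprK.
have cH : continuous H.
  by move=> u; apply/differentiable_continuous/derivable1_diffP.
rewrite (@ge0_continuous_FTC2y _ _ H _ 0).
- rewrite /H /E scale0r oppr0 expmx0 trmx1 mul1mx mulmx1.
  by rewrite -EFinB opprK add0r.
- by move=> u _.
- exact: continuous_subspaceT.
- rewrite -oppr0; apply: cvgN.
  have -> : 0 = bform (0 : 'M[R]_n) x x by rewrite /bform mulmx0 mul0mx mxE.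
  apply: bform_cvg.
  exact: (expmx_sandwich_cvg0 eps0 Q1 Qd QT).
- by move=> u _.
- by apply: cvg_at_right_filter; exact: cH.
- by move=> u _; rewrite derive1E derive_val.
Qed.

Let integrable_bform (x : 'rV[R]_n) : mu.-integrable `[0%R, +oo[ (EFin \o (fun u => bform (F u) x x)).
Proof.
have [X KX] := lyapunov_solution eps0 Q1 Qd QT G.
apply/integrableP; split.
  apply/measurable_EFinP; apply: measurable_funTS; exact: continuous_measurable_fun.
under eq_integral do rewrite /= ger0_norm//.
by rewrite (integral_bform x KX) ltry.
Qed.

(* Polarisation reduces the signed entries to the nonnegative quadratic forms,
   which have [-bform (E^T X E) x x] as a primitive. *)
Lemma lyapunov_integral :
  let S := \matrix_(i, j) \int[mu]_(u in `[0%R, +oo[) F u i j in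
  [/\ K^T *m S + S *m K = G, S^T = S & forall x, 0 <= bform S x x].
Proof.
move=> S.
have [X KX] := lyapunov_solution eps0 Q1 Qd QT G.
have XT : X^T = X.
  apply/eqP; rewrite -subr_eq0; apply/eqP.
  apply: (lyapunov_eq0 eps0 Q1 Qd QT).
  have KXT : K^T *m X^T + X^T *m K = G.
    by rewrite -GT -KX linearD /= !trmx_mul trmxK addrC.
  by rewrite mulmxBr mulmxBl addrACA -opprD KX KXT subrr.
pose d i : 'rV[R]_n := delta_mx 0 i.
have entry (A : 'M[R]_n) i j : bform A (d i) (d j) = A i j.
  rewrite /bform /d -rowE trmx_delta -colE !mxE.
  by [].
have pol (A : 'M[R]_n) i j : A^T = A ->
    A i j = 2^-1 * (bform A (d i + d j) (d i + d j) - bform A (d i) (d i) - bform A (d j) (d j)).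
  move=> AT; rewrite !bformDl !bformDr (bformC (d j) _ AT) !entry; lra.
have FT u : (F u)^T = F u by rewrite /F !trmx_mul trmxK GT mulmxA.
have SX : S = X.
  apply/matrixP => i j; rewrite mxE.
  under eq_Rintegral do rewrite pol//.
  have intB (f g : R -> R) : mu.-integrable `[0%R, +oo[ (EFin \o f) ->
      mu.-integrable `[0%R, +oo[ (EFin \o g) ->
      mu.-integrable `[0%R, +oo[ (EFin \o (fun u => f u - g u)).
    by move=> intf intg; exact: (integrableB _ intf intg).
  have i1 := intB _ _ (integrable_bform (d i + d j)) (integrable_bform (d i)).
  rewrite RintegralZl//; last exact: (intB _ _ i1 (integrable_bform (d j))).
  rewrite RintegralB//; try exact: integrable_bform.
  rewrite RintegralB//; try exact: integrable_bform.
  by rewrite /Rintegral !(integral_bform _ KX) /= -pol.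
split; rewrite SX// => x.
by rewrite -lee_fin -(integral_bform x KX) integral_ge0// => u _; rewrite lee_fin.
Qed.

End lyapunov_integral.

(** * Scalar recursions contracting at rate c / n, and the resulting weights *)

Section perturbed_contraction.
Context {R : realType}.

Lemma harmonic_series_cvgy : (series (@harmonic R)) @ \oo --> +oo.
Proof.
apply: nondecreasing_dvgn_lt; last exact: dvg_harmonic.
by apply/nondecreasing_seqP => n; rewrite seriesSr lerDl harmonic_ge0.
Qed.

(** Subtracting half the target precision [d] removes the forcing term as soon as [e n <= c d / 2].
    What remains is a product of factors [1 - c / (n + 1)], at most [expR] of minus [c] times a tail
    of the harmonic series, which diverges. *)
Lemma contraction_cvg0 (x e : R ^nat) (c : R) : 0 < c ->
  (forall n, 0 <= x n) -> e @ \oo --> (0 : R) ->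
  (\forall n \near \oo, x n.+1 <= (1 - c / n.+1%:R) * x n + e n / n.+1%:R) ->
  x @ \oo --> (0 : R).
Proof.
move=> c0 x0 ecvg [N0 _ hx].
apply/cvgrPdist_le => d d0.
pose d' := d / 2; have d'0 : 0 < d' by rewrite divr_gt0.
have cd : 0 < c * d' by rewrite mulr_gt0.
have [N1 _ he] : \forall n \near \oo, e n <= c * d'.
  move/cvgrPdist_le : ecvg => /(_ _ cd); apply: filterS => n.
  by rewrite sub0r normrN; exact: le_trans (ler_norm _).
have [N2 _ hN2] := nbhs_infty_ger c.
pose N := (N0 + N1 + N2)%N.
pose h := series (@harmonic R).
pose y n := x n - d'.
(* [y N] may be negative, while the induction multiplies exponential bounds by a nonnegative
   constant. *)
pose Y := Num.max (y N) 0.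
have Y0 : 0 <= Y by rewrite le_max lexx orbT.
have ybd k : y (N + k)%N <= Y * expR (- (c * (h (N + k)%N - h N))).
  elim: k => [|k ih].
    by rewrite addn0 subrr mulr0 oppr0 expR0 mulr1 le_max lexx.
  rewrite addnS; set n := (N + k)%N in ih *.
  have nN : (N <= n)%N by rewrite leq_addr.
  have n1 : 0 < n.+1%:R :> R by [].
  have step : y n.+1 <= (1 - c / n.+1%:R) * y n.
    have h1 := hx n (leq_trans (leq_trans (leq_addr _ _) (leq_addr _ _)) nN).
    have h2 := he n (leq_trans (leq_trans (leq_addl _ _) (leq_addr _ _)) nN).
    have h3 : e n / n.+1%:R <= c * d' / n.+1%:R by rewrite ler_pM2r ?invr_gt0.
    have -> : (1 - c / n.+1%:R) * y n =
        (1 - c / n.+1%:R) * x n + c * d' / n.+1%:R - d' by rewrite /y; ring.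
    by rewrite /y lerD2r (le_trans h1)// lerD2l.
  have f0 : 0 <= 1 - c / n.+1%:R.
    rewrite subr_ge0 ler_pdivrMr// mul1r.
    have := hN2 n (leq_trans (leq_addl _ _) nN).
    by move=> /le_trans; apply; rewrite ler_nat.
  apply: (le_trans step); apply: (le_trans (ler_wpM2l f0 ih)).
  have hS : h n.+1 = h n + n.+1%:R^-1 by rewrite /h seriesSr.
  rewrite mulrCA ler_wpM2l// hS.
  apply: (@le_trans _ _ (expR (- (c / n.+1%:R)) * expR (- (c * (h n - h N))))).
    by rewrite ler_wpM2r ?expR_ge0// expR_ge1Dx.
  by rewrite -expRD le_eqVlt; apply/orP; left; apply/eqP; congr expR; ring.
have lim0 : (fun n => Y * expR (- (c * (h n - h N)))) @ \oo --> (0 : R).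
  rewrite -(mulr0 Y); apply: cvgMr.
  apply: (cvg_comp (fun n => c * (h n - h N)) (fun v => expR (- v)) _ (@cvgr_expR R)).
  apply/cvgryPge => B; move/cvgryPge : harmonic_series_cvgy => /(_ (B / c + h N)).
  apply: filterS => n; rewrite -/h => hn.
  by rewrite mulrC -ler_pdivrMr// lerBrDr.
move/cvgrPdist_le : lim0 => /(_ _ d'0)[N3 _ h3].
exists (N + N3)%N => // n /= hn; rewrite sub0r normrN ger0_norm//.
have := h3 n (leq_trans (leq_addl _ _) hn); rewrite sub0r normrN => /(le_trans (ler_norm _)).
have := ybd (n - N)%N; rewrite subnKC ?(leq_trans (leq_addr _ _) hn)//.
rewrite /y /d'; lra.
Qed.

(** Any value above the equilibrium [|B| / c] is propagated by the recursion; the finite sum in the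
    constant covers the indices before it holds. *)
Lemma contraction_bounded (x : R ^nat) (c B : R) : 0 < c ->
  (forall n, 0 <= x n) ->
  (\forall n \near \oo, x n.+1 <= (1 - c / n.+1%:R) * x n + B / n.+1%:R) ->
  exists C, forall n, x n <= C.
Proof.
move=> c0 x0 [N0 _ hx].
have [N2 _ hN2] := nbhs_infty_ger c.
pose N := (N0 + N2)%N.
pose C := \sum_(i < N.+1) x i + `|B| / c.
have BC : `|B| / c <= C by rewrite lerDr sumr_ge0.
exists C => n.
have [nN|Nn] := leqP n N.
  rewrite /C (bigD1 (Ordinal (nN : (n < N.+1)%N)))//= -addrA lerDl addr_ge0//.
    by rewrite sumr_ge0.
  by rewrite divr_ge0// ltW.
rewrite -(subnKC (ltnW Nn)); elim: (n - N)%N => [|k ih].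
  by rewrite addn0 /C big_ord_recr /= -addrA addrCA lerDl addr_ge0 ?sumr_ge0// divr_ge0// ltW.
rewrite addnS; set l := (N + k)%N in ih *.
have lN : (N <= l)%N by rewrite leq_addr.
have l1 : 0 < l.+1%:R :> R by [].
have f0 : 0 <= 1 - c / l.+1%:R.
  rewrite subr_ge0 ler_pdivrMr// mul1r.
  have := hN2 l (leq_trans (leq_addl _ _) lN).
  by move=> /le_trans; apply; rewrite ler_nat.
apply: (le_trans (hx l (leq_trans (leq_addr _ _) lN))).
have h1 := ler_wpM2l f0 ih.
have h2 : B / l.+1%:R <= c * C / l.+1%:R.
  rewrite ler_pM2r ?invr_gt0// (le_trans (ler_norm B))// mulrC -ler_pdivrMr//.
have -> : C = (1 - c / l.+1%:R) * C + c * C / l.+1%:R by ring.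
by rewrite lerD.
Qed.

End perturbed_contraction.

Section weights.
Context {R : realType} (a : R ^nat) (c : R).
Hypothesis a0 : forall n, 0 <= a n.
Hypothesis c0 : 0 < c.
Hypothesis ac : \forall n \near \oo, n%:R * a n <= n.+1%:R - c.

Definition weight (k n : nat) : R := \prod_(k <= j < n) a j.

Lemma weight_ge0 k n : 0 <= weight k n.
Proof. by apply: prodr_ge0. Qed.

(** The common shape of the errors at horizon [n]: an error [d k] made at step [k], amplified by the
    later squared gains, in the scale [n] of the variance. *)
Definition weighted_mean (d : R ^nat) (n : nat) : R :=
  (\sum_(k < n) weight k.+1 n * d k) / n%:R.

Let weighted_meanS d n :
  weighted_mean d n.+1 = n%:R * a n / n.+1%:R * weighted_mean d n + d n / n.+1%:R.
Proof.
rewrite /weighted_mean big_ord_recr /= /weight big_geq// mul1r mulrDl; congr (_ + _).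
have [->|n0] := eqVneq n 0%N; first by rewrite big_ord0 !mul0r.
under eq_bigr => k _ do rewrite big_nat_recr//= mulrAC.
rewrite -mulr_suml; set s := \sum_(_ < n) _.
have n0R : n%:R != 0 :> R by rewrite pnatr_eq0.
have : n.+1%:R != 0 :> R by rewrite pnatr_eq0.
move: (n.+1%:R) => z z0; field.
by rewrite n0R z0.
Qed.

Let weighted_mean_ge0 d n : (forall k, 0 <= d k) -> 0 <= weighted_mean d n.
Proof.
move=> d0; rewrite /weighted_mean divr_ge0// sumr_ge0// => k _.
by rewrite mulr_ge0// weight_ge0.
Qed.

(** The factor in front of the old mean is [n a_n / (n + 1)], which the hypothesis on [a] turns into
    a contraction. *)
Let weighted_mean_step d : (forall k, 0 <= d k) ->
  \forall n \near \oo,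
    weighted_mean d n.+1 <= (1 - c / n.+1%:R) * weighted_mean d n + d n / n.+1%:R.
Proof.
move=> d0; apply: filterS ac => n hn.
rewrite weighted_meanS lerD2r ler_wpM2r ?weighted_mean_ge0//.
by rewrite ler_pdivrMr// mulrBl mul1r divfK.
Qed.

Lemma weighted_mean_cvg0 d : (forall k, 0 <= d k) ->
  d @ \oo --> (0 : R) -> weighted_mean d @ \oo --> (0 : R).
Proof.
move=> d0 dcvg; apply: (contraction_cvg0 c0 _ dcvg) => [n|].
  exact: weighted_mean_ge0.
exact: weighted_mean_step.
Qed.

Lemma weighted_mean_bounded d B : (forall k, 0 <= d k) -> (forall k, d k <= B) ->
  exists C, forall n, weighted_mean d n <= C.
Proof.
move=> d0 dB; apply: (@contraction_bounded _ _ c B c0) => [n|].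
  exact: weighted_mean_ge0.
apply: filterS (weighted_mean_step d0) => n /le_trans; apply.
by rewrite lerD2l ler_wpM2r.
Qed.

(** Extending the horizon from [j] to [j + 1] multiplies [weight] over horizon by the ratio of [a j]
    to [(j + 1) / j], that is by [b j]. Eventually [b j <= 1], so the running product of
    [max 1 (b j)] stops growing at [N]. *)
Lemma weight_le : exists2 C : R, 0 <= C &
  forall k n, (k < n)%N -> k.+1%:R * weight k.+1 n <= C * n%:R.
Proof.
have [N _ hN] := ac.
pose b j := j%:R * a j / j.+1%:R.
pose D n := \prod_(j < n) Num.max 1 (b j).
have DS n : D n.+1 = D n * Num.max 1 (b n) by rewrite /D big_ord_recr.
have D1 n : 1 <= D n.
  elim: n => [|n ih]; first by rewrite /D big_ord0.
  by rewrite DS mulr_ege1// le_max lexx.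
have Dnd : {homo D : m n / (m <= n)%N >-> m <= n}.
  apply/nondecreasing_seqP => n; rewrite DS ler_peMr ?(le_trans ler01)//.
  by rewrite le_max lexx.
have Dst n : D n <= D N.
  have [/Dnd//|Nn] := leqP n N; rewrite -(subnKC (ltnW Nn)).
  elim: (n - N)%N => [|k ih]; rewrite ?addn0// addnS DS max_l ?mulr1//.
  rewrite /b ler_pdivrMr// mul1r (le_trans (hN _ (leq_addr _ _)))//.
  by rewrite gerBl ltW.
exists (D N); first by rewrite (le_trans ler01).
move=> k n kn; apply: (@le_trans _ _ (D n * n%:R)); last by rewrite ler_wpM2r.
rewrite -(subnKC kn); elim: (n - k.+1)%N => [|l ih].
  by rewrite addn0 /weight big_geq// mulr1 ler_peMl.
rewrite addnS; set t := (k.+1 + l)%N in ih *.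
rewrite /weight big_nat_recr /=; last by rewrite leq_addr.
rewrite -/(weight _ _) mulrA DS (le_trans (ler_wpM2r (a0 t) ih))//.
have -> : D t * t%:R * a t = D t * (b t * t.+1%:R) by rewrite /b divfK// mulrA.
rewrite -mulrA ler_wpM2l ?(le_trans ler01)// ler_wpM2r//.
by rewrite le_max lexx orbT.
Qed.

End weights.

(** * Gain matrices, their products and the limiting variance *)

Section mxabs_theory.
Context {R : realType}.

Lemma mxabsD m n (A B : 'M[R]_(m, n)) : mxabs (A + B) <= mxabs A + mxabs B.
Proof.
rewrite /mxabs -big_split; apply: ler_sum => i _ /=.
by rewrite -big_split; apply: ler_sum => j _; rewrite mxE ler_normD.
Qed.

Lemma mxabsZ m n (a : R) (A : 'M[R]_(m, n)) : mxabs (a *: A) = `|a| * mxabs A.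
Proof.
rewrite /mxabs mulr_sumr; apply: eq_bigr => i _.
by rewrite mulr_sumr; apply: eq_bigr => j _; rewrite mxE normrM.
Qed.

Lemma mxabsN m n (A : 'M[R]_(m, n)) : mxabs (- A) = mxabs A.
Proof. by rewrite -scaleN1r mxabsZ normrN normr1 mul1r. Qed.

Lemma mxabs_tr m n (A : 'M[R]_(m, n)) : mxabs A^T = mxabs A.
Proof.
by rewrite /mxabs exchange_big; apply: eq_bigr => i _; apply: eq_bigr => j _; rewrite mxE.
Qed.

Lemma mxabs_le_max n (N : 'M[R]_n) (w : 'cV[R]_n) (C : R) :
  (forall i, w i 0 ^+ 2 <= C) -> `|(w^T *m N *m w) 0 0| <= mxabs N * C.
Proof.
move=> wC; rewrite mxE.
under eq_bigr do rewrite mxE mulr_suml.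
rewrite exchange_big /= (le_trans (ler_norm_sum _ _ _))// /mxabs mulr_suml.
apply: ler_sum => i _; rewrite mulr_suml (le_trans (ler_norm_sum _ _ _))//.
apply: ler_sum => j _; rewrite mxE mulrAC mulrC !normrM ler_wpM2l//.
have nK (u : R) : `|u| ^+ 2 = u ^+ 2 by rewrite real_normK ?num_real.
have := sqr_ge0 (`|w i 0| - `|w j 0|); rewrite sqrrB !nK.
have := wC i; have := wC j; lra.
Qed.

Lemma bform_le_mxabs n (N Q : 'M[R]_n) (x : 'rV[R]_n) :
  (forall x : 'rV[R]_n, bform 1%:M x x <= bform Q x x) ->
  bform N x x <= mxabs N * bform Q x x.
Proof.
move=> Q1; rewrite /bform -[x in x *m N]trmxK; apply: (le_trans (ler_norm _)).
apply: mxabs_le_max => i; rewrite mxE; apply: le_trans (Q1 x).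
rewrite /bform mulmx1 mxE (bigD1 i)//= [x^T _ _]mxE -expr2 lerDl sumr_ge0// => j _.
by rewrite [x^T _ _]mxE -expr2 sqr_ge0.
Qed.

End mxabs_theory.

Section gain_matrices.
Context {R : realType} (p : nat) (K Q : 'M[R]_p) (eps : R) (kap : 'I_p -> R).
Hypothesis eps0 : 0 < eps.
Hypothesis Q1 : forall x : 'rV[R]_p, bform 1%:M x x <= bform Q x x.
Hypothesis Qd : forall x : 'rV[R]_p, eps * bform Q x x <= bform Q (x *m K) x.
Hypothesis QT : Q^T = Q.
Hypothesis kap0 : forall i, 0 <= kap i.

(** For [K = H - 1/2] this is [1 - H], the matrix [c A_F] of the recursion. *)
Let M : 'M[R]_p := (2^-1)%:M - K.

Definition gain (M : 'M[R]_p) (n : nat) : 'M[R]_p :=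
  1%:M + diag_mx (\row_i (n%:R + kap i)^-1) *m M.

Let Q0 x : 0 <= bform Q x x.
Proof.
apply: le_trans (Q1 x); rewrite /bform mulmx1 mxE sumr_ge0// => i _.
by rewrite [x^T _ _]mxE -expr2 sqr_ge0.
Qed.

(** The correction due to the offsets. As [kap / (n + kap)] is [O(1/n)], a gain is [1 + M / n] up to
    [O(1/n^2)], whatever the offsets. *)
Let G n : 'M[R]_p := diag_mx (\row_i (kap i / (n%:R + kap i))) *m M.

Let gainE n : (0 < n)%N -> gain M n = 1%:M + n%:R^-1 *: (M - G n).
Proof.
move=> n0; rewrite /gain /G -[X in X - _]mul1mx -mulmxBl scalemxAl; congr (_ + _ *m _).
apply/matrixP => i j; rewrite !mxE; have [->|ij] := eqVneq i j; last first.
  by rewrite !mulr0n subrr mulr0.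
rewrite !mulr1n; field.
rewrite pnatr_eq0 -lt0n n0 /= gt_eqF//.
by rewrite ltr_pwDl// ltr0n.
Qed.

Let mxabsG : exists2 C : R, 0 <= C & forall n, (0 < n)%N -> mxabs (G n) <= C / n%:R.
Proof.
exists (\sum_i kap i * mxabs M); first by rewrite sumr_ge0// => i _; rewrite mulr_ge0 ?mxabs_ge0.
move=> n n0; apply: (le_trans (mxabsM _ _)).
rewrite -mulr_suml -mulrA (mulrC (mxabs M)) mulrA ler_wpM2r ?mxabs_ge0//.
rewrite /mxabs mulr_suml; apply: ler_sum => i _.
rewrite (bigD1 i)//= big1 ?addr0 => [|j ji]; last first.
  by rewrite !mxE eq_sym (negbTE ji) mulr0n normr0.
rewrite !mxE eqxx mulr1n normrM ger0_norm// ler_wpM2l//.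
rewrite normfV ger0_norm ?addr_ge0// lef_pV2 ?posrE ?ltr0n//; last first.
  by rewrite ltr_pwDl// ltr0n.
by rewrite lerDl.
Qed.

(** Both congruences are needed: [A S A^T] tells how the form changes on rows, [A^T S A] how the
    covariance telescopes along the backward weights. *)
Lemma gain_congr_expansion (S : 'M[R]_p) : exists2 C : R, 0 <= C & forall n, (0 < n)%N ->
  mxabs (gain M n *m S *m (gain M n)^T - S - n%:R^-1 *: (M *m S + S *m M^T)) <= C / n%:R ^+ 2 /\
  mxabs ((gain M n)^T *m S *m gain M n - S - n%:R^-1 *: (M^T *m S + S *m M)) <= C / n%:R ^+ 2.
Proof.
have [C C0 hC] := mxabsG.
pose m := mxabs M; pose s := mxabs S.
have m0 : 0 <= m := mxabs_ge0 _; have s0 : 0 <= s := mxabs_ge0 _.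
exists (2 * C * s + (m + C) * s * (m + C)).
  by rewrite !(addr_ge0, mulr_ge0)//.
move=> n n0; set h := n%:R^-1 : R.
have h0 : 0 < h by rewrite invr_gt0 ltr0n.
have h1 : h <= 1 by rewrite invf_le1 ?ltr0n// ler1n.
have gC : mxabs (G n) <= C * h := hC n n0.
have BC : mxabs (M - G n) <= m + C.
  rewrite (le_trans (mxabsD _ _))// mxabsN lerD2l (le_trans gC)//.
  by rewrite ler_piMr.
have expand (g B g' B' : 'M[R]_p) :
    (1%:M + h *: (B - g)) *m S *m (1%:M + h *: (B' - g')) - S - h *: (B *m S + S *m B')
    = - (h *: (g *m S + S *m g')) + h ^+ 2 *: ((B - g) *m S *m (B' - g')).
  have sandwich (X Y : 'M[R]_p) : (1%:M + h *: X) *m S *m (1%:M + h *: Y) =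
      S + h *: (X *m S + S *m Y) + h ^+ 2 *: (X *m S *m Y).
    rewrite mulmxDl mul1mx -scalemxAl mulmxDr mulmx1 -scalemxAr mulmxDl -scalemxAl.
    by apply/matrixP => i j; rewrite !mxE; ring.
  rewrite sandwich mulmxBl mulmxBr.
  move: (B *m S) (g *m S) (S *m B') (S *m g') => z1 z2 z3 z4.
  move: (_ *m (B' - g')) => z5.
  by apply/matrixP => i j; rewrite !mxE; ring.
have bnd (g B g' B' : 'M[R]_p) : mxabs g <= C * h -> mxabs g' <= C * h ->
    mxabs (B - g) <= m + C -> mxabs (B' - g') <= m + C ->
    mxabs (- (h *: (g *m S + S *m g')) + h ^+ 2 *: ((B - g) *m S *m (B' - g')))
    <= (2 * C * s + (m + C) * s * (m + C)) / n%:R ^+ 2.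
  move=> hg hg' hB hB'.
  rewrite -exprVn -/h (le_trans (mxabsD _ _))// mxabsN !mxabsZ normrX ger0_norm ?(ltW h0)//.
  have e1 : mxabs (g *m S + S *m g') <= 2 * C * h * s.
    rewrite (le_trans (mxabsD _ _))// (le_trans (lerD (mxabsM _ _) (mxabsM _ _)))//.
    have := ler_wpM2r s0 hg; have := ler_wpM2l s0 hg'; rewrite -/s; lra.
  have e2 : mxabs ((B - g) *m S *m (B' - g')) <= (m + C) * s * (m + C).
    rewrite (le_trans (mxabsM _ _))// ler_pM ?mxabs_ge0// (le_trans (mxabsM _ _))//.
    by rewrite ler_wpM2r.
  have := ler_wpM2l (ltW h0) e1; have := ler_wpM2l (sqr_ge0 h) e2; lra.
have gT : (gain M n)^T = 1%:M + h *: (M^T - (G n)^T).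
  rewrite gainE//; move: (G n) => g.
  by apply/matrixP => i j; rewrite !mxE eq_sym.
rewrite gT gainE// -/h.
have BCT : mxabs (M^T - (G n)^T) <= m + C by rewrite -linearB mxabs_tr.
have gCT : mxabs (G n)^T <= C * h by rewrite mxabs_tr.
by split; rewrite expand; exact: bnd.
Qed.

(** Since [M = 1/2 - K], the first order term of the form is at most [(1 - 2 eps) / n]. One of the
    two [eps] survives in the conclusion, the other absorbs the remainder [C / n^2]. *)
Lemma gain_contraction : exists2 a : R ^nat, (forall n, 0 <= a n) &
  (forall n x, bform Q (x *m gain M n) (x *m gain M n) <= a n * bform Q x x) /\
  \forall n \near \oo, n%:R * a n <= n.+1%:R - eps.
Proof.
have [C C0 hC] := gain_congr_expansion Q.
pose b n : R := 1 + n%:R^-1 * (1 - 2 * eps) + C / n%:R ^+ 2.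
(* At [n = 0] the expansion in [1 / n] says nothing, and a crude bound on the form is taken; the
   maximum keeps the rate nonnegative afterwards. *)
exists (fun n => if n == 0%N then mxabs (gain M n *m Q *m (gain M n)^T) else Num.max 0 (b n)).
  by move=> [|n] /=; rewrite ?mxabs_ge0// le_max lexx.
split=> [n x|].
  rewrite bform_mulmx; case: eqP => [_|/eqP n0]; first exact: bform_le_mxabs.
  rewrite -lt0n in n0; have [h _] := hC n n0.
  apply: (@le_trans _ _ (b n * bform Q x x)); last first.
    by rewrite ler_wpM2r// le_max lexx orbT.
  have hx N := @bform_le_mxabs R p N Q x Q1.
  have {hx} := le_trans (hx _) (ler_wpM2r (Q0 x) h).
  have -> : bform (gain M n *m Q *m (gain M n)^T - Q - n%:R^-1 *: (M *m Q + Q *m M^T)) x x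
    = bform (gain M n *m Q *m (gain M n)^T) x x - bform Q x x
      - n%:R^-1 * (2 * bform Q (x *m M) x).
    have eM : bform (M *m Q + Q *m M^T) x x = 2 * bform Q (x *m M) x.
      have -> : bform (M *m Q + Q *m M^T) x x = bform Q (x *m M) x + bform Q x (x *m M).
        by rewrite /bform mulmxDr mulmxDl mxE trmx_mul !mulmxA.
      by rewrite (bformC x _ QT) mulrDl !mul1r.
    by rewrite -eM /bform !mulmxBr !mulmxBl -scalemxAr -scalemxAl !mxE.
  have -> : bform Q (x *m M) x = 2^-1 * bform Q x x - bform Q (x *m K) x.
    rewrite /M mulmxBr mul_mx_scalar bformDl -scaleN1r !bformZl; ring.
  have hn : 0 < n%:R^-1 :> R by rewrite invr_gt0 ltr0n.
  have := ler_wpM2l (ltW hn) (Qd x); rewrite /b; lra.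
(* [C / eps] makes [C / n <= eps]; the extra [eps] handles the branch where the maximum is 0. *)
have [N _ hN] := nbhs_infty_ger (C / eps + eps).
exists N.+1 => // n /= Nn; have n0 : (0 < n)%N by apply: leq_trans Nn.
have nr0 : 0 < n%:R :> R by rewrite ltr0n.
have {hN} hn : C / eps + eps <= n%:R := hN n (ltnW Nn).
have Ce : 0 <= C / eps by rewrite divr_ge0// ltW.
rewrite gtn_eqF// maxr_pMr// mulr0 ge_max; apply/andP; split.
  by rewrite -natr1; lra.
have -> : n%:R * b n = n%:R + 1 - 2 * eps + C / n%:R.
  by rewrite /b; field; rewrite gt_eqF.
suff : C / n%:R <= eps by rewrite -natr1; lra.
by rewrite ler_pdivrMr// mulrC -ler_pdivrMr// (le_trans _ hn)// lerDl ltW.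
Qed.

End gain_matrices.

Section gain_products.
Context {R : realType} (p : nat) (K Q : 'M[R]_p) (eps : R) (kap : 'I_p -> R).
Hypothesis eps0 : 0 < eps.
Hypothesis Q1 : forall x : 'rV[R]_p, bform 1%:M x x <= bform Q x x.
Hypothesis Qd : forall x : 'rV[R]_p, eps * bform Q x x <= bform Q (x *m K) x.
Hypothesis QT : Q^T = Q.
Hypothesis kap0 : forall i, 0 <= kap i.

Let M : 'M[R]_p := (2^-1)%:M - K.

Definition gain_prod (M : 'M[R]_p) (k n : nat) : 'M[R]_p := \prod_(k <= j < n) gain kap M j.

Lemma gain_prod_id M' n : gain_prod M' n n = 1%:M.
Proof. by rewrite /gain_prod big_geq. Qed.

Lemma gain_prod_ltn M' k n : (k < n)%N ->
  gain_prod M' k n = gain kap M' k *m gain_prod M' k.+1 n.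
Proof. by move=> kn; rewrite /gain_prod big_ltn. Qed.

Definition gain_weight (u : 'rV[R]_p) (k n : nat) : 'cV[R]_p := gain_prod M k n *m u^T.

Lemma gain_weight_id u n : gain_weight u n n = u^T.
Proof. by rewrite /gain_weight gain_prod_id mul1mx. Qed.

Lemma gain_weight_ltn u k n : (k < n)%N ->
  gain_weight u k n = gain kap M k *m gain_weight u k.+1 n.
Proof. by move=> kn; rewrite /gain_weight gain_prod_ltn// mulmxA. Qed.

Lemma bform_gain_prod (a : R ^nat) (x : 'rV[R]_p) k n : (k <= n)%N ->
  (forall n, 0 <= a n) ->
  (forall n x, bform Q (x *m gain kap M n) (x *m gain kap M n) <= a n * bform Q x x) ->
  bform Q (x *m gain_prod M k n) (x *m gain_prod M k n) <= weight a k n * bform Q x x.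
Proof.
move=> kn a0 ha; rewrite -(subnKC kn); elim: (n - k)%N => [|l ih].
  by rewrite addn0 gain_prod_id /weight big_geq// mulmx1 mul1r.
rewrite addnS /gain_prod /weight !big_nat_recr/= ?leq_addr//.
rewrite -[X in bform Q (x *m X)]/(gain_prod M k (k + l) *m gain kap M (k + l)).
rewrite -[X in bform Q _ (x *m X)]/(gain_prod M k (k + l) *m gain kap M (k + l)).
rewrite mulmxA (le_trans (ha _ _))// mulrC mulrAC ler_wpM2r//.
Qed.

Lemma cauchy_schwarz_row (x u : 'rV[R]_p) :
  (x *m u^T) 0 0 ^+ 2 <= bform 1%:M x x * bform 1%:M u u.
Proof.
have pos (y : 'rV[R]_p) : 0 <= bform 1%:M y y.
  rewrite /bform mulmx1 mxE sumr_ge0// => i _.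
  by rewrite [y^T _ _]mxE -expr2 sqr_ge0.
have bE (y z : 'rV[R]_p) : bform 1%:M y z = (y *m z^T) 0 0 by rewrite /bform mulmx1.
rewrite -bE; set s := bform _ x u; set A := bform _ x x; set B := bform _ u u.
have q (l : R) : 0 <= A + 2 * l * s + l ^+ 2 * B.
  have := pos (x + l *: u).
  rewrite !(bformDl, bformDr, bformZl, bformZr) (bformC u x (trmx1 _ _)) -/s -/A -/B.
  by congr (0 <= _); ring.
have B0 : 0 <= B := pos u.
have [BE|Bn] := eqVneq B 0.
  rewrite BE mulr0; have [->|sn] := eqVneq s 0; first by rewrite expr0n.
  (* When [B = 0] the quadratic is affine in [l], and this value of [l] would make it [-1]. *)
  have := q (- (A + 1) / (2 * s)); rewrite BE mulr0 addr0.
  have -> : A + 2 * (- (A + 1) / (2 * s)) * s = -1 by field.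
  by rewrite ler0N1.
have Bp : 0 < B by rewrite lt_def Bn.
have := q (- s / B).
have -> : A + 2 * (- s / B) * s + (- s / B) ^+ 2 * B = A - s ^+ 2 / B by field.
by rewrite subr_ge0 ler_pdivrMr.
Qed.

(** The contraction concerns rows multiplied by gains, whereas the weight is a column. Entry [i] of
    the weight pairs [u] with the row [delta_i] times the product, and Cauchy-Schwarz transfers the
    bound. *)
Lemma gain_weight_bound (u : 'rV[R]_p) (a : R ^nat) : (forall n, 0 <= a n) ->
  (forall n x, bform Q (x *m gain kap M n) (x *m gain kap M n) <= a n * bform Q x x) ->
  exists2 C : R, 0 <= C & forall k n, (k <= n)%N -> forall i,
    gain_weight u k n i 0 ^+ 2 <= C * weight a k n.
Proof.
move=> a0 ha; pose c i := bform Q (delta_mx 0 i : 'rV[R]_p) (delta_mx 0 i).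
have pos (y : 'rV[R]_p) : 0 <= bform 1%:M y y.
  rewrite /bform mulmx1 mxE sumr_ge0// => i _.
  by rewrite [y^T _ _]mxE -expr2 sqr_ge0.
have cpos i : 0 <= c i by rewrite (le_trans (pos _) (Q1 _)).
exists ((\sum_i c i) * bform 1%:M u u).
  by rewrite mulr_ge0 ?sumr_ge0.
move=> k n kn i.
have -> : gain_weight u k n i 0 = (((delta_mx 0 i : 'rV[R]_p) *m gain_prod M k n) *m u^T) 0 0.
  by rewrite -mulmxA -rowE [RHS]mxE.
rewrite (le_trans (cauchy_schwarz_row _ _))// mulrAC ler_wpM2r//.
rewrite (le_trans (Q1 _))// (le_trans (bform_gain_prod _ kn a0 ha))// mulrC.
rewrite ler_wpM2r ?weight_ge0// (bigD1 i)//= lerDl sumr_ge0//.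
Qed.

(* Telescoping [k w_k^T S w_k] with [w_k] the backward weights: by the Lyapunov
   equation each increment is [w_(k+1)^T G w_(k+1)] up to [O(1/k)]. *)
Lemma gain_covariance_cvg (S G : 'M[R]_p) (u : 'rV[R]_p) :
  K^T *m S + S *m K = G ->
  (fun n => (\sum_(k < n) ((gain_weight u k.+1 n)^T *m G *m gain_weight u k.+1 n) 0 0) / n%:R)
    @ \oo --> bform S u u.
Proof.
move=> KS.
have [a a0 [ha hac]] := gain_contraction eps0 Q1 Qd QT kap0.
have [C C0 hC] := gain_weight_bound u a0 ha.
have [D D0 hD] := gain_congr_expansion K kap0 S.
pose A k := gain kap M k.
pose E k : 'M[R]_p := k%:R *: ((A k)^T *m S *m A k) + G - k.+1%:R *: S.
pose d k := C * mxabs (E k).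
have EE k : (0 < k)%N -> mxabs (E k) <= D / k%:R.
  move=> k0; have kr : 0 < k%:R :> R by rewrite ltr0n.
  have [_ h] := hD k k0.
  have -> : E k = k%:R *: ((A k)^T *m S *m A k - S - k%:R^-1 *: (M^T *m S + S *m M)).
    rewrite !scalerBr scalerA divff ?gt_eqF// scale1r /E -KS /M.
    rewrite linearB /= tr_scalar_mx mulmxBl mulmxBr mul_scalar_mx mul_mx_scalar -natr1.
    move: (K^T *m S) (S *m K) (_ *m A k) => z1 z2 z3.
    by apply/matrixP => i j; rewrite !mxE; field.
  rewrite mxabsZ normr_nat (le_trans (ler_wpM2l (ltW kr) h))//.
  by rewrite le_eqVlt; apply/orP; left; apply/eqP; field; rewrite gt_eqF.
have d0 k : 0 <= d k by rewrite mulr_ge0 ?mxabs_ge0.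
have dcvg : d @ \oo --> (0 : R).
  rewrite -(mulr0 C); apply: cvgMr.
  (* [harmonic k] is [1 / (k + 1)], hence the predecessor for a bound in [1 / k]. *)
  have h0 : (fun k => D * harmonic k.-1) @ \oo --> (0 : R).
    rewrite -(mulr0 D); apply: cvgMr; rewrite -cvg_shiftS /=.
    exact: cvg_harmonic.
  apply: (@squeeze_cvgr _ _ _ _ (cst 0) _ _ _ _ _ h0); last exact: cvg_cst.
  exists 1%N => // k /= k0; rewrite mxabs_ge0 /=.
  by rewrite (le_trans (EE k k0))// prednK.
have wm := weighted_mean_cvg0 a0 eps0 hac d0 dcvg.
pose w n k := gain_weight u k n.
have main n : (0 < n)%N ->
    (\sum_(k < n) ((w n k.+1)^T *m G *m w n k.+1) 0 0) / n%:R =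
    bform S u u + (\sum_(k < n) ((w n k.+1)^T *m E k *m w n k.+1) 0 0) / n%:R.
  move=> n0; have nr : n%:R != 0 :> R by rewrite pnatr_eq0 -lt0n.
  (* The factor [k] kills the term at 0, and at [k = n] the weight is [u^T] itself. *)
  have tele : \sum_(0 <= k < n) (k.+1%:R * ((w n k.+1)^T *m S *m w n k.+1) 0 0
      - k%:R * ((w n k)^T *m S *m w n k) 0 0) = n%:R * bform S u u.
    rewrite telescope_sumr// mul0r subr0 /w gain_weight_id trmxK.
    by [].
  apply: (mulIf nr); rewrite mulrDl !divfK//.
  rewrite [bform _ _ _ * _]mulrC -tele big_mkord -big_split /=; apply: eq_bigr => k _.
  have -> : w n k = A k *m w n k.+1 by rewrite /w gain_weight_ltn.
  move: (w n k.+1) => v; rewrite trmx_mul.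
  have -> : v^T *m (A k)^T *m S *m (A k *m v) = v^T *m ((A k)^T *m S *m A k) *m v.
    by rewrite !mulmxA.
  rewrite /E; move: ((A k)^T *m S *m A k) => z.
  rewrite mulmxBr mulmxBl mulmxDr mulmxDl -!scalemxAr -!scalemxAl !mxE; ring.
have err n : `|(\sum_(k < n) ((w n k.+1)^T *m E k *m w n k.+1) 0 0) / n%:R| <= weighted_mean a d n.
  rewrite /weighted_mean normrM normfV normr_nat ler_wpM2r ?invr_ge0//.
  rewrite (le_trans (ler_norm_sum _ _ _))//; apply: ler_sum => k _.
  rewrite (le_trans (mxabs_le_max _ (fun i => hC _ _ (ltn_ord k) i)))//.
  by rewrite /d mulrC mulrA [leLHS]mulrAC mulrC mulrA.
have e0 : (fun n => (\sum_(k < n) ((w n k.+1)^T *m E k *m w n k.+1) 0 0) / n%:R) @ \oo --> (0 : R).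
  apply/norm_cvg0P; apply: (@squeeze_cvgr _ _ _ _ (cst 0) _ _ _ _ _ wm); last exact: cvg_cst.
  by apply: nearW => n; rewrite normr_ge0 /= err.
rewrite -[X in _ --> X]addr0.
apply: cvg_trans (cvgD (cvg_cst (bform S u u)) e0).
apply: near_eq_cvg; exists 1%N => // n /= n0.
by rewrite main.
Qed.

End gain_products.

(** * Taylor bounds for the cosine and the exponential *)

Section trig_bounds.
Context {R : realType}.
Implicit Types x y : R.

(** Drives the chain of inequalities that follows: each is an equality at 0, and its derivative is
    either an elementary bound on sine or cosine or an inequality already obtained. *)
Lemma nonneg_of_derive (f df : R -> R) x : 0 <= x -> f 0 = 0 ->
  (forall t, is_derive t (1 : R) f (df t)) -> (forall t, 0 <= t -> 0 <= df t) -> 0 <= f x.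
Proof.
move=> x0 f0 dfE df0; rewrite -f0.
have der (t : R) : t \in `]0, x[ -> derivable f t 1 by [].
have d0 (t : R) : t \in `]0, x[ -> 0 <= derive1 f t.
  by rewrite in_itv /= => /andP[/ltW t0 _]; rewrite derive1E derive_val df0.
have cf : {within `[0, x], continuous f} by exact: derivable_within_continuous.
by apply: (ger0_derive1_le_cc der d0 cf); rewrite ?in_itv /= ?lexx ?x0.
Qed.

Lemma onem_cos_le x : 0 <= x -> 1 - cos x <= x.
Proof.
move=> x0; rewrite -subr_ge0.
apply: (@nonneg_of_derive (fun t => t - (1 - cos t)) (fun t => 1 - sin t) _ x0 _ _ _).
- by rewrite cos0 !subrr.
- by move=> t; apply: is_derive_eq; ring.
- by move=> t _; rewrite subr_ge0 sin_le1.
Qed.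

Lemma sin_le_id x : 0 <= x -> sin x <= x.
Proof.
move=> x0; rewrite -subr_ge0.
apply: (@nonneg_of_derive (fun t => t - sin t) (fun t => 1 - cos t) _ x0 _ _ _).
- by rewrite sin0 subrr.
- by move=> t _; rewrite subr_ge0 cos_le1.
Qed.

Let derX n (t : R) : is_derive t 1 (fun s : R => s ^+ n.+1) (n.+1%:R * t ^+ n).
Proof.
elim: n => [|n ih].
  by rewrite expr0 mulr1; exact: is_derive_id.
under [X in is_derive _ _ X]eq_fun do rewrite exprS.
apply: (is_derive_eq (is_deriveM (is_derive_id t 1) ih)).
by rewrite /GRing.scale /= -[in RHS]natr1 exprS; ring.
Qed.

Let derZ (f : R -> R) (a t d : R) : is_derive t 1 f d ->
  is_derive t 1 (fun s => a * f s) (a * d).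
Proof. by move=> fd; exact: (is_derive_eq (is_deriveZ a fd)). Qed.

Lemma id_sub_sin_le x : 0 <= x -> x - sin x <= 2^-1 * x ^+ 2.
Proof.
move=> x0; rewrite -subr_ge0.
apply: (@nonneg_of_derive (fun t => 2^-1 * t ^+ 2 - (t - sin t)) (fun t => t - (1 - cos t)) _ x0 _ _ _).
- by rewrite sin0 expr0n /= mulr0 !subrr.
- move=> t; have d := derZ 2^-1 (derX 1 t).
  by apply: is_derive_eq; rewrite ?expr1 /GRing.scale /=; field.
- by move=> t t0; rewrite subr_ge0 onem_cos_le.
Qed.

Lemma cos_ge x : 0 <= x -> 1 - cos x <= 2^-1 * x ^+ 2.
Proof.
move=> x0; rewrite -subr_ge0.
apply: (@nonneg_of_derive (fun t => 2^-1 * t ^+ 2 - (1 - cos t)) (fun t => t - sin t) _ x0 _ _ _).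
- by rewrite cos0 expr0n /= mulr0 !subrr.
- move=> t; have d := derZ 2^-1 (derX 1 t).
  by apply: is_derive_eq; rewrite ?expr1 /GRing.scale /=; field.
- by move=> t t0; rewrite subr_ge0 sin_le_id.
Qed.

Lemma cos_le x : 0 <= x -> 2^-1 * x ^+ 2 - (1 - cos x) <= 6^-1 * x ^+ 3.
Proof.
move=> x0; rewrite -subr_ge0.
apply: (@nonneg_of_derive (fun t => 6^-1 * t ^+ 3 - (2^-1 * t ^+ 2 - (1 - cos t)))
  (fun t => 2^-1 * t ^+ 2 - (t - sin t)) _ x0 _ _ _).
- by rewrite cos0 !expr0n /= !mulr0 !subrr.
- move=> t; have d := derZ 2^-1 (derX 1 t); have d' := derZ 6^-1 (derX 2 t).
  by apply: is_derive_eq; rewrite ?expr1 /GRing.scale /=; field.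
- by move=> t t0; rewrite subr_ge0 id_sub_sin_le.
Qed.

Lemma sin_ge x : 0 <= x -> x - sin x <= 6^-1 * x ^+ 3.
Proof.
move=> x0; rewrite -subr_ge0.
apply: (@nonneg_of_derive (fun t => 6^-1 * t ^+ 3 - (t - sin t))
  (fun t => 2^-1 * t ^+ 2 - (1 - cos t)) _ x0 _ _ _).
- by rewrite sin0 !expr0n /= !mulr0 !subrr.
- move=> t; have d' := derZ 6^-1 (derX 2 t).
  by apply: is_derive_eq; field.
- by move=> t t0; rewrite subr_ge0 cos_ge.
Qed.

Lemma cos_taylor2 y x :
  `|cos (y + x) - (cos y - x * sin y - x ^+ 2 / 2 * cos y)| <= `|x| ^+ 3.
Proof.
have nx0 : 0 <= `|x| by [].
have hc : `|cos x - 1 + x ^+ 2 / 2| <= 6^-1 * `|x| ^+ 3.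
  have -> : cos x = cos `|x| by case: (ger0P x) => // _; rewrite cosN.
  have -> : x ^+ 2 = `|x| ^+ 2 by rewrite real_normK ?num_real.
  have h1 := cos_ge nx0; have h2 := cos_le nx0.
  by rewrite ler_norml; apply/andP; split; have := exprn_ge0 3 nx0; lra.
have hs : `|x - sin x| <= 6^-1 * `|x| ^+ 3.
  have -> : `|x - sin x| = `| `|x| - sin `|x| |.
    by case: (ger0P x) => // _; rewrite sinN -opprD normrN.
  have h1 := sin_le_id nx0; have h2 := sin_ge nx0.
  by rewrite ger0_norm; lra.
have -> : cos (y + x) - (cos y - x * sin y - x ^+ 2 / 2 * cos y) =
    cos y * (cos x - 1 + x ^+ 2 / 2) + sin y * (x - sin x) by rewrite cosD; ring.
rewrite (le_trans (ler_normD _ _))// !normrM.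
have e1 := ler_pM (normr_ge0 _) (normr_ge0 _) (cos_max y) hc.
have e2 := ler_pM (normr_ge0 _) (normr_ge0 _) (sin_max y) hs.
have := exprn_ge0 3 nx0; lra.
Qed.

Lemma expRN_taylor1 x : 0 <= x -> `|expR (- x) - (1 - x)| <= x ^+ 2.
Proof.
move=> x0; rewrite ger0_norm ?subr_ge0 ?expR_ge1Dx// expRN.
have x1 : 0 < 1 + x by lra.
have h : (expR x)^-1 <= (1 + x)^-1 by rewrite lef_pV2 ?posrE ?expR_gt0// expR_ge1Dx.
have h2 : (1 + x)^-1 <= 1 - x + x ^+ 2.
  rewrite -[leLHS]mul1r ler_pdivrMr//.
  have -> : (1 - x + x ^+ 2) * (1 + x) = 1 + x ^+ 3 by ring.
  by rewrite lerDl exprn_ge0.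
lra.
Qed.

End trig_bounds.

(** * Product Bernoulli laws and their first two moments *)

Section bernoulli_product.
Context {R : realType} (I : finType).
Implicit Types (z : I -> R) (y : {ffun I -> bool}).

(** The product Bernoulli law with parameters [z]. It serves twice: as the law of one round of
    draws, and as the weights of a Bernstein-type approximation. *)
Definition bern z y : R := \prod_i (if y i then z i else 1 - z i).

(** Independence in the form of distributivity. The mean and the covariances follow by taking [h i]
    equal to 1 outside one or two indices. *)
Lemma bern_sum_prod z (h : I -> bool -> R) :
  \sum_y bern z y * \prod_i h i (y i) =
  \prod_i (z i * h i true + (1 - z i) * h i false).
Proof.
under [RHS]eq_bigr => i _.
  rewrite -[X in X + _]/((if true then z i else 1 - z i) * h i true).
  rewrite -[X in _ + X]/((if false then z i else 1 - z i) * h i false).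
  rewrite -(big_bool _ (fun b : bool => (if b then z i else 1 - z i) * h i b)).
  over.
rewrite bigA_distr_bigA; apply: eq_bigr => y _.
by rewrite /bern -big_split.
Qed.

Lemma bern_sum1 z : \sum_y bern z y = 1.
Proof.
have h := bern_sum_prod z (fun=> fun=> 1).
rewrite [RHS]big1 in h; last by move=> i _; rewrite !mulr1 addrC subrK.
by rewrite -[RHS]h; apply: eq_bigr => y _; rewrite big1 ?mulr1.
Qed.

Lemma bern_ge0 z y : (forall i, 0 <= z i <= 1) -> 0 <= bern z y.
Proof.
move=> z01; apply: prodr_ge0 => i _; have /andP[z0 z1] := z01 i.
by case: ifP; rewrite ?subr_ge0.
Qed.

Lemma bern_mean z j : \sum_y bern z y * ((y j)%:R - z j) = 0.
Proof.
pose h i (b : bool) : R := if i == j then b%:R - z j else 1.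
transitivity (\sum_y bern z y * \prod_i h i (y i)).
  apply: eq_bigr => y _; congr (_ * _).
  by rewrite (bigD1 j)//= big1 ?mulr1 /h ?eqxx// => i /negbTE ->.
rewrite bern_sum_prod (bigD1 j)//= [X in X * _](_ : _ = 0) ?mul0r//.
by rewrite /h eqxx /=; ring.
Qed.

Lemma bern_cov z j l :
  \sum_y bern z y * (((y j)%:R - z j) * ((y l)%:R - z l)) =
  if j == l then z j * (1 - z j) else 0.
Proof.
pose h i (b : bool) : R := (if i == j then b%:R - z j else 1) *
                           (if i == l then b%:R - z l else 1).
transitivity (\sum_y bern z y * \prod_i h i (y i)).
  apply: eq_bigr => y _; congr (_ * _).
  rewrite /h big_split /=; congr (_ * _).
    by rewrite (bigD1 j)//= big1 ?mulr1 ?eqxx// => i /negbTE ->.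
  by rewrite (bigD1 l)//= big1 ?mulr1 ?eqxx// => i /negbTE ->.
rewrite bern_sum_prod (bigD1 j)//=; case: eqVneq => [jl|jl].
  rewrite big1 ?mulr1 => [|i ij]; rewrite /h -?jl.
    by rewrite eqxx /=; ring.
  by rewrite (negbTE ij) !mulr1; ring.
rewrite [X in X * _](_ : _ = 0) ?mul0r// /h eqxx (negbTE jl) !mulr1 /=; ring.
Qed.

Definition bern_lin (al : I -> R) z y : R := \sum_j al j * ((y j)%:R - z j).

Lemma bern_lin_mean al z : \sum_y bern z y * bern_lin al z y = 0.
Proof.
under eq_bigr do rewrite mulr_sumr.
rewrite exchange_big /= big1// => j _.
under eq_bigr do rewrite mulrCA.
by rewrite -mulr_sumr bern_mean mulr0.
Qed.

Lemma bern_lin_var al z :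
  \sum_y bern z y * bern_lin al z y ^+ 2 = \sum_j al j ^+ 2 * (z j * (1 - z j)).
Proof.
have key j l : \sum_y bern z y *
      (al j * ((y j)%:R - z j) * (al l * ((y l)%:R - z l))) =
    al j * al l * (if j == l then z j * (1 - z j) else 0).
  by rewrite -bern_cov mulr_sumr; apply: eq_bigr => y _; ring.
transitivity (\sum_j \sum_l \sum_y bern z y *
      (al j * ((y j)%:R - z j) * (al l * ((y l)%:R - z l)))).
  under [RHS]eq_bigr do rewrite exchange_big.
  rewrite exchange_big; apply: eq_bigr => y _.
  rewrite /bern_lin expr2 mulr_suml mulr_sumr; apply: eq_bigr => j _.
  by rewrite mulr_sumr mulr_sumr.
apply: eq_bigr => j _; rewrite (bigD1 j)//= [X in _ + X]big1 ?addr0 => [|l lj].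
  by rewrite /= key eqxx expr2.
by rewrite /= key eq_sym (negbTE lj) mulr0.
Qed.

Lemma bern_lin_bound al z y : (forall i, 0 <= z i <= 1) ->
  `|bern_lin al z y| <= \sum_j `|al j|.
Proof.
move=> z01; rewrite (le_trans (ler_norm_sum _ _ _))//; apply: ler_sum => j _.
rewrite normrM ler_piMr// ler_norml; have /andP[h0 h1] := z01 j.
by case: (y j) => /=; apply/andP; split; lra.
Qed.

End bernoulli_product.

(** * Lindeberg replacement for an abstract Markov expectation *)

Section lindeberg.
Context {R : realType} (N : nat).
(** [Ex t f] stands for the expectation of [f] at the state of time [t]. Only linearity,
    monotonicity on the set [V] of admissible states and the one-step transition are assumed, which
    keeps measure theory out of the argument. *)
Variable Ex : nat -> ('rV[R]_N -> R) -> R.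
Variable V : set 'rV[R]_N.
Variable G : nat -> 'rV[R]_N -> {ffun 'I_N -> bool} -> 'rV[R]_N.
Hypothesis V01 : forall z, V z -> forall i, 0 <= z 0 i <= 1.
Hypothesis ExD : forall t f g, Ex t (fun z => f z + g z) = Ex t f + Ex t g.
Hypothesis ExZ : forall t a f, Ex t (fun z => a * f z) = a * Ex t f.
Hypothesis Ex_le : forall t f g, (forall z, V z -> f z <= g z) -> Ex t f <= Ex t g.
Hypothesis Ex1 : forall t, Ex t (fun=> 1) = 1.
Hypothesis ExS : forall t f, Ex t.+1 f = Ex t (fun z => \sum_y bern (z 0) y * f (G t z y)).

Let Ex_eq t f g : (forall z, V z -> f z = g z) -> Ex t f = Ex t g.
Proof. by move=> fg; apply/eqP; rewrite eq_le !Ex_le// => z Vz; rewrite fg. Qed.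

Let Ex_norm_le t f g : (forall z, V z -> `|f z| <= g z) -> `|Ex t f| <= Ex t g.
Proof.
move=> fg; rewrite ler_norml -mulN1r -ExZ; apply/andP; split; apply: Ex_le => z /fg.
  by rewrite ler_norml mulN1r => /andP[].
by rewrite ler_norml => /andP[].
Qed.

Let ExC t a : Ex t (fun=> a) = a.
Proof. by rewrite -[RHS]mulr1 -(Ex1 t) -ExZ; apply: Ex_eq => z _; rewrite mulr1. Qed.

Variables (n : nat) (m : nat -> 'rV[R]_N -> R) (al : nat -> 'I_N -> R).
Hypothesis mS : forall k z y, (k < n)%N -> V z ->
  m k.+1 (G k z y) = m k z + bern_lin (al k) (z 0) y.

Let A k := \sum_j `|al k j|.
Let v k (z : 'rV[R]_N) := \sum_j al k j ^+ 2 * (z 0 j * (1 - z 0 j)).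

Let A0 k : 0 <= A k. Proof. exact: sumr_ge0. Qed.

(** Second order Taylor expansion averaged over one round of draws: the linear term has mean 0 and
    the quadratic one produces the conditional variance [v k z]. *)
Let cos_step phi k z : (k < n)%N -> V z ->
  `|\sum_y bern (z 0) y * cos (m k.+1 (G k z y) + phi) - cos (m k z + phi) * (1 - v k z / 2)|
  <= A k ^+ 3.
Proof.
move=> kn Vz; set x := m k z + phi.
have -> : cos x * (1 - v k z / 2) =
    \sum_y bern (z 0) y * (cos x - bern_lin (al k) (z 0) y * sin x
                       - bern_lin (al k) (z 0) y ^+ 2 / 2 * cos x).
  transitivity (\sum_y (cos x * bern (z 0) y - sin x * (bern (z 0) y * bern_lin (al k) (z 0) y)
      - cos x / 2 * (bern (z 0) y * bern_lin (al k) (z 0) y ^+ 2))).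
    rewrite !sumrB -!mulr_sumr bern_sum1 bern_lin_mean bern_lin_var -/(v k z).
    by field.
  by apply: eq_bigr => y _; field.
rewrite -sumrB (le_trans (ler_norm_sum _ _ _))//.
apply: (@le_trans _ _ (\sum_y bern (z 0) y * A k ^+ 3)).
  apply: ler_sum => y _; rewrite -mulrBr normrM ger0_norm ?bern_ge0 ?V01//.
    rewrite ler_wpM2l ?bern_ge0//; first exact: V01.
    rewrite mS// addrAC -/x (le_trans (cos_taylor2 _ _))//.
    by rewrite lerXn2r ?nnegrE// bern_lin_bound//; exact: V01.
  by move=> i; exact: V01.
by rewrite -mulr_suml bern_sum1 mul1r.
Qed.

(** Each step is compared with multiplication by [expR (- s k / 2)], a factor at most 1, so earlier
    errors are never amplified and simply add up. The three terms come from replacing the random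
    variance by [s k], linearising the exponential, and the Taylor remainder. *)
Lemma lindeberg_cos (s : R ^nat) phi k : (forall j, 0 <= s j) -> (k <= n)%N ->
  `|Ex k (fun z => cos (m k z + phi)) -
     expR (- (\sum_(j < k) s j / 2)) * Ex 0 (fun z => cos (m 0 z + phi))| <=
  \sum_(j < k) (2^-1 * Ex j (fun z => `|v j z - s j|) + (s j / 2) ^+ 2 + A j ^+ 3).
Proof.
move=> s0; elim: k => [_|k ih kn].
  by rewrite !big_ord0 oppr0 expR0 mul1r subrr normr0.
rewrite !big_ord_recr /= opprD expRD.
set X := Ex k (fun z => cos (m k z + phi)) in ih *.
set Y := expR (- \sum_(i < k) _) in ih *; set Z := Ex 0 _ in ih *.
set D := expR (- (s k / 2)).
have D1 : `|D| <= 1.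
  by rewrite ger0_norm ?expR_ge0// -[leRHS]expR0 ler_expR oppr_le0 divr_ge0.
have -> : Ex k.+1 (fun z => cos (m k.+1 z + phi)) - Y * D * Z =
  D * (X - Y * Z) + (Ex k.+1 (fun z => cos (m k.+1 z + phi)) - D * X) by ring.
rewrite (le_trans (ler_normD _ _))//; apply: lerD.
  by rewrite normrM (le_trans (ler_piMl _ D1))// ih// ltnW.
rewrite ExS /X -mulN1r -!ExZ -ExD.
have -> : Ex k (fun z => 2^-1 * `|v k z - s k|) + (s k / 2) ^+ 2 + A k ^+ 3 =
    Ex k (fun z => 2^-1 * `|v k z - s k| + (s k / 2) ^+ 2 + A k ^+ 3).
  by rewrite !ExD !ExC.
apply: Ex_norm_le => z Vz; rewrite mulN1r.
have h1 := cos_step phi kn Vz.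
have h2 := expRN_taylor1 (divr_ge0 (s0 k) (ler0n R 2)).
set x := m k z + phi in h1 *; set S := \sum_y _ in h1 *.
have -> : S - D * cos x = (S - cos x * (1 - v k z / 2)) - 2^-1 * (cos x * (v k z - s k))
   - cos x * (D - (1 - s k / 2)) by field.
rewrite (le_trans (ler_normB _ _))// [leRHS]addrC addrA; apply: lerD; last first.
  rewrite normrM (le_trans (ler_wpM2r _ (cos_max _)))// mul1r; exact: h2.
rewrite (le_trans (ler_normB _ _))//; apply: lerD => //.
rewrite !normrM ger0_norm// ler_wpM2l//.
by rewrite (le_trans (ler_wpM2r _ (cos_max _)))// mul1r.
Qed.

(** Orthogonality of martingale increments: the cross term vanishes because [bern_lin] has mean
    0. *)
Lemma second_moment_bound k : (k <= n)%N ->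
  Ex k (fun z => m k z ^+ 2) <= Ex 0 (fun z => m 0 z ^+ 2) + \sum_(j < k) A j ^+ 2.
Proof.
elim: k => [_|k ih kn]; first by rewrite big_ord0 addr0.
rewrite big_ord_recr /= addrA ExS.
apply: (@le_trans _ _ (Ex k (fun z => m k z ^+ 2 + A k ^+ 2))); last first.
  by rewrite ExD ExC lerD2r ih// ltnW.
apply: Ex_le => z Vz.
have -> : \sum_y bern (z 0) y * m k.+1 (G k z y) ^+ 2 = m k z ^+ 2 +
    \sum_y bern (z 0) y * bern_lin (al k) (z 0) y ^+ 2.
  transitivity (\sum_y (m k z ^+ 2 * bern (z 0) y + 2 * m k z * (bern (z 0) y * bern_lin (al k) (z 0) y)
      + bern (z 0) y * bern_lin (al k) (z 0) y ^+ 2)).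
    by apply: eq_bigr => y _; rewrite mS//; ring.
  by rewrite !big_split /= -!mulr_sumr bern_sum1 bern_lin_mean mulr1 mulr0 addr0.
rewrite lerD2l.
apply: (@le_trans _ _ (\sum_y bern (z 0) y * A k ^+ 2)).
  apply: ler_sum => y _; rewrite ler_wpM2l ?bern_ge0//; first exact: V01.
  rewrite -real_normK ?num_real// lerXn2r ?nnegrE// bern_lin_bound//; exact: V01.
by rewrite -mulr_suml bern_sum1 mul1r.
Qed.

End lindeberg.

(** * Uniform approximation by trigonometric polynomials on boxes *)

Section trigpoly.
Context {R : realType} (p : nat).

(** The linear span of phased cosines. The phases bring in constants and sines, and the
    product-to-sum formula closes the class under products, so statements about cosine transforms
    extend by linearity alone. *)
Inductive trigpoly : ('rV[R]_p -> R) -> Prop :=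
| trigpoly_cos (u : 'rV[R]_p) phi : trigpoly (fun x => cos ((x *m u^T) 0 0 + phi))
| trigpolyD f g : trigpoly f -> trigpoly g -> trigpoly (fun x => f x + g x)
| trigpolyZ a f : trigpoly f -> trigpoly (fun x => a * f x).

Lemma trigpoly_eq f g : trigpoly f -> (forall x, f x = g x) -> trigpoly g.
Proof. by move=> tf /funext <-. Qed.

Lemma trigpoly_cst a : trigpoly (fun=> a).
Proof.
apply: (trigpoly_eq (trigpolyZ a (trigpoly_cos 0 0))) => x.
by rewrite trmx0 mulmx0 mxE addr0 cos0 mulr1.
Qed.

Lemma trigpolyM f g : trigpoly f -> trigpoly g -> trigpoly (fun x => f x * g x).
Proof.
elim=> [u phi|f1 f2 _ ih1 _ ih2|a f1 _ ih] tg; last 2 first.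
- by apply: (trigpoly_eq (trigpolyD (ih1 tg) (ih2 tg))) => x; rewrite mulrDl.
- by apply: (trigpoly_eq (trigpolyZ a (ih tg))) => x; rewrite mulrA.
elim: tg => [w psi|g1 g2 _ ih1 _ ih2|a g1 _ ih].
- apply: (trigpoly_eq (trigpolyZ 2^-1
    (trigpolyD (trigpoly_cos (u + w) (phi + psi)) (trigpoly_cos (u - w) (phi - psi))))) => x.
  rewrite linearD linearB /= mulmxDr mulmxBr !mxE.
  set a := \sum_i _ * u^T _ _; set b := \sum_i _ * w^T _ _.
  have -> : a + b + (phi + psi) = (a + phi) + (b + psi) by ring.
  have -> : a - b + (phi - psi) = (a + phi) - (b + psi) by ring.
  by rewrite cosD cosB; field.
- by apply: (trigpoly_eq (trigpolyD ih1 ih2)) => x; rewrite mulrDr.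
- by apply: (trigpoly_eq (trigpolyZ a ih)) => x; rewrite mulrCA.
Qed.

Lemma trigpoly_sum (I : finType) (F : I -> 'rV[R]_p -> R) :
  (forall i, trigpoly (F i)) -> trigpoly (fun x => \sum_i F i x).
Proof.
move=> tF; apply: (@trigpoly_eq (\sum_i F i)%R); last by move=> x; rewrite fct_sumE.
elim/big_rec: _ => [|i f _ tf]; first exact: trigpoly_cst.
exact: trigpolyD.
Qed.

Lemma trigpoly_prod (I : finType) (F : I -> 'rV[R]_p -> R) :
  (forall i, trigpoly (F i)) -> trigpoly (fun x => \prod_i F i x).
Proof.
move=> tF; suff H (r : seq I) : trigpoly (fun x => \prod_(i <- r) F i x).
  exact: H.
elim: r => [|i r ih].
  by apply: (trigpoly_eq (trigpoly_cst 1)) => x; rewrite big_nil.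
by apply: (trigpoly_eq (trigpolyM (tF i) ih)) => x; rewrite big_cons.
Qed.

Lemma trigpoly_sin_coord (i : 'I_p) (h : R) : trigpoly (fun x => sin (h * x 0 i)).
Proof.
apply: (trigpoly_eq (trigpoly_cos (h *: delta_mx 0 i) (- (pi / 2)))) => x.
rewrite linearZ /= -scalemxAr trmx_delta -colE !mxE.
by rewrite cosB cos_pihalf sin_pihalf mulr0 add0r mulr1.
Qed.

End trigpoly.

Section sine_coordinates.
Context {R : realType}.

(** Confines the argument of the arcsine to the values of sine on [[-1, 1]], where sine has slope at
    least [cos 1 > 0]; this avoids the singular slope of arcsine at the ends. *)
Let clip (v : R) : R := Num.max (- sin 1) (Num.min (sin 1) v).

Let one_itv : (1 : R) \in `[- (pi / 2), pi / 2].
Proof. by rewrite in_itv /=; have := pi_ge2 R; lra. Qed.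

Let sin1_ge0 : 0 <= sin 1 :> R.
Proof. by apply: sin_ge0_pi; have := pi_ge2 R; lra. Qed.

Let clip_itv v : - sin 1 <= clip v <= sin 1.
Proof.
rewrite /clip le_max lexx /= ge_max ge_min lexx /= andbT.
by rewrite lerNl (le_trans _ sin1_ge0)// oppr_le0.
Qed.

Let clip_lip v w : - sin 1 <= w <= sin 1 -> `|clip v - w| <= `|v - w|.
Proof.
move=> /andP[w1 w2]; rewrite /clip; have s0 := sin1_ge0.
have [h1|h1] := lerP (sin 1) v.
  by rewrite max_r; [rewrite !ger0_norm; lra|lra].
have [h2|h2] := lerP (- sin 1) v; first by [].
by rewrite !ler0_norm; lra.
Qed.

Lemma sin_expansion (a b : R) : -1 <= a <= 1 -> -1 <= b <= 1 ->
  cos 1 * `|a - b| <= `|sin a - sin b|.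
Proof.
wlog ab : a b / a <= b => [hw|] a1 b1.
  have [ab|/ltW ba] := leP a b; first exact: hw.
  by rewrite distrC (distrC (sin a)); exact: hw.
have cosge t : -1 <= t <= 1 -> cos 1 <= cos t :> R.
  move=> t1; have -> : cos t = cos `|t| by case: (ger0P t) => // _; rewrite cosN.
  have nt : `|t| <= 1 by rewrite ler_norml.
  rewrite leNgt; apply/negP; rewrite ltr_cos.
  - by rewrite ltNge nt.
  - by have := normr_ge0 t; rewrite in_itv /=; have := pi_ge2 R; lra.
  - by have := normr_ge0 t; rewrite in_itv /=; have := pi_ge2 R; lra.
pose f t := sin t - cos 1 * t : R.
have df (t : R) : is_derive t 1 f (cos t - cos 1).
  have d := is_deriveZ (cos 1) (is_derive_id t 1).
  by apply: (is_derive_eq (is_deriveB (is_derive_sin t) d)); rewrite /GRing.scale /= mulr1.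
have h : f a <= f b.
  have der (t : R) : t \in `]a, b[ -> derivable f t 1 by [].
  have d0 (t : R) : t \in `]a, b[ -> 0 <= derive1 f t.
    rewrite in_itv /= => /andP[t0 t1]; rewrite derive1E derive_val subr_ge0 cosge//.
    lra.
  have cf : {within `[a, b], continuous f} by exact: derivable_within_continuous.
  by apply: (ger0_derive1_le_cc der d0 cf); rewrite ?in_itv /= ?lexx ?ab.
have c0 : 0 < cos 1 :> R by exact: cos1_gt0.
have h3 : 0 <= cos 1 * (b - a) by rewrite mulr_ge0 ?subr_ge0// ltW.
rewrite distrC (distrC (sin a)) !ger0_norm ?subr_ge0//; move: h; rewrite /f; lra.
Qed.

(** A Bernoulli parameter for every real [x], trigonometric in [x], from which [x] can be recovered
    when [|x| <= L]. *)
Definition sin_coord (L x : R) : R := 2^-1 * (1 + sin (L^-1 * x)).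

Definition sin_coord_inv (L v : R) : R := L * asin (clip (2 * v - 1)).

Lemma sin_coord_itv L x : 0 <= sin_coord L x <= 1.
Proof.
by rewrite /sin_coord; have := sin_geN1 (L^-1 * x); have := sin_le1 (L^-1 * x); lra.
Qed.

Let clip1 v : -1 <= clip v <= 1.
Proof. by have := clip_itv v; have := sin_le1 (1 : R); lra. Qed.

Let asin_clip v : -1 <= asin (clip v) <= 1.
Proof.
have hc := clip_itv v; have h1 := clip1 v.
have itv : asin (clip v) \in `[- (pi / 2), pi / 2].
  by rewrite in_itv /= asin_geNpi2// asin_lepi2.
have K : sin (asin (clip v)) = clip v by rewrite asinK// in_itv.
have Nitv : (-1 : R) \in `[- (pi / 2), pi / 2].
  by rewrite in_itv /=; have := pi_ge2 R; lra.
apply/andP; split; rewrite leNgt; apply/negP; rewrite -ltr_sin//.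
  by rewrite K sinN; lra.
by rewrite K; lra.
Qed.

(** For [|x| <= L] the sine of [x / L] lies in the clipping range, so clipping does not increase
    distances to it; the inverse slope of sine gives the factor [1 / cos 1]. *)
Lemma sin_coord_inv_lip L v x : 0 < L -> `|x| <= L ->
  `|sin_coord_inv L v - x| <= (2 * L / cos 1) * `|v - sin_coord L x|.
Proof.
move=> L0 xL; have c0 : 0 < cos 1 :> R by exact: cos1_gt0.
set a := asin (clip (2 * v - 1)); set b := L^-1 * x.
have b1 : -1 <= b <= 1.
  by rewrite -ler_norml /b normrM gtr0_norm ?invr_gt0// ler_pdivrMl// mulr1.
have -> : sin_coord_inv L v - x = L * (a - b).
  by rewrite /sin_coord_inv -/a /b mulrBr mulrA divff ?mul1r ?gt_eqF.
rewrite normrM gtr0_norm//.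
have h := sin_expansion (asin_clip (2 * v - 1)) b1.
rewrite asinK in h; last by rewrite in_itv; exact: clip1.
have sb : - sin 1 <= sin b <= sin 1.
  have bitv : b \in `[- (pi / 2), pi / 2] by rewrite in_itv /=; have := pi_ge2 R; lra.
  have Nitv : (-1 : R) \in `[- (pi / 2), pi / 2].
    by rewrite in_itv /=; have := pi_ge2 R; lra.
  have /andP[b2 b3] := b1.
  apply/andP; split; rewrite leNgt; apply/negP; rewrite -?sinN ltr_sin//; lra.
have h2 := le_trans h (clip_lip (2 * v - 1) sb).
have -> : 2 * L / cos 1 * `|v - sin_coord L x| = L * ((cos 1)^-1 * `|2 * v - 1 - sin b|).
  have -> : 2 * v - 1 - sin b = 2 * (v - sin_coord L x) by rewrite /sin_coord -/b; field.
  by rewrite normrM (ger0_norm (ler0n R 2)); ring.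
by rewrite ler_wpM2l ?(ltW L0)// ler_pdivlMl.
Qed.

End sine_coordinates.

Section uniform_trig_approximation.
Context {R : realType} (p : nat).

(** Compactness of the box in its near-covering form: only [x] is confined to the box, [y] is
    free. *)
Lemma box_uniform_continuity (f : 'rV[R]_p -> R) (L eps : R) :
  continuous f -> 0 < eps ->
  exists2 delta : R, 0 < delta & forall x y : 'rV[R]_p, (forall i, `|x 0 i| <= L) ->
    (forall i, `|y 0 i - x 0 i| < delta) -> `|f y - f x| <= eps.
Proof.
move=> cf eps0.
pose K := [set x : 'rV[R]_p | forall i, (`[- L, L]%classic : set R) (x ord0 i)].
have Kc : compact K := rV_compact (fun=> @segment_compact R (- L) L).
pose P (d : R) (x : 'rV[R]_p) := forall y : 'rV[R]_p,
  (forall i, `|y 0 i - x 0 i| < d) -> `|f y - f x| <= eps.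
have H : \forall d \near (0 : R)^'+, (K `<=` P d) /\ 0 < d.
  have e20 : 0 < eps / 2 by rewrite divr_gt0.
  apply: filterI; last exact: nbhs_right_gt.
  have Kcov : near_covering K by exact/compact_near_coveringP.
  apply: (Kcov R (0 : R)^'+ P _) => x Kx.
  move/cvgrPdist_lt : (cf x) => /(_ _ e20)/nbhs_ballP[r /= r0 xr].
  have r20 : 0 < r / 2 by rewrite divr_gt0.
  exists (ball x (r / 2), [set d : R | d < r / 2]).
    by split; [exact: nbhsx_ballx|exact: nbhs_right_lt].
  move=> [x' d] /= [xx' dr] y yx'.
  have h1 : `|f x - f x'| < eps / 2.
    apply: xr; apply: le_ball xx'; lra.
  have h2 : `|f x - f y| < eps / 2.
    apply: xr; split=> // i j; rewrite (ord1 i).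
    have a1 : `|x 0 j - x' 0 j| < r / 2 by have [_ /(_ 0 j)] := xx'.
    have a2 : d < r / 2 by [].
    have a3 := yx' j; rewrite distrC in a3.
    rewrite -ball_normE /=.
    have -> : x 0 j - y 0 j = (x 0 j - x' 0 j) + (x' 0 j - y 0 j) by ring.
    by rewrite (le_lt_trans (ler_normD _ _))//; lra.
  have -> : f y - f x' = (f x - f x') - (f x - f y) by ring.
  by rewrite (le_trans (ler_normB _ _))//; lra.
have [d [dP d0]] := @filter_ex R (0 : R)^'+ (at_right_proper_filter 0) _ H.
exists d => // x y xL; apply: dP => i; rewrite /= in_itv /= -ler_norml.
exact: xL.
Qed.

(** Coefficients of the average of the [n + 1] draws attached to coordinate [i], as a linear form in
    all [p (n + 1)] draws. *)
Let sc_al (n : nat) (i : 'I_p) (ij : 'I_p * 'I_n.+1) : R :=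
  if ij.1 == i then n.+1%:R^-1 else 0.

Let sum_sc_al (n : nat) (i : 'I_p) (g : 'I_p -> R) : \sum_(ij : 'I_p * 'I_n.+1) sc_al i ij * g ij.1 = g i.
Proof.
pose F (k : 'I_p) (j : 'I_n.+1) := sc_al i (k, j) * g k.
rewrite (eq_bigr (fun ij => F ij.1 ij.2)); last by move=> [].
rewrite -(pair_bigA _ F) /= (bigD1 i)//= [X in _ + X]big1 ?addr0 => [|k ki].
  rewrite /F /sc_al /= eqxx sumr_const card_ord -[LHS]mulr_natl mulrA mulfV ?mul1r//.
by apply: big1 => j _; rewrite /F /sc_al /= (negbTE ki) mul0r.
Qed.

(* Bernstein's argument in the variables [(1 + sin (x_i / L)) / 2]: averages of
   independent Bernoulli variables with these parameters concentrate. *)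
Lemma trigpoly_approximation (f : 'rV[R]_p -> R) (C L eps : R) :
  continuous f -> (forall x, `|f x| <= C) -> 0 < L -> 0 < eps ->
  exists T : 'rV[R]_p -> R, [/\ trigpoly T, (forall x, `|T x| <= C) &
    forall x : 'rV[R]_p, (forall i, `|x 0 i| <= L) -> `|T x - f x| <= eps].
Proof.
move=> cf fC L0 eps0; have e20 : 0 < eps / 2 by rewrite divr_gt0.
have C0 : 0 <= C by apply: le_trans (fC 0).
have [delta d0 uc] := box_uniform_continuity L cf e20.
have c1 : 0 < cos 1 :> R by exact: cos1_gt0.
pose kap := 2 * L / cos 1; have k0 : 0 < kap by rewrite divr_gt0// mulr_gt0.
(* Chebyshev's constant: a node at distance [delta] or more from [x] forces some average to deviate
   by at least [delta / kap], and [f] then differs by at most [2 C]. Each average has variance at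
   most [1 / (n + 1)], which dictates the choice of [n]. *)
pose B := 2 * C * (kap / delta) ^+ 2.
have B0 : 0 <= B by apply: mulr_ge0; [exact: mulr_ge0|exact: sqr_ge0].
have [n hn] : exists n : nat, B * p%:R <= eps / 2 * n.+1%:R.
  have [N _ hN] := nbhs_infty_ger (B * p%:R / (eps / 2)).
  have := hN N (leqnn N); rewrite ler_pdivrMr// => h.
  by exists N; rewrite (le_trans h)// mulrC ler_wpM2l ?(ltW e20)// ler_nat.
pose z (x : 'rV[R]_p) (ij : 'I_p * 'I_n.+1) := sin_coord L (x 0 ij.1).
have z01 x ij : 0 <= z x ij <= 1 by exact: sin_coord_itv.
pose avg (y : {ffun 'I_p * 'I_n.+1 -> bool}) i := \sum_ij sc_al i ij * (y ij)%:R.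
pose node y : 'rV[R]_p := \row_i sin_coord_inv L (avg y i).
pose T x := \sum_y bern (z x) y * f (node y).
exists T; split.
- apply: trigpoly_sum => y.
  apply: (@trigpoly_eq _ _ (fun x => f (node y) * bern (z x) y)); last by move=> x; rewrite mulrC.
  apply: trigpolyZ; apply: trigpoly_prod => ij.
  have tz : trigpoly (fun x : 'rV[R]_p => z x ij).
    apply: trigpolyZ; apply: trigpolyD; first exact: trigpoly_cst.
    exact: trigpoly_sin_coord.
  case: (y ij) => //.
  apply: (@trigpoly_eq _ _ (fun x => 1 + (-1) * z x ij)); last by move=> x; rewrite mulN1r.
  by apply: trigpolyD; [exact: trigpoly_cst|exact: trigpolyZ].
- move=> x; rewrite (le_trans (ler_norm_sum _ _ _))//.
  apply: (@le_trans _ _ (\sum_y bern (z x) y * C)).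
    apply: ler_sum => y _; rewrite normrM ger0_norm ?bern_ge0// ler_wpM2l//.
    exact: bern_ge0.
  by rewrite -mulr_suml bern_sum1 mul1r.
move=> x xL.
have -> : T x - f x = \sum_y bern (z x) y * (f (node y) - f x).
  rewrite /T; under [RHS]eq_bigr do rewrite mulrBr.
  by rewrite sumrB -mulr_suml bern_sum1 mul1r.
have avgE y i : avg y i - sin_coord L (x 0 i) = bern_lin (sc_al i) (z x) y.
  rewrite /bern_lin; under [RHS]eq_bigr do rewrite mulrBr.
  rewrite sumrB; congr (_ - _).
  by rewrite (sum_sc_al n i (fun i => sin_coord L (x 0 i))).
have pt y : `|f (node y) - f x| <= eps / 2 + B * \sum_i bern_lin (sc_al i) (z x) y ^+ 2.
  have S0 : 0 <= \sum_i bern_lin (sc_al i) (z x) y ^+ 2 by apply: sumr_ge0 => i _; exact: sqr_ge0.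
  have [/forallP close|] := boolP [forall i, `|node y 0 i - x 0 i| < delta].
    by rewrite (le_trans (uc _ _ xL close))// lerDl mulr_ge0.
  move=> nclose; have [i far] := elimT forallPn nclose; rewrite -leNgt in far.
  apply: (@le_trans _ _ (2 * C)).
    by rewrite (le_trans (ler_normB _ _))// mulr2n mulrDl mul1r lerD.
  apply: (@le_trans _ _ (B * bern_lin (sc_al i) (z x) y ^+ 2)); last first.
    rewrite -[leLHS]add0r lerD ?(ltW e20)// ler_wpM2l// (bigD1 i)//= lerDl.
    by apply: sumr_ge0 => j _; exact: sqr_ge0.
  rewrite /B -mulrA ler_peMr ?mulr_ge0// -exprMn.
  have h := sin_coord_inv_lip (avg y i) L0 (xL i).
  rewrite avgE -/kap in h.
  have {h}h : delta <= kap * `|bern_lin (sc_al i) (z x) y|.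
    by apply: (le_trans far); rewrite /node mxE.
  rewrite -real_normK ?num_real// exprn_ege1// normrM ger0_norm; last by rewrite divr_ge0// ltW.
  by rewrite mulrAC ler_pdivlMr// mul1r.
rewrite (le_trans (ler_norm_sum _ _ _))//.
apply: (@le_trans _ _ (\sum_y bern (z x) y * (eps / 2 + B * \sum_i bern_lin (sc_al i) (z x) y ^+ 2))).
  apply: ler_sum => y _; rewrite normrM ger0_norm ?bern_ge0// ler_wpM2l ?pt//.
  exact: bern_ge0.
under eq_bigr do rewrite mulrDr [X in _ + X]mulrCA mulr_sumr.
rewrite big_split /= -mulr_suml bern_sum1 mul1r -mulr_sumr exchange_big /=.
rewrite [leRHS]splitr lerD2l.
under eq_bigr do rewrite bern_lin_var.
have var i : \sum_ij sc_al i ij ^+ 2 * (z x ij * (1 - z x ij)) <= n.+1%:R^-1.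
  have := sum_sc_al n i (fun=> n.+1%:R^-1); move=> <-.
  apply: ler_sum => ij _; have /andP[h0 h1] := z01 x ij.
  rewrite /sc_al; case: ifP => _; last by rewrite expr0n mul0r mul0r.
  rewrite expr2 -[leRHS]mulr1 ler_wpM2l ?mulr_ge0 ?invr_ge0//.
  by rewrite mulr_ile1//; lra.
apply: (@le_trans _ _ (B * (p%:R / n.+1%:R))).
  rewrite ler_wpM2l// (le_trans (ler_sum _ (fun i _ => var i)))//.
  by rewrite sumr_const card_ord mulr_natl.
by rewrite mulrA ler_pdivrMr.
Qed.

End uniform_trig_approximation.

(** * Convergence in law from tightness and cosine transforms *)

Section bounded_integrals.
Context {R : realType} d (S : measurableType d) (mu : probability S R).

Lemma bounded_integrable (f : S -> R) (C : R) : measurable_fun setT f ->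
  (forall x, `|f x| <= C) -> mu.-integrable setT (EFin \o f).
Proof.
move=> mf fC; apply: measurable_bounded_integrable => //.
  by apply: (le_lt_trans (probability_le1 mu measurableT)); rewrite ltry.
exists C; split; first exact: num_real.
by move=> r Cr x _ /=; rewrite (le_trans (fC x))// ltW.
Qed.

Lemma prob_Rintegral_cst (c : R) : \int[mu]_(x in setT) c = c.
Proof. by rewrite Rintegral_cst// [X in fine X](probability_setT mu) mulr1. Qed.

End bounded_integrals.

Section borel_rV_theory.
Context {R : realType} (p : nat).

Lemma measurable_borel_rV_open (U : set 'rV[R]_p) : open U ->
  measurable (U : set (borel_rV R p)).
Proof. by move=> oU; exact: sub_sigma_algebra. Qed.

Lemma measurable_borel_rV_continuous (f : 'rV[R]_p -> R) : continuous f ->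
  measurable_fun [set: borel_rV R p] f.
Proof.
move=> cf; apply: (measurability _ (RGenOInfty.measurableE R)).
move=> /= _ [_ [a ->]] <-; rewrite setTI; apply: measurable_borel_rV_open.
apply: open_comp => [x _|]; first exact: cf.
exact: interval_open.
Qed.

Lemma continuous_norm_rV : continuous (fun x : 'rV[R]_p => `|x|).
Proof. exact: norm_continuous. Qed.

Lemma coord_le_norm (x : 'rV[R]_p) i : `|x 0 i| <= `|x|.
Proof.
rewrite [leRHS]/Num.norm /= mx_normrE.
exact: (le_bigmax _ (fun ij => `|x ij.1 ij.2|) (0, i)).
Qed.

Lemma trigpoly_continuous (T : 'rV[R]_p -> R) : trigpoly T -> continuous T.
Proof.
elim=> [u phi|f g _ cf _ cg|a f _ cf] x.
- have cl : (fun y : 'rV[R]_p => (y *m u^T) 0 0) @ x --> (x *m u^T) 0 0.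
    apply: (@cvg_coord _ _ _ _ _ (fun y : 'rV[R]_p => y *m u^T)).
    have idx : id @ x --> x by [].
    exact: (cvg_mulmx _ idx (cvg_cst u^T)).
  have cl' : (fun y : 'rV[R]_p => (y *m u^T) 0 0 + phi) @ x --> (x *m u^T) 0 0 + phi.
    exact: (cvgD cl (cvg_cst phi)).
  exact: (cvg_comp _ _ cl' (@continuous_cos R _)).
- exact: (cvgD (cf x) (cg x)).
- exact: (cvgM (cvg_cst a) (cf x)).
Qed.

Lemma trigpoly_bounded (T : 'rV[R]_p -> R) : trigpoly T ->
  exists C, forall x, `|T x| <= C.
Proof.
elim=> [u phi|f g _ [C1 h1] _ [C2 h2]|a f _ [C h]].
- by exists 1 => x; exact: cos_max.
- by exists (C1 + C2) => x; rewrite (le_trans (ler_normD _ _))// lerD.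
- by exists (`|a| * C) => x; rewrite normrM ler_wpM2l.
Qed.

Lemma probability_tight (nu : probability (borel_rV R p) R) (eps : R) : 0 < eps ->
  exists2 L : R, 0 < L & (nu [set x | (L < `|x : 'rV[R]_p|)%R] <= eps%:E)%E.
Proof.
move=> eps0.
pose A k : set (borel_rV R p) := [set x | k.+1%:R < `|x : 'rV[R]_p|].
have mA k : measurable (A k).
  rewrite (_ : A k = (fun x : 'rV[R]_p => `|x|) @^-1` `]k.+1%:R, +oo[).
    by rewrite -[X in measurable X]setTI;
      exact: (measurable_borel_rV_continuous continuous_norm_rV).
  by apply/seteqP; split => x /=; rewrite /A /= in_itv /= andbT.
have cA : nu \o A @ \oo --> nu (\bigcap_k A k).
  apply: nonincreasing_cvg_mu => //.
  - by rewrite (le_lt_trans (probability_le1 _ _))// ltry.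
  - exact: bigcap_measurable.
  - move=> k l kl; apply/subsetPset => x; rewrite /A /=.
    by apply: le_lt_trans; rewrite ler_nat ltnS.
have A0 : \bigcap_k A k = set0.
  apply/seteqP; split => // x /= Ax.
  have [k _ hk] := nbhs_infty_ger (`|x : 'rV[R]_p|).
  have := Ax k Logic.I; rewrite /A /= => /lt_le_trans/(_ (hk k (leqnn k))).
  by rewrite ltr_nat ltnNge leqnSn.
rewrite A0 measure0 in cA.
have [k _ hk] : \forall k \near \oo, (nu (A k) <= eps%:E)%E.
  move/fine_cvgP : cA => [fA].
  move/cvgrPdist_le => /(_ _ eps0) h.
  apply: filterS2 fA h => k fk; rewrite sub0r normrN /= => h.
  have fk' : nu (A k) \is a fin_num by exact: fk.
  by rewrite -(fineK fk') lee_fin (le_trans (ler_norm _) h).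
by exists k.+1%:R => //; exact: hk (leqnn k).
Qed.

Lemma measurable_norm_gt d (S : measurableType d) (Y : S -> borel_rV R p) (L : R) :
  measurable_fun setT Y -> measurable [set w | L < `|Y w : 'rV[R]_p|].
Proof.
move=> mY.
have h := measurableT_comp (measurable_borel_rV_continuous continuous_norm_rV) mY.
have := h measurableT `]L, +oo[%classic (measurable_itv _); rewrite setTI.
by congr measurable; apply/seteqP; split => x /=; rewrite in_itv /= andbT.
Qed.

Lemma Rintegral_approx d (S : measurableType d) (mu : probability S R)
    (Y : S -> borel_rV R p) (f T : 'rV[R]_p -> R) (M eps delta L : R) :
  measurable_fun setT Y -> continuous f -> continuous T ->
  (forall x, `|f x| <= M) -> (forall x, `|T x| <= M) -> 0 <= eps ->
  (forall x, `|x| <= L -> `|T x - f x| <= eps) ->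
  (mu [set w | (L < `|Y w : 'rV[R]_p|)%R] <= delta%:E)%E ->
  `|\int[mu]_w f (Y w) - \int[mu]_w T (Y w)| <= eps + 2 * M * delta.
Proof.
move=> mY cf cT fM TM eps0 Tf muL.
have M0 : 0 <= M by apply: le_trans (fM 0).
pose B := [set w | L < `|Y w : 'rV[R]_p|].
have mB : measurable B by exact: measurable_norm_gt.
have mf : measurable_fun setT (fun w => f (Y w)).
  by apply: measurableT_comp => //; exact: measurable_borel_rV_continuous.
have mT : measurable_fun setT (fun w => T (Y w)).
  by apply: measurableT_comp => //; exact: measurable_borel_rV_continuous.
have intf := bounded_integrable mu mf (fun w => fM (Y w)).
have intT := bounded_integrable mu mT (fun w => TM (Y w)).
rewrite -RintegralB//.
have diffM x : `|f x - T x| <= 2 * M.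
  by rewrite (le_trans (ler_normB _ _))// mulr2n mulrDl mul1r lerD.
have mfT : measurable_fun setT (fun w => f (Y w) - T (Y w)) by exact: measurable_funB.
rewrite (le_trans (le_normr_Rintegral _ _))//.
  exact: (bounded_integrable mu mfT (fun w => diffM (Y w))).
have mI : measurable_fun setT (fun w => \1_B w : R) by exact: measurable_indic.
have m2I : measurable_fun setT (fun w => 2 * M * \1_B w) by exact: measurable_funM.
have mg : measurable_fun setT (fun w => eps + 2 * M * \1_B w) by exact: measurable_funD.
have b2I w : `|2 * M * \1_B w| <= 2 * M.
  rewrite normrM indicE ger0_norm ?mulr_ge0//.
  by case: (w \in B); rewrite ?normr1 ?normr0 ?mulr1 ?mulr0 ?mulr_ge0.
have bI w : `|\1_B w : R| <= 1.
  by rewrite indicE; case: (w \in B); rewrite ?normr1 ?normr0.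
have intI := bounded_integrable mu mI bI.
have intMI := bounded_integrable mu m2I b2I.
have intc : mu.-integrable setT (EFin \o (fun w : S => eps)).
  by apply: (@bounded_integrable _ _ _ _ _ `|eps|).
apply: (@le_trans _ _ (\int[mu]_w (eps + 2 * M * \1_B w))).
  apply: le_Rintegral => //.
  - apply: (@bounded_integrable _ _ _ _ _ (2 * M)); first exact: measurableT_comp.
    by move=> w; rewrite normr_id.
  - apply: (bounded_integrable mu mg (C := eps + 2 * M)) => w.
    by rewrite (le_trans (ler_normD _ _))// ger0_norm// lerD2l.
  move=> w _; rewrite indicE; have [wB|wB] := boolP (w \in B).
    by rewrite mulr1 (le_trans (diffM _))// lerDr.
  rewrite mulr0 addr0 distrC Tf// leNgt; apply/negP => h; move/negP: wB; apply.
  by rewrite inE.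
rewrite RintegralD// prob_Rintegral_cst lerD2l RintegralZl// ler_wpM2l ?mulr_ge0//.
rewrite /Rintegral integral_indic// setIT.
have : mu B \is a fin_num by rewrite fin_num_measure.
by move=> fB; rewrite -lee_fin fineK.
Qed.

(** Tightness confines all the laws to one box up to mass [dl]. There a trigonometric polynomial
    approximates [f]; outside, it obeys the same bound [M] as [f], so the mass left out costs at
    most [2 M dl]. *)
Lemma cvg_in_law_trig d (Omega : measurableType d) (P : probability Omega R)
    (X : nat -> Omega -> borel_rV R p) (nu : probability (borel_rV R p) R) :
  (forall n, measurable_fun setT (X n)) ->
  (forall eps : R, 0 < eps -> exists2 L : R, 0 < L &
     \forall n \near \oo, (P [set w | (L < `|X n w : 'rV[R]_p|)%R] <= eps%:E)%E) ->
  (forall (u : 'rV[R]_p) phi,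
     (fun n => \int[P]_w cos (((X n w : 'rV[R]_p) *m u^T) 0 0 + phi)) @ \oo -->
     \int[nu]_x cos (((x : 'rV[R]_p) *m u^T) 0 0 + phi)) ->
  cvg_in_law P X nu.
Proof.
move=> mX tightX cosX f cf [M fM].
have mid : measurable_fun setT (@id (borel_rV R p)) by exact: measurable_id.
have trigX T : trigpoly T -> (fun n => \int[P]_w T (X n w)) @ \oo --> \int[nu]_x T x.
  elim=> [u phi|g h tg ihg th ihh|a g tg ih].
  - exact: cosX.
  - have [C1 b1] := trigpoly_bounded tg; have [C2 b2] := trigpoly_bounded th.
    have cg := trigpoly_continuous tg; have ch := trigpoly_continuous th.
    have E d' (S : measurableType d') (mu : probability S R) (Y : S -> borel_rV R p) :
        measurable_fun setT Y ->
        \int[mu]_w (g (Y w) + h (Y w)) = \int[mu]_w g (Y w) + \int[mu]_w h (Y w).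
      move=> mY; rewrite RintegralD//.
      + apply: (bounded_integrable mu _ (fun w => b1 (Y w))).
        by apply: measurableT_comp => //; exact: measurable_borel_rV_continuous.
      + apply: (bounded_integrable mu _ (fun w => b2 (Y w))).
        by apply: measurableT_comp => //; exact: measurable_borel_rV_continuous.
    rewrite (E _ _ nu id)//; under eq_fun do rewrite E//.
    exact: cvgD.
  - have [C b] := trigpoly_bounded tg; have cg := trigpoly_continuous tg.
    have E d' (S : measurableType d') (mu : probability S R) (Y : S -> borel_rV R p) :
        measurable_fun setT Y ->
        \int[mu]_w (a * g (Y w)) = a * \int[mu]_w g (Y w).
      move=> mY; rewrite RintegralZl//.
      apply: (bounded_integrable mu _ (fun w => b (Y w))).
      by apply: measurableT_comp => //; exact: measurable_borel_rV_continuous.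
    rewrite (E _ _ nu id)//; under eq_fun do rewrite E//.
    exact: cvgMr.
have M0 : 0 <= M by apply: le_trans (fM 0).
apply/cvgrPdist_le => eps eps0.
(* For [nu] and for [P] alike, passing from [f] to [T] costs [e] inside the box and at most [e]
   outside; the convergence for [T] costs the fifth [e]. *)
pose e := eps / 5; have e0 : 0 < e by rewrite divr_gt0.
pose dl := e / (2 * M + 1).
have M1 : 0 < 2 * M + 1 by rewrite ltr_wpDl// mulr_ge0.
have dl0 : 0 < dl by rewrite divr_gt0.
have Mdl : 2 * M * dl <= e.
  rewrite /dl mulrCA -[leRHS]mulr1 ler_wpM2l ?(ltW e0)// ler_pdivrMr// mul1r; lra.
have [L1 L10 h1] := tightX dl dl0.
have [L2 L20 h2] := probability_tight nu dl0.
pose L := L1 + L2; have L0 : 0 < L by rewrite addr_gt0.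
have [T [tT TM Tf]] := trigpoly_approximation cf fM L0 e0.
have cT := trigpoly_continuous tT.
have Tf' (x : 'rV[R]_p) : `|x| <= L -> `|T x - f x| <= e.
  by move=> xL; apply: Tf => i; exact: le_trans (coord_le_norm x i) xL.
have mono d' (S : measurableType d') (mu : probability S R) (Y : S -> borel_rV R p) (l : R) :
    measurable_fun setT Y -> l <= L ->
    (mu [set w | (l < `|Y w : 'rV[R]_p|)%R] <= dl%:E)%E ->
    (mu [set w | (L < `|Y w : 'rV[R]_p|)%R] <= dl%:E)%E.
  move=> mY lL; apply: le_trans; apply: le_measure; rewrite ?inE.
  - exact: measurable_norm_gt.
  - exact: measurable_norm_gt.
  - by move=> w /=; apply: le_lt_trans.
have hnu := Rintegral_approx mid cf cT fM TM (ltW e0) Tf'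
  (mono _ _ nu id L2 mid (ler_wpDl (ltW L10) (lexx L2)) h2).
move/cvgrPdist_le : (trigX T tT) => /(_ _ e0) hT.
apply: filterS2 hT h1 => n hn /(mono _ _ _ _ _ (mX n) (ler_wpDr (ltW L20) (lexx L1))) hLn.
have hP := Rintegral_approx (mX n) cf cT fM TM (ltW e0) Tf' hLn.
set a := \int[nu]_x f x in hnu *; set b := \int[P]_w f (X n w) in hP *.
set a' := \int[nu]_x T x in hnu hn *; set b' := \int[P]_w T (X n w) in hP hn *.
have -> : a - b = (a - a') + (a' - b') - (b - b') by ring.
rewrite (le_trans (ler_normB _ _))//.
rewrite (le_trans (lerD (ler_normD _ _) (lexx _)))//.
rewrite /e in e0 Mdl hn hnu hP; lra.
Qed.

End borel_rV_theory.

(** * Integration against a density; the cosine transform of the normal law *)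

Section integral_density.
Context {R : realType} d (T : measurableType d).
Variables (mu nu : {measure set T -> \bar R}) (h : T -> R).
Hypothesis mh : measurable_fun setT h.
Hypothesis h0 : forall x, 0 <= h x.
Hypothesis nuE : forall A, measurable A -> (nu A = \int[mu]_(x in A) (h x)%:E)%E.

Import HBNNSimple.

Let integral_density_indic A (mA : measurable A) :
  (\int[nu]_x (\1_A x)%:E = \int[mu]_x ((\1_A x)%:E * (h x)%:E))%E.
Proof.
rewrite integral_indic//= setIT nuE// integral_mkcond.
apply: eq_integral => x _; rewrite patchE indicE.
by case: (x \in A); rewrite ?mul1e ?mul0e.
Qed.

Let integral_density_nnsfun (f : {nnsfun T >-> R}) :
  (\int[nu]_x (f x)%:E = \int[mu]_x ((f x)%:E * (h x)%:E))%E.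
Proof.
under [LHS]eq_integral do rewrite fimfunE -fsumEFin//.
rewrite [LHS]ge0_integral_fsum//; last 2 first.
- by move=> r; exact/measurable_EFinP/measurableT_comp.
- by move=> n x _; rewrite EFinM nnfun_muleindic_ge0.
under [RHS]eq_integral.
  move=> x xD; rewrite fimfunE -fsumEFin// ge0_mule_fsuml; last first.
    by move=> r; rewrite EFinM nnfun_muleindic_ge0.
  over.
rewrite [RHS]ge0_integral_fsum//; last 2 first.
- move=> r; apply: emeasurable_funM; last exact/measurable_EFinP.
  by apply/measurable_EFinP/measurableT_comp.
- by move=> n x _; rewrite EFinM mule_ge0 ?nnfun_muleindic_ge0 ?lee_fin.
apply: eq_fsbigr => r _.
under [LHS]eq_integral do rewrite EFinM.
under [RHS]eq_integral do rewrite EFinM -muleA.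
have [r0|r0] := leP 0 r.
  transitivity (r%:E * \int[nu]_x (\1_(f @^-1` [set r]) x)%:E)%E.
    by apply: ge0_integralZl => //; exact/measurable_EFinP.
  rewrite integral_density_indic//; apply/esym; apply: ge0_integralZl => //.
    by apply: emeasurable_funM; exact/measurable_EFinP.
  by move=> x _; rewrite mule_ge0// lee_fin.
have -> : f @^-1` [set r] = set0.
  by apply/preimage10 => -[x _ fx]; move: r0; rewrite -fx ltNge fun_ge0.
by rewrite !integral0_eq// => x _; rewrite indic0 ?mul0e mule0.
Qed.

Lemma integral_density (f : T -> \bar R) : measurable_fun setT f ->
  (forall x, 0 <= f x)%E -> (\int[nu]_x f x = \int[mu]_x (f x * (h x)%:E))%E.
Proof.
move=> mf f0; pose g := nnsfun_approx measurableT mf.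
have cg x : (g n x)%:E @[n --> \oo] --> f x by apply: cvg_nnsfun_approx.
transitivity (lim (\int[nu]_x (g n x)%:E @[n --> \oo])%E).
  rewrite -monotone_convergence//=.
  - by apply: eq_integral => x _; apply/esym/cvg_lim => //; exact: cg.
  - by move=> n; exact/measurable_EFinP.
  - by move=> n x _; rewrite lee_fin.
  - by move=> x _ m n mn; rewrite lee_fin; exact/lefP/nd_nnsfun_approx.
transitivity (lim (\int[mu]_x ((g n x)%:E * (h x)%:E) @[n --> \oo])%E).
  by apply: congr_lim; apply/funext => n; exact: integral_density_nnsfun.
rewrite -monotone_convergence//=.
- apply: eq_integral => x _; apply/cvg_lim => //.
  by apply: cvgeMr => //; exact: cg.
- by move=> n; apply: emeasurable_funM; exact/measurable_EFinP.
- by move=> n x _; rewrite mule_ge0// lee_fin.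
- move=> x _ m n mn; rewrite lee_wpmul2r ?lee_fin//.
  exact/lefP/nd_nnsfun_approx.
Qed.

End integral_density.

Section normal_characteristic.
Context {R : realType}.
Local Notation mu := (@lebesgue_measure R).

(** The fundamental theorem on growing symmetric intervals, then dominated convergence. It provides
    integration by parts on the whole line. *)
Lemma Rintegral_derivative_eq0 (w D : R -> R) :
  (forall x, is_derive x (1 : R) w (D x)) -> continuous D ->
  mu.-integrable setT (EFin \o D) ->
  (fun n : nat => w n.+1%:R - w (- n.+1%:R)) @ \oo --> (0 : R) ->
  \int[mu]_x D x = 0.
Proof.
move=> wD cD intD w0.
pose I n : set R := `[- n.+1%:R, n.+1%:R]%classic.
pose fR n (x : R) : R := D x * \1_(I n) x.
pose f n (x : R) : \bar R := (fR n x)%:E.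
have fE n : (\int[mu]_x f n x = (w n.+1%:R - w (- n.+1%:R))%:E)%E.
  have h : (\int[mu]_(x in I n) (D x)%:E = (w n.+1%:R)%:E - (w (- n.+1%:R))%:E)%E.
    have nn : - n.+1%:R < n.+1%:R :> R by rewrite gtrN.
    apply: continuous_FTC2 => //.
    - exact: continuous_subspaceT.
    - have cw : continuous w.
        move=> x; apply/differentiable_continuous/derivable1_diffP.
        by have := wD x.
      split.
      + by move=> x _; have := wD x.
      + by apply: cvg_at_right_filter; exact: cw.
      + by apply: cvg_at_left_filter; exact: cw.
    - by move=> x _; rewrite derive1E; have := wD x => wx; rewrite derive_val.
  rewrite EFinB -h [RHS]integral_mkcond; apply: eq_integral => x _.
  rewrite /f /fR patchE indicE.
  by case: ifP => _; rewrite ?mulr1 ?mulr0.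
have mD : measurable_fun setT D by exact: continuous_measurable_fun.
have mfR n : measurable_fun setT (fR n).
  by apply: measurable_funM => //; apply: measurable_indic; exact: measurable_itv.
have fD n x : `|fR n x| <= `|D x|.
  by rewrite /fR normrM indicE; case: (x \in I n); rewrite ?normr1 ?normr0 ?mulr1 ?mulr0.
have cvgfR x : (fun n => fR n x) @ \oo --> D x.
  apply: cvg_near_cst; have [N _ hN] := nbhs_infty_ger `|x|.
  exists N => // n /= Nn; rewrite /fR indicE mem_set ?mulr1// /I /= in_itv /= -ler_norml.
  by rewrite (le_trans (hN n Nn))// ler_nat.
have [] := @dominated_convergence _ _ _ mu setT measurableT f (EFin \o D)
  (fun x => (`|D x|)%:E).
- by move=> n; apply/measurable_EFinP; exact: mfR.
- by apply/measurable_EFinP; exact: mD.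
- apply: aeW => x _; apply/fine_cvgP; split; first exact: nearW.
  exact: cvgfR.
- exact: (integrable_norm intD).
- by apply: aeW => x n _; rewrite lee_fin.
move=> _ _ cvgf.
rewrite /Rintegral; suff -> : (\int[mu]_x (D x)%:E = 0)%E by [].
apply: (cvg_unique _ cvgf) => //=.
under eq_fun do rewrite fE.
by apply/fine_cvgP; split; first exact: nearW.
Qed.

End normal_characteristic.

Section normal_pdf_theory.
Context {R : realType} (s : R).
Hypothesis s0 : s != 0.
Local Notation mu := (@lebesgue_measure R).
Let pdf := normal_pdf 0 s.

Let s2 : 0 < s ^+ 2.
Proof. by rewrite exprn_even_gt0. Qed.

Let pdfE x : pdf x = normal_peak s * expR (- (x ^+ 2 / (s ^+ 2 *+ 2))).
Proof. by rewrite /pdf normal_pdfE// /normal_fun subr0 mulNr. Qed.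

Let der_pdf (x : R) : is_derive x 1 pdf (- (x / s ^+ 2) * pdf x).
Proof.
have -> : pdf = (fun x => normal_peak s * expR (- (x ^+ 2 / (s ^+ 2 *+ 2)))) by exact/funext/pdfE.
have d1 : is_derive x 1 (fun x : R => - (x ^+ 2 / (s ^+ 2 *+ 2))) (- (x / s ^+ 2)).
  have d := is_deriveZ (- (s ^+ 2 *+ 2)^-1) (is_deriveX 2 (is_derive_id x 1)).
  have -> : (fun x : R => - (x ^+ 2 / (s ^+ 2 *+ 2))) = - (s ^+ 2 *+ 2)^-1 \*: (id ^+ 2).
    by apply/funext => y; rewrite -[RHS]/(- (s ^+ 2 *+ 2)^-1 * y ^+ 2) mulNr mulrC.
  apply: (is_derive_eq d); rewrite /GRing.scale /=.
  by field; rewrite ?s0.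
have d2 : is_derive x 1 (expR \o (fun x : R => - (x ^+ 2 / (s ^+ 2 *+ 2))))
    (expR (- (x ^+ 2 / (s ^+ 2 *+ 2))) * - (x / s ^+ 2)).
  exact: (is_derive1_comp _ d1).
apply: (is_derive_eq (is_deriveZ (normal_peak s) d2)).
by rewrite /GRing.scale /=; ring.
Qed.

(** Doubling the standard deviation leaves room for a factor growing like [expR (a x^2)], which
    beats [|x|]. One integrable bound thus dominates all integrands with a factor [x]. *)
Let pdf_moment_bound : exists2 k : R, 0 <= k & forall x, `|x| * pdf x <= k * normal_pdf 0 (2 * s) x.
Proof.
(* The difference of the two exponents: [1 / (2 s^2) - 1 / (8 s^2)]. *)
pose a : R := 3 / (8 * s ^+ 2); have a0 : 0 < a by rewrite divr_gt0// mulr_gt0.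
pose c := Num.min 1 a; have c0 : 0 < c by rewrite lt_min ltr01.
have s20 : 2 * s != 0 by rewrite mulf_neq0.
have pk0 := normal_peak_gt0 s20.
exists (normal_peak s / (c * normal_peak (2 * s))).
  by rewrite divr_ge0 ?normal_peak_ge0// mulr_ge0 ?normal_peak_ge0// ltW.
move=> x; rewrite pdfE (normal_pdfE _ s20) /normal_fun subr0.
set e1 := expR _; set e2 := expR _.
have -> : normal_peak s / (c * normal_peak (2 * s)) * (normal_peak (2 * s) * e2) =
  normal_peak s * (c^-1 * e2) by field; rewrite !gt_eqF.
rewrite mulrCA ler_wpM2l ?normal_peak_ge0// ler_pdivlMl//.
have -> : e2 = expR (a * x ^+ 2) * e1.
  rewrite /e1 /e2 -expRD /a; congr expR.
  by field; rewrite ?s0.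
rewrite mulrA ler_wpM2r ?expR_ge0//.
apply: (le_trans _ (expR_ge1Dx _)).
have xx : `|x| ^+ 2 = x ^+ 2 by rewrite real_normK ?num_real.
have h1 : c * `|x| <= c * (1 + `|x| ^+ 2).
  rewrite ler_wpM2l ?(ltW c0)//; have := sqr_ge0 (`|x| - 1); rewrite sqrrB expr1n mulr1.
  by have := normr_ge0 x; lra.
apply: (le_trans h1); rewrite mulrDr mulr1 xx lerD ?ler_wpM2r ?sqr_ge0//.
  by rewrite ge_min lexx.
by rewrite ge_min lexx orbT.
Qed.

Let pdf_cvg0 : (fun n : nat => pdf n.+1%:R) @ \oo --> (0 : R) /\
  (fun n : nat => pdf (- n.+1%:R)) @ \oo --> (0 : R).
Proof.
have [k k0 hk] := pdf_moment_bound.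
have s20 : 2 * s != 0 by rewrite mulf_neq0.
pose K := k * normal_peak (2 * s).
have bd x : x != 0 -> pdf x <= K * `|x|^-1.
  move=> x0; rewrite ler_pdivlMr ?normr_gt0// mulrC (le_trans (hk x))//.
  by rewrite ler_wpM2l// normal_pdf_ub.
have h0 : (fun n => K * harmonic n) @ \oo --> (0 : R).
  rewrite -(mulr0 K); apply: cvgMr; exact: cvg_harmonic.
split; apply: (@squeeze_cvgr _ _ _ _ (cst 0) _ _ _ _ _ h0); try exact: cvg_cst.
  by apply: nearW => n; rewrite normal_pdf_ge0 /= (le_trans (bd _ _))// ?normr_nat.
apply: nearW => n; rewrite normal_pdf_ge0 /= (le_trans (bd _ _)) ?oppr_eq0//.
by rewrite normrN normr_nat.
Qed.

Let intpdf : mu.-integrable setT (EFin \o pdf).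
Proof. exact: integrable_normal_pdf. Qed.

Let int_dominated (f g : R -> R) : measurable_fun setT f -> (forall x, `|f x| <= g x) ->
  mu.-integrable setT (EFin \o g) -> mu.-integrable setT (EFin \o f).
Proof.
move=> mf fg; apply: le_integrable => //; first exact/measurable_EFinP.
by move=> x _; rewrite lee_fin (le_trans (fg x))// ler_norm.
Qed.

Let intZ (f : R -> R) (k : R) : mu.-integrable setT (EFin \o f) ->
  mu.-integrable setT (EFin \o (fun x => k * f x)).
Proof. by move=> intf; exact: (integrableZl measurableT k intf). Qed.

Let phase (t phi x : R) := t * x + phi.

Let cphase t phi : continuous (phase t phi).
Proof.
move=> x; apply: cvgD; last exact: cvg_cst.
by apply: cvgMr; exact: cvg_id.
Qed.

Let mcos t phi : measurable_fun setT (fun x => cos (phase t phi x)).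
Proof.
apply: continuous_measurable_fun => x.
by apply: (continuous_comp (@cphase t phi x)); exact: continuous_cos.
Qed.

Let msin t phi : measurable_fun setT (fun x => sin (phase t phi x)).
Proof.
apply: continuous_measurable_fun => x.
by apply: (continuous_comp (@cphase t phi x)); exact: continuous_sin.
Qed.

Let mpdf : measurable_fun setT pdf.
Proof. exact: measurable_normal_pdf. Qed.

Let int_cos t phi : mu.-integrable setT (EFin \o (fun x => cos (phase t phi x) * pdf x)).
Proof.
apply: (int_dominated _ _ intpdf); first exact: measurable_funM.
move=> x; rewrite normrM (ger0_norm (normal_pdf_ge0 _ _ _)) ler_piMl ?cos_max//.
exact: normal_pdf_ge0.
Qed.

Let int_xsin t phi : mu.-integrable setT (EFin \o (fun x => x * sin (phase t phi x) * pdf x)).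
Proof.
have [k k0 hk] := pdf_moment_bound.
have intk : mu.-integrable setT (EFin \o (fun x => k * normal_pdf 0 (2 * s) x)).
  by apply: intZ; exact: integrable_normal_pdf.
apply: (int_dominated _ _ intk); first by do 2 apply: measurable_funM => //.
move=> x; rewrite !normrM (ger0_norm (normal_pdf_ge0 _ _ _)) (le_trans _ (hk x))//.
by rewrite ler_wpM2r ?normal_pdf_ge0// ler_piMr ?sin_max.
Qed.

(** Stein's identity: [x pdf] is [- s^2] times the derivative of [pdf], and the boundary terms
    vanish. *)
Let by_parts t phi :
  \int[mu]_x (x * sin (phase t phi x) * pdf x) =
  s ^+ 2 * t * \int[mu]_x (cos (phase t phi x) * pdf x).
Proof.
pose w x := sin (phase t phi x) * pdf x.
pose D x := t * (cos (phase t phi x) * pdf x) - (s ^+ 2)^-1 * (x * sin (phase t phi x) * pdf x).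
have dph (x : R) : is_derive x 1 (phase t phi) t.
  have d := is_deriveD (is_deriveZ t (is_derive_id x 1)) (is_derive_cst phi x 1).
  by apply: (is_derive_eq d); rewrite /GRing.scale /= mulr1 addr0.
have wD (x : R) : is_derive x 1 w (D x).
  have d1 : is_derive x 1 (sin \o phase t phi) (cos (phase t phi x) * t).
    exact: (is_derive1_comp _ (dph x)).
  apply: (is_derive_eq (is_deriveM d1 (der_pdf x))).
  by rewrite /GRing.scale /= /D; field; rewrite s0.
have i1 := intZ t (int_cos t phi).
have i2 := intZ (s ^+ 2)^-1 (int_xsin t phi).
have intD : mu.-integrable setT (EFin \o D) by exact: (integrableB measurableT i1 i2).
have cpdf : continuous pdf by exact: continuous_normal_pdf.
have cD : continuous D.
  have ccos : continuous (fun x => cos (phase t phi x)).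
    by move=> x; apply: (continuous_comp (@cphase t phi x)); exact: continuous_cos.
  have csin : continuous (fun x => sin (phase t phi x)).
    by move=> x; apply: (continuous_comp (@cphase t phi x)); exact: continuous_sin.
  move=> x; apply: cvgB.
    by apply: cvgMr; apply: cvgM; [exact: ccos|exact: cpdf].
  apply: cvgMr; apply: cvgM; last exact: cpdf.
  by apply: cvgM; [exact: cvg_id|exact: csin].
have [c1 c2] := pdf_cvg0.
have w0 : (fun n : nat => w n.+1%:R - w (- n.+1%:R)) @ \oo --> (0 : R).
  rewrite -(subr0 0); apply: cvgB.
    apply/norm_cvg0P; apply: (@squeeze_cvgr _ _ _ _ (cst 0) _ _ _ _ _ c1); last exact: cvg_cst.
    apply: nearW => n; rewrite normr_ge0 /= normrM (ger0_norm (normal_pdf_ge0 _ _ _)).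
    by rewrite ler_piMl ?sin_max// normal_pdf_ge0.
  apply/norm_cvg0P; apply: (@squeeze_cvgr _ _ _ _ (cst 0) _ _ _ _ _ c2); last exact: cvg_cst.
  apply: nearW => n; rewrite normr_ge0 /= normrM (ger0_norm (normal_pdf_ge0 _ _ _)).
  by rewrite ler_piMl ?sin_max// normal_pdf_ge0.
have := Rintegral_derivative_eq0 wD cD intD w0.
rewrite /D RintegralB// !RintegralZl//.
move=> /eqP; rewrite subr_eq0 => /eqP h.
by rewrite -mulrA h mulrA divff ?mul1r// gt_eqF.
Qed.

(** As a function of the frequency [t], the integral solves [C' = - s^2 t C]: differentiate under
    the integral sign, then integrate by parts. An integrating factor and the value at [t = 0]
    conclude. *)
Lemma Rintegral_cos_normal_pdf r phi :
  \int[mu]_x (cos (r * x + phi) * normal_pdf 0 s x) =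
  expR (- (s ^+ 2 / 2 * r ^+ 2)) * cos phi.
Proof.
pose C (t : R) := \int[mu]_x (cos (phase t phi x) * pdf x).
have [k k0 hk] := pdf_moment_bound.
have intk : mu.-integrable setT (EFin \o (fun x => k * normal_pdf 0 (2 * s) x)).
  by apply: intZ; exact: integrable_normal_pdf.
have dC (t : R) : is_derive t 1 C (- (s ^+ 2 * t) * C t).
  pose f (t x : R) := cos (phase t phi x) * pdf x.
  have df (u y : R) : is_derive u 1 (f ^~ y) (- (y * sin (phase u phi y) * pdf y)).
    have d0 : is_derive u 1 (fun u => phase u phi y) y.
      have d := is_deriveD (is_deriveZ y (is_derive_id u 1)) (is_derive_cst phi u 1).
      have -> : (fun u => phase u phi y) = y \*: id + cst phi.
        by apply/funext => v; rewrite -[RHS]/(y * v + phi) mulrC.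
      by apply: (is_derive_eq d); rewrite /GRing.scale /= mulr1 addr0.
    have d1 : is_derive u 1 (cos \o (fun u => phase u phi y)) (- sin (phase u phi y) * y).
      exact: (is_derive1_comp _ d0).
    have d2 := is_deriveM d1 (is_derive_cst (pdf y) u 1).
    by apply: (is_derive_eq d2); rewrite scaler0 add0r /GRing.scale /=; ring.
  have tI : `](t - 1), (t + 1)[%classic t by rewrite /= in_itv /=; lra.
  have H1 (x : R) : `](t - 1), (t + 1)[%classic x -> mu.-integrable setT (EFin \o f x).
    by move=> _; exact: int_cos.
  have H2 (x y : R) : `](t - 1), (t + 1)[%classic x -> setT y -> derivable (f ^~ y) x 1.
    by move=> _ _; have := df x y.
  have G0 (y : R) : 0 <= k * normal_pdf 0 (2 * s) y by rewrite mulr_ge0// normal_pdf_ge0.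
  have dE (x y : R) : partial1of2 f x y = - (y * sin (phase x phi y) * pdf y).
    by rewrite partial1of2E; have := df x y => d; rewrite derive_val.
  have H3 (x y : R) : `](t - 1), (t + 1)[%classic x -> setT y ->
      `|partial1of2 f x y| <= k * normal_pdf 0 (2 * s) y.
    move=> _ _; rewrite dE normrN !normrM (ger0_norm (normal_pdf_ge0 _ _ _)).
    rewrite (le_trans _ (hk y))// ler_wpM2r ?normal_pdf_ge0//.
    by rewrite ler_piMr ?sin_max.
  have dd := derivable_under_integral measurableT tI H1 H2 G0 intk H3.
  have de := differentiation_under_integral measurableT tI H1 H2 G0 intk H3.
  apply: DeriveDef; first exact: dd.
  rewrite -derive1E de.
  under eq_Rintegral do rewrite dE -mulN1r.
  by rewrite RintegralZl ?by_parts//; rewrite mulN1r mulNr.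
pose E (t : R) := C t * expR (s ^+ 2 / 2 * t ^+ 2).
have dE (t : R) : is_derive t 1 E 0.
  have d0 : is_derive t 1 (fun t : R => s ^+ 2 / 2 * t ^+ 2) (s ^+ 2 * t).
    have d := is_deriveZ (s ^+ 2 / 2) (is_deriveX 2 (is_derive_id t 1)).
    apply: (is_derive_eq d); by rewrite /GRing.scale /= expr1 mulr1; field.
  have d1 : is_derive t 1 (expR \o (fun t : R => s ^+ 2 / 2 * t ^+ 2))
      (expR (s ^+ 2 / 2 * t ^+ 2) * (s ^+ 2 * t)).
    exact: (is_derive1_comp _ d0).
  apply: (is_derive_eq (is_deriveM (dC t) d1)).
  by rewrite /GRing.scale /=; ring.
have := is_derive_0_is_cst r 0 dE.
rewrite /E expr0n mulr0 expR0 mulr1 => h.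
have C0 : C 0 = cos phi.
  rewrite /C; under eq_Rintegral do rewrite /phase mul0r add0r.
  by rewrite RintegralZl// /Rintegral integral_normal_pdf mulr1.
rewrite -[LHS]/(C r) expRN; apply: (mulIf (lt0r_neq0 (expR_gt0 (s ^+ 2 / 2 * r ^+ 2)))).
by rewrite h C0 mulrAC mulVf ?mul1r// gt_eqF// expR_gt0.
Qed.

End normal_pdf_theory.

(** * Borel measurability of random rows; uniqueness of laws on the line *)

Section bounded_convergence.
Context {R : realType} d (S : measurableType d) (P : probability S R).

Lemma bounded_dominated_cvg (f_ : nat -> S -> R) (f : S -> R) (C : R) :
  (forall n, measurable_fun setT (f_ n)) -> measurable_fun setT f ->
  (forall n x, `|f_ n x| <= C) -> {ae P, forall x, (fun n => f_ n x) @ \oo --> f x} ->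
  (fun n => \int[P]_x f_ n x) @ \oo --> \int[P]_x f x.
Proof.
move=> mf_ mf fC cf.
have C0 : 0 <= C by apply: le_trans (fC 0%N point).
have intC : P.-integrable setT (EFin \o cst C).
  by apply: (@bounded_integrable _ _ _ _ _ C) => // x; rewrite ger0_norm.
have mE n : measurable_fun setT (EFin \o f_ n) by exact/measurable_EFinP.
have mE' : measurable_fun setT (EFin \o f) by exact/measurable_EFinP.
have cE : {ae P, forall x, setT x -> (EFin \o f_ n) x @[n --> \oo] --> (EFin \o f) x}.
  by apply: filterS cf => x cx _; apply/fine_cvgP; split; first exact: nearW.
have bE : {ae P, forall x n, setT x -> (`|(EFin \o f_ n) x| <= (EFin \o cst C) x)%E}.
  by apply: aeW => x n _; rewrite /= lee_fin.
have [intf _ cI] := dominated_convergence measurableT mE mE' cE intC bE.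
apply: fine_cvg; rewrite fineK //; exact: integrable_fin_num.
Qed.

End bounded_convergence.

Section borel_rV_measurability.
Context {R : realType} (p : nat) d (S : measurableType d).

(** The sigma-algebra of [borel_rV] is generated by open sets, not by coordinates. An open set is
    the countable union of the rational boxes it contains, and the preimage of a box is a finite
    intersection of coordinate events. *)
Lemma measurable_borel_rV_coord (X : S -> borel_rV R p) :
  (forall i, measurable_fun setT (fun w => (X w : 'rV[R]_p) 0 i)) ->
  measurable_fun setT X.
Proof.
move=> mX; apply: (@measurability _ _ S (borel_rV R p) setT X (@open 'rV[R]_p)) => // _ [U oU <-].
rewrite setTI.
pose box (cr : 'rV[rat]_p * rat) : set 'rV[R]_p :=
  [set x | forall i, `|x 0 i - ratr (cr.1 0 i)| < ratr cr.2].
pose F cr := if `[< box cr `<=` U >] then X @^-1` box cr else set0.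
have -> : X @^-1` U = \bigcup_cr F cr.
  apply/seteqP; split => [w Uw|w [cr _]]; last first.
    by rewrite /F; case: asboolP => // bU; exact: bU.
  have : nbhs (X w : 'rV[R]_p) U by apply: open_nbhs_nbhs; split.
  move=> /nbhs_ballP[r /= r0 rU].
  have r20 : 0 < r / 2 by rewrite divr_gt0.
  have [e /[!in_itv]/= /andP[e0 er]] := rat_in_itvoo r20.
  have /choice[c hc] : forall i, exists c : rat, `|(X w : 'rV[R]_p) 0 i - ratr c| < ratr e.
    move=> i; have /rat_in_itvoo[c /[!in_itv]/= /andP[c1 c2]] :
      (X w : 'rV[R]_p) 0 i < (X w : 'rV[R]_p) 0 i + ratr e by rewrite ltrDl.
    by exists c; rewrite ltr0_norm ?subr_lt0// opprB ltrBlDl.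
  exists (\row_i c i, e) => //; rewrite /F; case: asboolP => [_|].
    by rewrite /= => i; rewrite /= mxE.
  case=> y /= hy; apply: rU; split => // i j.
  rewrite ord1 /ball /=; rewrite (le_lt_trans (ler_distD (ratr (c j)) _ _))//.
  have := hy j; rewrite mxE => hyj.
  have := hc j; rewrite [X in _ -> _ + X < _]distrC => hcj.
  by have er' := ltW er; lra.
apply: countable_bigcupT_measurable; first exact: countableP.
move=> cr; rewrite /F; case: ifP => _ //.
rewrite (_ : X @^-1` box cr =
  \bigcap_(i in [set: 'I_p]) ((fun w => (X w : 'rV[R]_p) 0 i) @^-1`
     `](ratr (cr.1 0 i) - ratr cr.2), (ratr (cr.1 0 i) + ratr cr.2)[%classic)).
  apply: fin_bigcap_measurable => // i _; rewrite -[X in measurable X]setTI.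
  exact: (mX i measurableT).
by apply/seteqP; split => w h i => [_|]; have := h i; rewrite /= in_itv /= ltr_distl //;
  exact.
Qed.

End borel_rV_measurability.

Section pushforward_law.
Context {R : realType} d d' (S : measurableType d) (T : measurableType d').
Variable P : probability S R.

Lemma law_exists (X : S -> T) : measurable_fun setT X ->
  exists2 nu : probability T R, (forall A, nu A = P (X @^-1` A)) &
    forall (f : T -> R) (C : R), measurable_fun setT f -> (forall y, `|f y| <= C) ->
      \int[nu]_y f y = \int[P]_w f (X w).
Proof.
move=> mX; exists (distribution P (mfun_Sub (mem_set mX))) => // f C mf fC.
rewrite /Rintegral integral_distribution//; first exact/measurable_EFinP.
apply: (@bounded_integrable _ _ _ _ (f \o X) C) => //; first exact: measurableT_comp.
by move=> w; exact: fC.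
Qed.

End pushforward_law.

Section cos_transform.
Context {R : realType}.

Lemma measurable_cos_affine (r phi : R) : measurable_fun setT (fun x : R => cos (r * x + phi)).
Proof.
apply: continuous_measurable_fun => x.
have cl : (fun x : R => r * x + phi) @ x --> r * x + phi.
  by apply: cvgD; [apply: cvgMr; exact: cvg_id|exact: cvg_cst].
by apply: (continuous_comp cl); exact: continuous_cos.
Qed.

(** Uniqueness as a special case of convergence: a constant sequence with law [mu] converges in law
    to [nu], the line being embedded as rows of length 1. *)
Lemma Rintegral_eq_cos (mu nu : probability (measurableTypeR R) R) :
  (forall r phi, \int[mu]_x cos (r * x + phi) = \int[nu]_x cos (r * x + phi)) ->
  forall (f : R -> R) (M : R), continuous f -> (forall x, `|f x| <= M) ->
  \int[mu]_x f x = \int[nu]_x f x.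
Proof.
move=> munu f M cf fM.
pose X (x : measurableTypeR R) : borel_rV R 1 := const_mx x : 'rV[R]_1.
have mX : measurable_fun setT X.
  apply: measurable_borel_rV_coord => i.
  by under eq_fun do rewrite mxE; exact: measurable_id.
pose g (x : 'rV[R]_1) := f (x 0 0).
have cg : continuous g.
  move=> x; apply: (continuous_comp _ (cf (x 0 0))); exact: coord_continuous.
have gM (x : 'rV[R]_1) : `|g x| <= M by exact: fM.
have mcos (u : 'rV[R]_1) phi : measurable_fun setT
    (fun x : borel_rV R 1 => cos (((x : 'rV[R]_1) *m u^T) 0 0 + phi)).
  apply: measurable_borel_rV_continuous.
  by apply: trigpoly_continuous; exact: trigpoly_cos.
have [muX muXE muXI] := law_exists mu mX.
have [nuX nuXE nuXI] := law_exists nu mX.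
have cosM (x : R) : `|cos x| <= 1 by exact: cos_max.
have XE (u : 'rV[R]_1) x : ((X x : 'rV[R]_1) *m u^T) 0 0 = u 0 0 * x.
  by rewrite mxE big_ord1 !mxE mulrC.
have tight eps : 0 < eps -> exists2 L : R, 0 < L &
    \forall n \near \oo, (mu [set w | (L < `|X w : 'rV[R]_1|)%R] <= eps%:E)%E.
  move=> e0; have [L L0 hL] := probability_tight muX e0.
  by exists L => //; apply: nearW => _; move: hL; rewrite muXE.
have := @cvg_in_law_trig _ _ _ _ mu (fun _ => X) nuX (fun _ => mX) tight _ g cg
  (ex_intro _ M gM).
have cosE : forall (u : 'rV[R]_1) phi,
     (fun n : nat => \int[mu]_w cos (((X w : 'rV[R]_1) *m u^T) 0 0 + phi)) @ \oo -->
     \int[nuX]_x cos (((x : 'rV[R]_1) *m u^T) 0 0 + phi).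
  move=> u phi; rewrite (nuXI _ 1 (mcos u phi))//.
  have E (k : probability (measurableTypeR R) R) :
      \int[k]_w cos (((X w : 'rV[R]_1) *m u^T) 0 0 + phi) = \int[k]_x cos (u 0 0 * x + phi).
    by apply: eq_Rintegral => x _; rewrite XE.
  by rewrite !E munu; exact: cvg_cst.
move=> /(_ cosE) /cvg_lim => /(_ (@norm_hausdorff _ _)).
rewrite lim_cst// (nuXI g M _ gM); last exact: measurable_borel_rV_continuous.
have gX (k : probability (measurableTypeR R) R) : \int[k]_w g (X w) = \int[k]_x f x.
  by apply: eq_Rintegral => x _; rewrite /g mxE.
by rewrite !gX.
Qed.

(** Continuous ramps carry the equality to open rays, a generating family stable under
    intersection. *)
Lemma eq_probability_cos (mu nu : probability (measurableTypeR R) R) :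
  (forall r phi, \int[mu]_x cos (r * x + phi) = \int[nu]_x cos (r * x + phi)) ->
  forall A, measurable A -> mu A = nu A.
Proof.
move=> munu.
have ray (a : R) : mu `]a, +oo[%classic = nu `]a, +oo[%classic.
  (* A ramp of slope [n] starting at [a]: bounded by 1, with the indicator of the open ray as its
     pointwise limit. *)
  pose f_ n (y : R) := Num.min 1 (n%:R * Num.max 0 (y - a)).
  have cf n : continuous (f_ n).
    move=> y; apply: (@continuous_min _ _ (cst 1) (fun y => n%:R * Num.max 0 (y - a))).
      exact: cvg_cst.
    apply: cvgMr; apply: (@continuous_max _ _ (cst 0) (fun y => y - a)).
      exact: cvg_cst.
    by apply: cvgB; [exact: cvg_id|exact: cvg_cst].
  have fM n y : `|f_ n y| <= 1.
    have h : 0 <= n%:R * Num.max 0 (y - a) by rewrite mulr_ge0// le_max lexx.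
    by rewrite ger0_norm /f_ ?le_min ?ler01//= ge_min lexx.
  have mf n : measurable_fun setT (f_ n) by exact: continuous_measurable_fun.
  have cvf (y : R) : (fun n => f_ n y) @ \oo --> (\1_(`]a, +oo[%classic) y : R).
    rewrite indicE mem_setE in_itv /= andbT; have [ay|ya] := ltP a y.
      apply: cvg_near_cst; have [k _ hk] := nbhs_infty_ger (y - a)^-1.
      exists k => // n /= kn; have ya0 : 0 < y - a by rewrite subr_gt0.
      rewrite /f_ max_r ?ltW// min_l//.
      by rewrite -ler_pdivrMr// mul1r; exact: hk.
    apply: cvg_near_cst; apply: nearW => n.
    by rewrite /f_ max_l ?subr_le0// mulr0 min_r.
  have lawE (k : probability (measurableTypeR R) R) :
      (fun n => \int[k]_x f_ n x) @ \oo --> fine (k `]a, +oo[%classic).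
    have -> : fine (k `]a, +oo[%classic) = \int[k]_x \1_(`]a, +oo[%classic) x.
      by rewrite /Rintegral integral_indic// setIT.
    apply: (@bounded_dominated_cvg _ _ _ k f_ _ 1) => //.
      by apply: aeW => y; exact: cvf.
  have h := lawE mu; rewrite (_ : (fun n => _) = (fun n => \int[nu]_x f_ n x)) in h.
    have := cvg_unique _ h (lawE nu); move=> /(_ (@norm_hausdorff _ _)) hE.
    by rewrite -(fineK (fin_num_measure mu _ _)) // hE fineK // fin_num_measure.
  by apply/funext => n; exact: (Rintegral_eq_cos munu (cf n) (fM n)).
move=> A mA; refine (@measure_unique _ R (measurableTypeR R) (@RGenOInfty.G R)
  (fun n : nat => `](- n%:R), +oo[%classic) _ _ _ _ mu nu _ _ A mA).
- exact: RGenOInfty.measurableE.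
- move=> _ _ [x ->] [y ->]; exists (Num.max x y).
  by apply/seteqP; split => z /=; rewrite !in_itv /= !andbT gt_max => /andP.
- by move=> n; exists (- n%:R).
- apply/seteqP; split => // x _; have [k _ hk] := nbhs_infty_gtr (- x).
  exists k => //=; rewrite in_itv /= andbT ltrNl; exact: hk k (leqnn k).
- by move=> _ [x ->]; exact: ray.
- by move=> n; rewrite (le_lt_trans (probability_le1 _ _)) ?ltry.
Qed.

End cos_transform.

(** * Construction of the multivariate normal law, possibly degenerate *)

Section psd_factorization.
Context {R : realType}.

Lemma bform_delta n (Q : 'M[R]_n) x j : bform Q x (delta_mx 0 j) = (x *m Q) 0 j.
Proof.
rewrite /bform mxE (bigD1 j) //= big1 => [|k kj]; first by rewrite !mxE !eqxx mulr1 addr0.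
by rewrite !mxE (negPf kj) andbF mulr0.
Qed.

Lemma psd_cauchy_schwarz n (Q : 'M[R]_n) (x y : 'rV[R]_n) : Q^T = Q ->
  (forall x, 0 <= bform Q x x) -> bform Q x y ^+ 2 <= bform Q x x * bform Q y y.
Proof.
move=> QT Q0.
have key (s t : R) : 0 <= s ^+ 2 * bform Q x x - 2 * s * t * bform Q x y + t ^+ 2 * bform Q y y.
  have := Q0 (s *: x + (- t) *: y).
  rewrite bformDl !bformDr !bformZl !bformZr (bformC y x QT).
  by congr (_ <= _); ring.
have [y0|y0] := eqVneq (bform Q y y) 0.
  rewrite y0 mulr0; have [->|xy0] := eqVneq (bform Q x y) 0; first by rewrite expr0n.
  (* With [bform Q y y = 0] this value of [t] would make the form equal to [-1]. *)
  have := key 1 ((bform Q x x + 1) / (2 * bform Q x y)).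
  have -> : 2 * 1 * ((bform Q x x + 1) / (2 * bform Q x y)) * bform Q x y = bform Q x x + 1.
    by field; rewrite xy0.
  by rewrite y0; lra.
have yp : 0 < bform Q y y by rewrite lt0r y0 Q0.
have := key (bform Q y y) (bform Q x y).
have -> : bform Q y y ^+ 2 * bform Q x x - 2 * bform Q y y * bform Q x y * bform Q x y +
  bform Q x y ^+ 2 * bform Q y y =
  bform Q y y * (bform Q x x * bform Q y y - bform Q x y ^+ 2) by ring.
by rewrite pmulr_rge0// subr_ge0.
Qed.

(** A Cholesky factorisation by induction: subtracting [v^T v] clears the first row and column,
    Cauchy-Schwarz keeps the rest positive semidefinite, and the induction hypothesis factors the
    remaining block. *)
Lemma psd_factorization n (Q : 'M[R]_n) : Q^T = Q -> (forall x, 0 <= bform Q x x) ->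
  exists A : 'M[R]_n, Q = A^T *m A.
Proof.
elim: n Q => [|n IH] Q QT Q0; first by exists 0; apply/matrixP => -[].
pose e0 : 'rV[R]_n.+1 := delta_mx 0 0.
pose a := Q 0 0.
(* If the corner [a] is 0, the convention on inverses makes [v] zero; the first row of [Q] then
   vanishes already, by Cauchy-Schwarz. *)
pose v : 'rV[R]_n.+1 := (Num.sqrt a)^-1 *: row 0 Q.
have QE i j : Q i j = Q j i by rewrite -[in LHS]QT mxE.
have e0Q : e0 *m Q = row 0 Q by rewrite -rowE.
have aE : bform Q e0 e0 = a by rewrite bform_delta e0Q mxE.
have a0 : 0 <= a by rewrite -aE.
have xQ x : bform Q x e0 = (x *m (row 0 Q)^T) 0 0.
  by rewrite bform_delta !mxE; apply: eq_bigr => k _; rewrite !mxE QE.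
have xv x : (x *m v^T) 0 0 ^+ 2 = a^-1 * bform Q x e0 ^+ 2.
  rewrite /v linearZ /= -scalemxAr mxE -xQ exprMn exprVn sqr_sqrtr //.
have [Q' Q'def] : exists Q', Q' = Q - v^T *m v by exists (Q - v^T *m v).
have Q'E x : bform Q' x x = bform Q x x - (x *m v^T) 0 0 ^+ 2.
  rewrite /bform Q'def mulmxBr mulmxBl !mulmxA mxE [in X in _ + X]mxE; congr (_ - _).
  rewrite -[x *m v^T *m v *m x^T]mulmxA mxE big_ord1 expr2; congr (_ * _).
  by rewrite !mxE; apply: eq_bigr => k _; rewrite !mxE mulrC.
have Q'0 x : 0 <= bform Q' x x.
  rewrite Q'E subr_ge0 xv.
  have := psd_cauchy_schwarz x e0 QT Q0; rewrite aE => h.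
  have [a_0|an0] := eqVneq a 0; first by rewrite a_0 invr0 mul0r.
  by rewrite ler_pdivrMl ?lt0r ?an0// mulrC.
have Q'T : Q'^T = Q' by rewrite Q'def linearB /= trmx_mul trmxK QT.
have Q'0j j : Q' 0 j = 0.
  rewrite Q'def !mxE big_ord1 !mxE mulrACA -invfM -expr2 sqr_sqrtr// -/a.
  have [a_0|an0] := eqVneq a 0; last by rewrite mulrA mulVf// mul1r subrr.
  rewrite a_0 invr0 mul0r subr0.
  have := psd_cauchy_schwarz (delta_mx 0 j) e0 QT Q0.
  rewrite aE a_0 mulr0 xQ -rowE !mxE => h.
  have {h} : Q 0 j ^+ 2 <= 0 by exact: h.
  by rewrite le_eqVlt ltNge sqr_ge0 orbF sqrf_eq0 => /eqP.
have Q'j0 i : Q' i 0 = 0 by rewrite -Q'T mxE Q'0j.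
have l0 : lshift n (0 : 'I_1) = 0 :> 'I_(1 + n) by exact/val_inj.
pose r (i : 'I_n) : 'I_(1 + n) := rshift 1 i.
pose Q1 : 'M[R]_n := \matrix_(i, j) Q' (r i) (r j).
have [||A1 hA1] := IH Q1.
- by apply/matrixP => i j; rewrite !mxE -[in LHS]Q'T mxE.
- move=> x; have [y y0 yr] : exists2 y : 'rV[R]_n.+1, y 0 0 = 0 & forall j, y 0 (r j) = x 0 j.
    exists (row_mx 0 x : 'rV_(1 + n)) => [|j]; last exact: row_mxEr.
    by have := row_mxEl (0 : 'M[R]_1) x 0 (0 : 'I_1); rewrite l0 => ->; rewrite mxE.
  have := Q'0 y; congr (_ <= _); rewrite /bform !mxE.
  rewrite (@big_split_ord _ _ _ 1 n) /= big_ord1 l0 [X in _ * X + _]mxE y0 mulr0 add0r.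
  apply: eq_bigr => j _; congr (_ * _); last by rewrite [LHS]mxE yr [RHS]mxE.
  rewrite !mxE (@big_split_ord _ _ _ 1 n) /= big_ord1 l0 y0 mul0r add0r.
  by apply: eq_bigr => k _; rewrite yr mxE.
pose B : 'M[R]_(n, 1 + n) := row_mx 0 A1.
exists (col_mx (v : 'rV[R]_(1 + n)) B : 'M[R]_(1 + n)).
have E : (col_mx (v : 'rV[R]_(1 + n)) B)^T *m col_mx (v : 'rV[R]_(1 + n)) B =
    (v : 'rV[R]_(1 + n))^T *m v + B^T *m B by rewrite tr_col_mx mul_row_col.
refine (etrans _ (esym E)).
rewrite -[LHS](subrK (v^T *m v)) addrC; congr (_ + _).
rewrite -Q'def; apply/matrixP => i j.
have Br k j' : B k (r j') = A1 k j' by exact: row_mxEr.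
have B0 k : B k 0 = 0.
  by have := row_mxEl (0 : 'M[R]_(n, 1)) A1 k (0 : 'I_1); rewrite l0 => ->; rewrite mxE.
move: B {E} Br B0 => B Br B0.
have [i' ->|i' ->] := @split_ordP 1 n i.
  by rewrite ord1 l0 Q'0j mxE big1 // => k _; rewrite mxE B0 mul0r.
have [j' ->|j' ->] := @split_ordP 1 n j.
  by rewrite ord1 l0 Q'j0 mxE big1 // => k _; rewrite B0 mulr0.
have := congr1 (fun M : 'M[R]_n => M i' j') hA1; rewrite !mxE => ->.
by apply: eq_bigr => k _; rewrite !mxE !Br.
Qed.

End psd_factorization.

Section gaussian_vector.
Context {R : realType}.

Lemma Rintegral_cos_normal_prob (s r phi : R) : s != 0 ->
  \int[normal_prob 0 s]_x cos (r * x + phi) = expR (- (s ^+ 2 / 2 * r ^+ 2)) * cos phi.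
Proof.
move=> s0; rewrite -Rintegral_cos_normal_pdf//.
(* The density formula is stated for nonnegative functions; the added 1 integrates to 1 on both
   sides and cancels. *)
pose f x := 1 + cos (r * x + phi).
have mcos := measurable_cos_affine r phi.
have f0 x : (0 <= (f x)%:E)%E by rewrite lee_fin -lerBlDl sub0r cos_geN1.
have mf : measurable_fun setT f by apply: measurable_funD.
have mEf : measurable_fun setT (EFin \o f) by exact/measurable_EFinP.
have intN : (normal_prob 0 s).-integrable setT (EFin \o (fun x => cos (r * x + phi))).
  by apply: (@bounded_integrable _ _ _ (normal_prob 0 s) _ 1) => // x; exact: cos_max.
have int1 : (normal_prob 0 s).-integrable setT (EFin \o (cst 1 : R -> R)).
  by apply: (@bounded_integrable _ _ _ (normal_prob 0 s) _ 1) => // x; rewrite normr1.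
have mpdf := @measurable_normal_pdf R 0 s.
have intp : (@lebesgue_measure R).-integrable setT (EFin \o normal_pdf 0 s).
  exact: integrable_normal_pdf.
have intcp : (@lebesgue_measure R).-integrable setT
    (EFin \o (fun x => cos (r * x + phi) * normal_pdf 0 s x)).
  apply: le_integrable intp => //.
    by apply/measurable_EFinP; exact: measurable_funM.
  move=> x _; rewrite lee_fin normrM (ger0_norm (normal_pdf_ge0 _ _ _)).
  by rewrite ler_piMl ?cos_max// normal_pdf_ge0.
have E : \int[normal_prob 0 s]_x f x = \int[lebesgue_measure]_x (f x * normal_pdf 0 s x).
  rewrite /Rintegral; congr fine.
  exact: (@integral_density _ _ _ lebesgue_measure (normal_prob 0 s) _ mpdf
    (normal_pdf_ge0 _ _) (fun A mA => erefl) _ mEf f0).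
move: E; rewrite /f RintegralD//.
have -> : (fun x : R => (1 + cos (r * x + phi)) * normal_pdf 0 s x) =
  (fun x : R => normal_pdf 0 s x + cos (r * x + phi) * normal_pdf 0 s x).
  by apply/funext => x; rewrite mulrDl mul1r.
rewrite RintegralD//.
rewrite (prob_Rintegral_cst (normal_prob 0 s)) {2}/Rintegral integral_normal_pdf//=.
exact: addrI.
Qed.

Lemma measurable_cos_form p (u : 'rV[R]_p) phi :
  measurable_fun setT (fun x : borel_rV R p => cos (((x : 'rV[R]_p) *m u^T) 0 0 + phi)).
Proof.
by apply: measurable_borel_rV_continuous; apply: trigpoly_continuous; exact: trigpoly_cos.
Qed.

Lemma measurable_borel_rV_entry p i :
  measurable_fun setT (fun x : borel_rV R p => (x : 'rV[R]_p) 0 i).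
Proof. by apply: measurable_borel_rV_continuous => x; exact: coord_continuous. Qed.

Lemma standard_gaussian p : exists nu : probability (borel_rV R p) R,
  forall (u : 'rV[R]_p) phi,
    \int[nu]_x cos (((x : 'rV[R]_p) *m u^T) 0 0 + phi) =
    expR (- ((u *m u^T) 0 0 / 2)) * cos phi.
Proof.
elim: p => [|p [nu hnu]].
  pose o : borel_rV R 0 := (0 : 'rV[R]_0).
  exists (\d_o : probability (borel_rV R 0) R) => u phi.
  have -> : (u *m u^T) 0 0 = 0 by rewrite mxE big_ord0.
  rewrite mul0r oppr0 expR0 mul1r.
  have -> : (fun x : 'rV[R]_0 => cos ((x *m u^T) 0 0 + phi)) = cst (cos phi).
    by apply/funext => x; rewrite /= mxE big_ord0 add0r.
  exact: (prob_Rintegral_cst (\d_o : probability (borel_rV R 0) R)).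
pose N1 : probability (measurableTypeR R) R := normal_prob 0 1.
pose P := (nu \x N1)%E.
pose X (w : borel_rV R p * measurableTypeR R) : borel_rV R p.+1 :=
  \row_i oapp (fun j => (w.1 : 'rV[R]_p) 0 j) w.2 (unlift 0 i).
have mX : measurable_fun setT X.
  apply: measurable_borel_rV_coord => i.
  have [j ->|->] := unliftP 0 i.
    under eq_fun do rewrite mxE liftK /=.
    exact: (measurableT_comp (measurable_borel_rV_entry j) measurable_fst).
  by under eq_fun do rewrite mxE unlift_none /=; exact: measurable_snd.
have [nu' _ nu'I] := law_exists P mX.
exists nu' => u phi.
rewrite (nu'I _ 1 (measurable_cos_form u phi)); last by move=> y; exact: cos_max.
pose v := u 0 0; pose u' : 'rV[R]_p := \row_j u 0 (lift 0 j).
have XE x y : ((X (x, y) : 'rV[R]_p.+1) *m u^T) 0 0 = v * y + ((x : 'rV[R]_p) *m u'^T) 0 0.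
  rewrite !mxE big_ord_recl !mxE unlift_none mulrC; congr (_ + _).
  by apply: eq_bigr => j _; rewrite !mxE liftK.
have uE : (u *m u^T) 0 0 = v ^+ 2 + (u' *m u'^T) 0 0.
  rewrite !mxE big_ord_recl !mxE expr2; congr (_ + _).
  by apply: eq_bigr => j _; rewrite !mxE.
pose F (w : borel_rV R p * measurableTypeR R) := cos (((X w : 'rV[R]_p.+1) *m u^T) 0 0 + phi).
have mF : measurable_fun setT F.
  exact: (measurableT_comp (measurable_cos_form u phi) mX).
have intF : P.-integrable setT (EFin \o F).
  by apply: (@bounded_integrable _ _ _ P F 1) => // x; exact: cos_max.
have IE x : (\int[N1]_y (F (x, y))%:E)%E =
    (expR (- (v ^+ 2 / 2)) * cos (((x : 'rV[R]_p) *m u'^T) 0 0 + phi))%:E.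
  rewrite /F; under eq_integral do rewrite XE -addrA.
  have mc := measurable_cos_affine v (((x : 'rV[R]_p) *m u'^T) 0 0 + phi).
  rewrite -[LHS]fineK.
    congr EFin; have := Rintegral_cos_normal_prob v (((x : 'rV[R]_p) *m u'^T) 0 0 + phi)
      (oner_neq0 R); rewrite /Rintegral => ->.
    by rewrite expr1n; congr (expR _ * _); ring.
  apply: integrable_fin_num => //.
  by apply: (@bounded_integrable _ _ _ N1 _ 1) => // y; exact: cos_max.
rewrite /Rintegral -[X in fine X](integral12_prod_meas1 intF) /fubini_F.
under eq_integral do rewrite /= IE.
rewrite -/(Rintegral _ _ _) RintegralZl// ?hnu.
  by rewrite mulrA -expRD uE; congr (expR _ * _); ring.
apply: (@bounded_integrable _ _ _ nu _ 1); first exact: measurable_cos_form.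
by move=> y; exact: cos_max.
Qed.

End gaussian_vector.

Section multivariate_gaussian.
Context {R : realType} (p : nat).

Lemma measurable_linear_form (u : 'rV[R]_p) :
  measurable_fun setT (fun x : borel_rV R p => ((x : 'rV[R]_p) *m u^T) 0 0).
Proof.
apply: measurable_borel_rV_continuous => x.
apply: (@cvg_coord _ _ _ _ _ (fun y : 'rV[R]_p => y *m u^T)).
have idx : id @ x --> x by [].
exact: (cvg_mulmx _ idx (cvg_cst u^T)).
Qed.

(** The image of the standard Gaussian under a factor [A] of [S]. The law of each linear form is
    identified by its cosine transform, with the point mass when the variance is 0. *)
Lemma multivariate_normal_exists (S : 'M[R]_p) : S^T = S -> (forall x, 0 <= bform S x x) ->
  exists2 nu : probability (borel_rV R p) R, multivariate_normal 0 S nu &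
    forall (u : 'rV[R]_p) phi, \int[nu]_x cos (((x : 'rV[R]_p) *m u^T) 0 0 + phi) =
      expR (- (bform S u u / 2)) * cos phi.
Proof.
move=> ST S0; have [A SA] := psd_factorization ST S0.
have [nu0 nu0E] := @standard_gaussian R p.
pose X (x : borel_rV R p) : borel_rV R p := (x : 'rV[R]_p) *m A.
have mX : measurable_fun setT X.
  apply: measurable_borel_rV_coord => i.
  have -> : (fun w : borel_rV R p => (X w : 'rV[R]_p) 0 i) =
      (fun x => ((x : 'rV[R]_p) *m (row i A^T)^T) 0 0).
    apply/funext => x; rewrite /X !mxE; apply: eq_bigr => k _.
    by rewrite !mxE.
  exact: measurable_linear_form.
have [nu _ nuI] := law_exists nu0 mX.
have cosE (u : 'rV[R]_p) phi : \int[nu]_x cos (((x : 'rV[R]_p) *m u^T) 0 0 + phi) =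
      expR (- (bform S u u / 2)) * cos phi.
  rewrite (nuI _ 1 (measurable_cos_form u phi)); last by move=> y; exact: cos_max.
  have -> : bform S u u = ((u *m A^T) *m (u *m A^T)^T) 0 0.
    by rewrite /bform SA trmx_mul trmxK !mulmxA.
  rewrite -nu0E; apply: eq_Rintegral => x _.
  by rewrite /X trmx_mul trmxK mulmxA.
exists nu => //; split => // u B mB; rewrite mul0mx mxE -/(bform S u u).
have [lam lamE lamI] :=
  @law_exists R _ _ _ (measurableTypeR R) nu _ (measurable_linear_form u).
rewrite -[LHS]lamE /normal_law.
have lamcos r phi : \int[lam]_x cos (r * x + phi) = expR (- (bform S u u / 2 * r ^+ 2)) * cos phi.
  rewrite (lamI _ 1 (measurable_cos_affine r phi)); last by move=> y; exact: cos_max.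
  have := cosE (r *: u) phi; rewrite bformZl bformZr => h.
  rewrite (_ : bform S u u / 2 * r ^+ 2 = r * (r * bform S u u) / 2) -?h; last by ring.
  by apply: eq_Rintegral => x _; rewrite linearZ /= -scalemxAr [in RHS]mxE.
case: eqVneq => [v0|v0].
  refine (@eq_probability_cos R lam (\d_(0 : measurableTypeR R)) _ B mB) => r phi.
  rewrite lamcos v0 !mul0r oppr0 expR0 mul1r /Rintegral integral_dirac ?diracT ?mul1e//=.
    by rewrite mulr0 add0r.
  by apply/measurable_EFinP; exact: measurable_cos_affine.
refine (@eq_probability_cos R lam (normal_prob 0 (Num.sqrt (bform S u u))) _ B mB) => r phi.
rewrite lamcos Rintegral_cos_normal_prob ?sqr_sqrtr//.
by rewrite sqrtr_eq0 -ltNge lt0r v0 S0.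
Qed.

End multivariate_gaussian.

(** * The urn process as a finite-valued Markov chain *)

Section finite_valued.
Context {R : realType} d (S : measurableType d) (P : probability S R).

(** The target carries no sigma-algebra: measurable fibres over a finite range make every function
    of [X] measurable and its integral a finite sum. *)
Definition finite_valued (T : choiceType) (X : S -> T) : Prop :=
  (exists s : seq T, forall w, X w \in s) /\ forall x, measurable [set w | X w = x].

Lemma finite_valued_preimage (T : choiceType) (X : S -> T) (A : set T) :
  finite_valued X -> measurable (X @^-1` A).
Proof.
move=> [[s Xs] mX]; pose F x := if `[< A x >] then [set w | X w = x] else set0.
have -> : X @^-1` A = \big[setU/set0]_(x <- s) F x.
  rewrite -bigcup_seq; apply/seteqP; split => [w Aw|w [x _]]; last first.
    by rewrite /F; case: asboolP => // Ax /= ->.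
  by exists (X w) => /=; [exact: Xs|rewrite /F; case: asboolP].
by apply: bigsetU_measurable => x _; rewrite /F; case: ifP.
Qed.

Lemma finite_valued_comp (T T' : choiceType) (X : S -> T) (g : T -> T') :
  finite_valued X -> finite_valued (g \o X).
Proof.
move=> fX; split=> [|y]; last exact: (finite_valued_preimage [set x | g x = y] fX).
by have [[s Xs] _] := fX; exists (map g s) => w; exact: map_f.
Qed.

Lemma finite_valued_pair (T T' : choiceType) (X : S -> T) (Y : S -> T') :
  finite_valued X -> finite_valued Y -> finite_valued (fun w => (X w, Y w)).
Proof.
move=> [[s Xs] mX] [[s' Ys] mY]; split=> [|[x y]].
  by exists [seq (x, y) | x <- s, y <- s'] => w; exact: allpairs_f.
rewrite (_ : [set w | _] = [set w | X w = x] `&` [set w | Y w = y]).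
  exact: measurableI.
by apply/seteqP; split => w /= [-> ->].
Qed.

Lemma finite_valued_measurable (T : choiceType) d' (T' : measurableType d') (X : S -> T)
  (g : T -> T') : finite_valued X -> measurable_fun setT (fun w => g (X w)).
Proof. by move=> fX _ A _; rewrite setTI; exact: (finite_valued_preimage (g @^-1` A) fX). Qed.

Lemma finite_valued_ffun (I : finType) (Y : I -> S -> bool) :
  (forall i, measurable_fun setT (Y i)) -> finite_valued (fun w => [ffun i => Y i w]).
Proof.
move=> mY; split=> [|y]; first by exists (enum {: {ffun I -> bool}}) => w; rewrite mem_enum.
rewrite (_ : [set w | _] = \bigcap_(i in [set: I]) (Y i @^-1` [set y i])).
  apply: fin_bigcap_measurable => // i _; rewrite -[X in measurable X]setTI.
  exact: mY.
apply/seteqP; split => [w /= <- i _|w h]; first by rewrite /= ffunE.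
by apply/ffunP => i; rewrite ffunE; exact: h.
Qed.

Lemma Rintegral_finite_valued (T : choiceType) (X : S -> T) (s : seq T) (g : T -> R) :
  finite_valued X -> uniq s -> (forall w, X w \in s) ->
  \int[P]_w g (X w) = \sum_(x <- s) g x * fine (P [set w | X w = x]).
Proof.
move=> [_ mX] us Xs.
have gE w : g (X w) = \sum_(x <- s) g x * \1_[set w | X w = x] w.
  rewrite (bigD1_seq (X w))//= big1 ?addr0.
    by rewrite indicE mem_set// mulr1.
  by move=> x xX; rewrite indicE memNset ?mulr0//= => Xx; rewrite Xx eqxx in xX.
rewrite /Rintegral.
under eq_integral do rewrite gE -sumEFin.
rewrite integral_sum//; last first.
  move=> x; apply: (@bounded_integrable _ _ _ P _ `|g x|) => [|w].
    by apply: measurable_funM => //; exact: measurable_indic.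
  by rewrite normrM ler_piMr// indicE; case: (_ \in _); rewrite ?normr1 ?normr0.
have E x : (\int[P]_w (g x * \1_[set w | X w = x] w)%:E = (g x * fine (P [set w | X w = x]))%:E)%E.
  under eq_integral do rewrite EFinM.
  rewrite integralZl//; last first.
    apply: (@bounded_integrable _ _ _ P _ 1) => [|w]; first exact: measurable_indic.
    by rewrite indicE; case: (_ \in _); rewrite ?normr1 ?normr0.
  by rewrite integral_indic// setIT EFinM fineK// fin_num_measure.
by under eq_bigr do rewrite E; rewrite sumEFin.
Qed.

End finite_valued.

Section conditional_probability.
Context {R : realType} d (Omega : measurableType d) (P : probability Omega R).

(** The process prescribes conditional probabilities of white draws only; black draws are the
    complements. *)
Lemma cond_probC (G : set (set Omega)) (A : set Omega) (f : Omega -> R) :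
  G `<=` measurable -> measurable A -> cond_prob P G A f ->
  cond_prob P G (~` A) (fun w => 1 - f w).
Proof.
move=> Gm mA [fG intf fA].
have int1 : P.-integrable setT (EFin \o (cst 1 : Omega -> R)).
  by apply: (@bounded_integrable _ _ _ P _ 1) => // x; rewrite normr1.
split.
- move=> _ [B mB <-]; apply: fG; exists ((fun x => 1 - x) @^-1` B) => //.
  rewrite -[X in measurable X]setTI.
  have mg : measurable_fun setT (fun x : R => 1 - x) by exact: measurable_funB.
  exact: mg.
- exact: (integrableB measurableT int1 intf).
- move=> C GC; have mC := Gm _ GC.
  have -> : (\int[P]_(w in C) (1 - f w)%:E = \int[P]_(w in C) ((cst 1 w)%:E - (f w)%:E))%E by [].
  rewrite integralB//; [|exact: integrableS int1|exact: integrableS intf].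
  rewrite fA// [X in _ = P X]setIC -setDE measureD//; last by rewrite (le_lt_trans (probability_le1 _ _))// ltry.
  rewrite -[X in (X - _)%E]/(\int[P]_(w in C) (cst 1%E) w)%E.
  by rewrite integral_cst// mul1e [A `&` C]setIC.
Qed.

End conditional_probability.

Section urn.
Context {R : realType} (N : nat) (e : rel 'I_N) (m alpha beta : nat).
Context (W0 B0 : 'I_N -> nat) d (Omega : measurableType d) (P : probability Omega R).
Context (W B : nat -> 'I_N -> Omega -> nat) (Y : nat -> 'I_N -> Omega -> bool).
Hypothesis alpha_le : (alpha <= m)%N.
Hypothesis beta_le : (beta <= m)%N.
Hypothesis T0_ge1 : forall i, (1 <= W0 i + B0 i)%N.
Hypothesis urnP : urn_process e m alpha beta W0 B0 P W B Y.

Definition urn_total (t : nat) (i : 'I_N) : nat := W0 i + B0 i + t * (m * indeg e i).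

Definition urn_next (t : nat) (z : 'rV[R]_N) (y : {ffun 'I_N -> bool}) : 'rV[R]_N :=
  \row_i ((z 0 i * (urn_total t i)%:R +
    \sum_(j | e j i) (alpha%:R * (y j)%:R + (m%:R - beta%:R) * (1 - (y j)%:R)))
    / (urn_total t.+1 i)%:R).

Local Notation Z := (urn_state R W B).

Lemma urn_total_gt0 t i : (0 < urn_total t i)%N.
Proof. by rewrite /urn_total addn_gt0 T0_ge1. Qed.

(** Each incoming edge contributes [m] balls whatever its colour, as [alpha + (m - alpha)] or
    [(m - beta) + beta]. The proportions thus follow a recursion with deterministic denominators. *)
Lemma urn_totalE t i w : (W t i w + B t i w)%N = urn_total t i.
Proof.
elim: t => [|t ih]; first by rewrite (urn_W0 urnP) (urn_B0 urnP) /urn_total mul0n addn0.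
rewrite (urn_W_step urnP) (urn_B_step urnP) addnACA ih -big_split /=.
rewrite /urn_total mulSn -addnA [(t * _ + _)%N]addnC; congr addn; congr addn.
rewrite (eq_bigr (fun _ => m)) => [|j _].
  by rewrite sum_nat_const mulnC.
by case: (Y t.+1 j w) => /=; rewrite ?muln1 ?muln0 ?addn0 ?add0n ?subnn ?muln0 ?addn0 ?subnKC ?subnK.
Qed.

Lemma urn_state_next t w : Z t.+1 w = urn_next t (Z t w) [ffun j => Y t.+1 j w].
Proof.
apply/rowP => i; rewrite !mxE /white_proportion !urn_totalE; congr (_ / _).
rewrite divfK ?pnatr_eq0 -?lt0n ?urn_total_gt0//.
rewrite (urn_W_step urnP) natrD natr_sum; congr (_ + _); apply: eq_bigr => j _.
rewrite ffunE natrD !natrM natrB//.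
by case: (Y t.+1 j w); rewrite ?subnn ?subn0 ?subr0 ?subrr.
Qed.

Lemma urn_state01 t w i : 0 <= Z t w 0 i <= 1.
Proof.
rewrite mxE /white_proportion urn_totalE divr_ge0//= ler_pdivrMr ?ltr0n ?urn_total_gt0//.
by rewrite mul1r ler_nat -(urn_totalE t i w) leq_addr.
Qed.

Lemma urn_state_source t w i : indeg e i = 0%N ->
  Z t w 0 i = white_proportion R (W0 i) (B0 i).
Proof.
move=> i0; elim: t => [|t]; first by rewrite mxE (urn_W0 urnP) (urn_B0 urnP).
move=> <-; rewrite !mxE (urn_W_step urnP) (urn_B_step urnP).
have e0 : (fun j => e j i) =1 xpred0.
  by move=> j; apply/negbTE/negP => eji; have := card0_eq i0 j; rewrite !inE eji.
by rewrite !(eq_bigl _ _ e0) !big_pred0_eq !addn0.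
Qed.

Lemma urn_draw_finite t : finite_valued (fun w => [ffun j => Y t.+1 j w]).
Proof. by apply: finite_valued_ffun => i; exact: (urn_measurable_draw urnP). Qed.

Lemma urn_state_finite t : finite_valued (Z t).
Proof.
elim: t => [|t ih].
  have -> : Z 0%N = cst (\row_i white_proportion R (W0 i) (B0 i)).
    by apply/funext => w; apply/rowP => i; rewrite !mxE (urn_W0 urnP) (urn_B0 urnP).
  set z0 := (\row__ _); split=> [|z]; first by exists [:: z0] => w; rewrite inE.
  have [<-|z0z] := pselect (z0 = z).
    by rewrite (_ : [set w | _] = setT)//; apply/seteqP.
  by rewrite (_ : [set w | _] = set0)//; apply/seteqP; split => w //= /z0z.
have -> : Z t.+1 = (fun zy => urn_next t zy.1 zy.2) \o
    (fun w => (Z t w, [ffun j => Y t.+1 j w])).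
  by apply/funext => w; rewrite urn_state_next.
exact: finite_valued_comp (finite_valued_pair ih (urn_draw_finite t)).
Qed.

Lemma urn_filtration_sub t : urn_filtration R W B t `<=` measurable.
Proof.
apply: smallest_sub; first exact: sigma_algebra_measurable.
move=> A [s _ [i _ [C mC <-]]]; rewrite setTI.
exact: (finite_valued_preimage [set z : 'rV[R]_N | C (z 0 i)] (urn_state_finite s)).
Qed.

Lemma urn_filtration_state t (z : 'rV[R]_N) : urn_filtration R W B t [set w | Z t w = z].
Proof.
rewrite (_ : [set w | _] = \bigcap_(i in [set: 'I_N]) [set w | Z t w 0 i = z 0 i]); last first.
  by apply/seteqP; split => [w /= <- i _ //|w h]; apply/rowP => i; exact: h.
pose G : set (set Omega) := \bigcup_(s in [set s : nat | (s <= t)%N]) \bigcup_(i in [set: 'I_N])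
        preimage_set_system setT (fun w => Z s w 0 i) measurable.
apply: (@fin_bigcap_measurable _ (g_sigma_algebraType G)) => // i _.
apply: sub_sigma_algebra; exists t => //=; exists i => //.
by exists [set z 0 i] => //; rewrite setTI.
Qed.

(** By conditional independence the product of the conditional probabilities is a version for the
    whole round of draws. On the event that the state is [z], which belongs to the filtration, this
    product is the constant [bern (z 0) y]. *)
Lemma urn_transition t (z : 'rV[R]_N) (y : {ffun 'I_N -> bool}) :
  fine (P [set w | (Z t w, [ffun j => Y t.+1 j w]) = (z, y)]) =
  fine (P [set w | Z t w = z]) * bern (z 0) y.
Proof.
pose f j w := if y j then Z t w 0 j else 1 - Z t w 0 j.
have cf j : cond_prob P (urn_filtration R W B t) (Y t.+1 j @^-1` [set y j]) (f j).
  rewrite /f; case: (y j); first exact: (urn_draw_prob urnP).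
  rewrite (_ : _ @^-1` _ = ~` (Y t.+1 j @^-1` [set true])).
    apply: cond_probC; [exact: urn_filtration_sub| |exact: (urn_draw_prob urnP)].
    rewrite -[X in measurable X]setTI.
    exact: (urn_measurable_draw urnP).
  by apply/seteqP; split => w /=; case: (Y t.+1 j w).
have [_ _ h] := urn_draw_indep urnP (fun j => (I : measurable [set y j])) cf.
have /esym := h _ (urn_filtration_state z).
rewrite (_ : _ `&` _ = [set w | (Z t w, [ffun j => Y t.+1 j w]) = (z, y)]); last first.
  apply/seteqP; split => [w /= [hy <-]|w /= [<- <-]].
    by congr pair; apply/ffunP => j; rewrite ffunE; exact: hy.
  by split=> // j _ /=; rewrite ffunE.
move=> ->; rewrite (eq_integral (fun w => (bern (z 0) y)%:E)); last first.
  by move=> w /[!inE] /= <-.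
have mz : measurable [set w | Z t w = z] by exact: (urn_state_finite t).2.
by rewrite integral_cst// fineM// ?fin_num_measure// mulrC.
Qed.

Lemma urn_expectation_next t (f : 'rV[R]_N -> R) :
  \int[P]_w f (Z t.+1 w) = \int[P]_w (\sum_y bern (Z t w 0) y * f (urn_next t (Z t w) y)).
Proof.
have [[s0 s0P] _] := urn_state_finite t.
pose s := undup s0.
have us : uniq s by exact: undup_uniq.
have sP w : Z t w \in s by rewrite mem_undup.
rewrite (@Rintegral_finite_valued _ _ _ P _ (Z t) s
  (fun z => \sum_y bern (z 0) y * f (urn_next t z y)) (urn_state_finite t))//.
pose s' := [seq (z, y) | z <- s, y <- index_enum {ffun 'I_N -> bool}].
have us' : uniq s'.
  by apply: allpairs_uniq => //; [exact: index_enum_uniq|move=> [a b] [a' b']].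
under eq_Rintegral do rewrite urn_state_next.
rewrite (@Rintegral_finite_valued _ _ _ P _ (fun w => (Z t w, [ffun j => Y t.+1 j w])) s'
  (fun zy => f (urn_next t zy.1 zy.2)))//.
- rewrite big_allpairs; apply: eq_bigr => z _.
  rewrite mulr_suml; apply: eq_bigr => y _.
  by rewrite urn_transition /=; ring.
- exact: finite_valued_pair (urn_state_finite t) (urn_draw_finite t).
- by move=> w; apply: allpairs_f; rewrite ?sP// mem_index_enum.
Qed.

End urn.

(** * Central limit theorem for a linear recursion with Bernoulli noise *)

Section linear_recursion_clt.
Context {R : realType} (N p : nat).
Variable Ex : nat -> ('rV[R]_N -> R) -> R.
Variable V : set 'rV[R]_N.
Variable G : nat -> 'rV[R]_N -> {ffun 'I_N -> bool} -> 'rV[R]_N.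
Hypothesis V01 : forall z, V z -> forall i, 0 <= z 0 i <= 1.
Hypothesis ExD : forall t f g, Ex t (fun z => f z + g z) = Ex t f + Ex t g.
Hypothesis ExZ : forall t a f, Ex t (fun z => a * f z) = a * Ex t f.
Hypothesis Ex_le : forall t f g, (forall z, V z -> f z <= g z) -> Ex t f <= Ex t g.
Hypothesis Ex1 : forall t, Ex t (fun=> 1) = 1.
Hypothesis ExS : forall t f, Ex t.+1 f = Ex t (fun z => \sum_y bern (z 0) y * f (G t z y)).
Variable z0 : 'rV[R]_N.
Hypothesis Ex0 : forall f, Ex 0 f = f z0.

Variables (K Q : 'M[R]_p) (kap : 'I_p -> R) (eps : R) (a : R ^nat).
Hypothesis eps0 : 0 < eps.
Hypothesis Q1 : forall x, bform 1%:M x x <= bform Q x x.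
Hypothesis a0 : forall n, 0 <= a n.
Hypothesis aQ : forall n x, bform Q (x *m gain kap ((2^-1)%:M - K) n)
  (x *m gain kap ((2^-1)%:M - K) n) <= a n * bform Q x x.
Hypothesis ac : \forall n \near \oo, n%:R * a n <= n.+1%:R - eps.

Variables (L : 'M[R]_(N, p)) (U : nat -> 'rV[R]_N -> 'rV[R]_p).
Hypothesis U_next : forall k z y, V z ->
  U k.+1 (G k z y) = U k z *m gain kap ((2^-1)%:M - K) k +
    (\row_j ((y j)%:R - z 0 j)) *m L.

Let w (u : 'rV[R]_p) k n := gain_weight K kap u k n.
Let mm u n k z : R := (U k z *m w u k n) 0 0 / Num.sqrt (n%:R : R).
Let al u n k j : R := (L *m w u k.+1 n) j 0 / Num.sqrt (n%:R : R).
Let A u n k : R := \sum_j `|al u n k j|.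
(** Up to a constant, the share of step [k] in the variance at horizon [n]: it dominates the squared
    increment, and is itself dominated by a multiple of [harmonic k]. *)
Let psi k n : R := weight a k.+1 n / n%:R.

Let mm_next u n k z y : (k < n)%N -> V z ->
  mm u n k.+1 (G k z y) = mm u n k z + bern_lin (al u n k) (z 0) y.
Proof.
move=> kn Vz; rewrite /mm U_next// mulmxDl mxE mulrDl; congr (_ + _).
  by rewrite /w [in RHS]gain_weight_ltn// mulmxA.
rewrite -mulmxA mxE mulr_suml; apply: eq_bigr => j _.
by rewrite [X in X * _ * _]mxE -mulrA mulrC.
Qed.

Let psi_ge0 k n : 0 <= psi k n.
Proof. by rewrite divr_ge0// weight_ge0. Qed.

Let A_ge0 u n k : 0 <= A u n k.
Proof. exact: sumr_ge0. Qed.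

Let A_sq_le u : exists2 C : R, 0 <= C & forall k n, (k < n)%N -> A u n k ^+ 2 <= C * psi k n.
Proof.
have [C C0 hC] := gain_weight_bound Q1 u a0 aQ.
pose B : R := \sum_j \sum_i `|L j i|.
have B0 : 0 <= B by apply: sumr_ge0 => j _; exact: sumr_ge0.
exists (B ^+ 2 * C) => [|k n kn]; first by rewrite mulr_ge0// sqr_ge0.
have w0 := weight_ge0 a0 k.+1 n.
pose r : R := Num.sqrt (C * weight a k.+1 n) / Num.sqrt (n%:R : R).
have r0 : 0 <= r by rewrite divr_ge0// sqrtr_ge0.
have AB : A u n k <= B * r.
  rewrite /A /B mulr_suml; apply: ler_sum => j _.
  rewrite /al normrM [X in _ * X]ger0_norm ?invr_ge0 ?sqrtr_ge0// /r mulrA.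
  rewrite ler_wpM2r ?invr_ge0 ?sqrtr_ge0// mxE (le_trans (ler_norm_sum _ _ _))//.
  rewrite mulr_suml; apply: ler_sum => i _; rewrite normrM ler_wpM2l//.
  by rewrite -sqrtr_sqr ler_wsqrtr// hC.
have -> : B ^+ 2 * C * psi k n = (B * r) ^+ 2.
  by rewrite /r /psi !exprMn exprVn !sqr_sqrtr ?mulr_ge0//; ring.
by rewrite ler_sqr ?nnegrE ?mulr_ge0.
Qed.

Let psi_le : exists2 D : R, 0 <= D & forall k n, (k < n)%N -> psi k n <= D * harmonic k.
Proof.
have [D D0 hD] := weight_le a0 eps0 ac; exists D => // k n kn.
rewrite /psi ler_pdivrMr ?ltr0n ?(leq_ltn_trans _ kn)//.
by rewrite mulrAC ler_pdivlMr// mulrC hD.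
Qed.

Let sum_psiE (d : R ^nat) n : \sum_(k < n) psi k n * d k = weighted_mean a d n.
Proof. by rewrite /weighted_mean mulr_suml; apply: eq_bigr => k _; rewrite mulrAC. Qed.

Let start_cvg0 u : (fun n => mm u n 0%N z0) @ \oo --> (0 : R).
Proof.
have [C C0 hC] := gain_weight_bound Q1 u a0 aQ.
(* For a unit mass at step 0 the weighted mean is [psi 0 n]. The full weight from 0 to [n] differs
   from it by the factor [a 0] and the scale [n], so the initial value is forgotten. *)
pose d k : R := (k == 0%N)%:R.
have d0 : d @ \oo --> (0 : R).
  by apply: cvg_near_cst; exists 1%N => // k /=; rewrite /d; case: k.
have dge k : 0 <= d k by rewrite /d.
have wm := weighted_mean_cvg0 a0 eps0 ac dge d0.
pose B : R := \sum_i `|U 0%N z0 0 i|.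
have B0 : 0 <= B by exact: sumr_ge0.
pose b n : R := B ^+ 2 * C * a 0%N * weighted_mean a d n.
have b0 : b @ \oo --> (0 : R).
  by rewrite -[X in _ --> X](mulr0 (B ^+ 2 * C * a 0%N)); exact: cvgMr.
have sb : (fun n => Num.sqrt (b n)) @ \oo --> (0 : R).
  rewrite -[X in _ --> X]sqrtr0; exact: (cvg_comp _ _ b0 (@sqrt_continuous R 0)).
apply/norm_cvg0P; apply: (@squeeze_cvgr _ _ _ _ (cst 0) _ _ _ _ _ sb); last exact: cvg_cst.
exists 1%N => // n /= n0; rewrite normr_ge0 /=.
have w0 : 0 <= weight a 0%N n by exact: weight_ge0.
have wE : weight a 0%N n / n%:R <= a 0%N * weighted_mean a d n.
  rewrite -sum_psiE /psi /weight big_ltn// -mulrA ler_wpM2l//.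
  case: n n0 {w0} => // n _; rewrite big_ord_recl [X in _ + X]big1 => [|k _].
    by rewrite /d /= mulr1 addr0.
  by rewrite /d /= mulr0.
have -> : `|mm u n 0%N z0| = Num.sqrt (mm u n 0%N z0 ^+ 2) by rewrite sqrtr_sqr.
apply: ler_wsqrtr.
have h : `|(U 0%N z0 *m w u 0%N n) 0 0| <= B * Num.sqrt (C * weight a 0%N n).
  rewrite mxE (le_trans (ler_norm_sum _ _ _))// /B mulr_suml; apply: ler_sum => i _.
  rewrite normrM ler_wpM2l//.
  by rewrite -[leLHS]sqrtr_sqr ler_wsqrtr// hC.
apply: (@le_trans _ _ (B ^+ 2 * C * (weight a 0%N n / n%:R))); last first.
  by rewrite /b -[_ * a 0%N * _]mulrA ler_wpM2l// mulr_ge0// sqr_ge0.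
rewrite /mm exprMn exprVn sqr_sqrtr// mulrA ler_wpM2r ?invr_ge0//.
have -> : B ^+ 2 * C * weight a 0%N n = (B * Num.sqrt (C * weight a 0%N n)) ^+ 2.
  by rewrite exprMn sqr_sqrtr ?mulrA// mulr_ge0.
by rewrite -[leLHS]real_normK ?num_real// ler_sqr ?nnegrE// mulr_ge0// sqrtr_ge0.
Qed.

(** The source of tightness: the squared increments sum to a weighted mean of a constant, which
    stays bounded in [n]. *)
Lemma linear_recursion_second_moment (u : 'rV[R]_p) : exists B : R, forall n : nat,
  Ex n (fun z => ((U n z *m u^T) 0 0 / Num.sqrt (n%:R : R)) ^+ 2) <= B.
Proof.
have [C C0 hC] := A_sq_le u.
have h1 : forall k : nat, (0 : R) <= cst 1 k by move=> k; exact: ler01.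
have [B hB] := weighted_mean_bounded a0 eps0 ac h1 (fun=> lexx _).
have [b bP] : exists b : R, forall n, mm u n 0%N z0 ^+ 2 <= b.
  have /cvg_seq_bounded [M [Mr hM]] : cvgn (fun n => mm u n 0%N z0).
    by apply/cvg_ex; exists 0; exact: start_cvg0.
  exists ((`|M| + 1) ^+ 2) => n.
  rewrite -real_normK ?num_real// ler_sqr ?nnegrE ?addr_ge0//.
  by apply: hM => //; rewrite (le_lt_trans (ler_norm M))// ltrDl.
exists (b + C * B) => n.
have := second_moment_bound V01 ExD ExZ Ex_le Ex1 ExS (@mm_next u n) (leqnn n).
rewrite Ex0 {1}/mm /w gain_weight_id => /le_trans; apply.
apply: lerD (bP n) _; apply: (@le_trans _ _ (C * weighted_mean a (cst 1) n)); last first.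
  exact: ler_wpM2l.
rewrite -sum_psiE mulr_sumr; apply: ler_sum => k _.
by rewrite mulr1 hC.
Qed.

Variables (S : 'M[R]_p) (theta : 'rV[R]_N).
Hypothesis Qd : forall x, eps * bform Q x x <= bform Q (x *m K) x.
Hypothesis QT : Q^T = Q.
Hypothesis kap0 : forall i, 0 <= kap i.
Hypothesis theta0 : forall j, 0 <= theta 0 j.
Hypothesis S_lyapunov : K^T *m S + S *m K = L^T *m diag_mx theta *m L.
Let dl k := Ex k (fun z => \sum_j `|z 0 j * (1 - z 0 j) - theta 0 j|).
Hypothesis dl_cvg : dl @ \oo --> (0 : R).

(** The deterministic stand-in for the conditional variance of step [k], with [theta] in place of
    [z_j (1 - z_j)]. *)
Let s u n k : R := ((w u k.+1 n)^T *m (L^T *m diag_mx theta *m L) *m w u k.+1 n) 0 0 / n%:R.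

Let sE u n k : s u n k = \sum_j al u n k j ^+ 2 * theta 0 j.
Proof.
have -> : s u n k = ((L *m w u k.+1 n)^T *m diag_mx theta *m (L *m w u k.+1 n)) 0 0 / n%:R.
  by rewrite /s; move: (w _ _ _) => W; rewrite trmx_mul !mulmxA.
rewrite mul_mx_diag mxE mulr_suml; apply: eq_bigr => j _.
rewrite /al exprMn exprVn sqr_sqrtr//; move: (L *m _) => W.
by rewrite !mxE; ring.
Qed.

Let s_ge0 u n k : 0 <= s u n k.
Proof. by rewrite sE sumr_ge0// => j _; rewrite mulr_ge0// sqr_ge0. Qed.

Let al_sq_le u n k j : al u n k j ^+ 2 <= A u n k ^+ 2.
Proof.
rewrite -real_normK ?num_real// ler_sqr ?nnegrE// /A (bigD1 j)//= lerDl.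
exact: sumr_ge0.
Qed.

Let Th : R := \sum_j theta 0 j.

Let s_le u n k : s u n k <= A u n k ^+ 2 * Th.
Proof. by rewrite sE /Th mulr_sumr; apply: ler_sum => j _; rewrite ler_wpM2r. Qed.

Let dl_ge0 k : 0 <= dl k.
Proof.
have E0 : Ex k (fun=> 0) = 0.
  rewrite -[X in _ = X](mul0r (Ex k (fun=> 1))) -ExZ; congr (Ex k _).
  by apply/funext => z; rewrite mul0r.
by rewrite -E0; apply: Ex_le => z _; exact: sumr_ge0.
Qed.

(** Each Lindeberg error is at most [psi k n] times a null sequence [d k], so the total is a
    weighted mean tending to 0. The exponent converges by the covariance telescoping. *)
Lemma linear_recursion_cos_cvg (u : 'rV[R]_p) (phi : R) :
  (fun n : nat => Ex n (fun z => cos ((U n z *m u^T) 0 0 / Num.sqrt (n%:R : R) + phi))) @ \oo -->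
  expR (- (bform S u u / 2)) * cos phi.
Proof.
have [C C0 hC] := A_sq_le u; have [D D0 hD] := psi_le.
have Th0 : 0 <= Th by exact: sumr_ge0.
(* The three terms match those of the Lindeberg bound: variance replacement through [dl], the
   squared surrogate variance through [A^4], and the cube [A^3]; in the last two one factor [A^2]
   pays for [psi]. *)
pose d k : R := C * (2^-1 * dl k + Th ^+ 2 * (C * (D * harmonic k)) +
  Num.sqrt (C * (D * harmonic k))).
have h0 k : 0 <= C * (D * harmonic k) by rewrite !mulr_ge0// harmonic_ge0.
have d_ge0 k : 0 <= d k.
  rewrite mulr_ge0// !addr_ge0 ?sqrtr_ge0//; first by rewrite mulr_ge0.
  by rewrite mulr_ge0// sqr_ge0.
have hc : (fun k => C * (D * harmonic k)) @ \oo --> (0 : R).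
  rewrite -[X in _ --> X](mulr0 C); apply: cvgMr.
  by rewrite -[X in _ --> X](mulr0 D); apply: cvgMr; exact: cvg_harmonic.
have d_cvg : d @ \oo --> (0 : R).
  rewrite -[X in _ --> X](mulr0 C); apply: cvgMr.
  rewrite -[X in _ --> X](addr0 0); apply: cvgD.
    rewrite -[X in _ --> X](addr0 0); apply: cvgD.
      by rewrite -[X in _ --> X](mulr0 2^-1); exact: cvgMr.
    by rewrite -[X in _ --> X](mulr0 (Th ^+ 2)); exact: cvgMr.
  rewrite -[X in _ --> X]sqrtr0; exact: (cvg_comp _ _ hc (@sqrt_continuous R 0)).
have wm := weighted_mean_cvg0 a0 eps0 ac d_ge0 d_cvg.
pose F n := expR (- \sum_(k < n) s u n k / 2) * cos (mm u n 0%N z0 + phi).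
have err n : `|Ex n (fun z => cos ((U n z *m u^T) 0 0 / Num.sqrt (n%:R : R) + phi)) - F n|
    <= weighted_mean a d n.
  have := lindeberg_cos V01 ExD ExZ Ex_le Ex1 ExS (@mm_next u n) phi (s_ge0 u n) (leqnn n).
  rewrite Ex0 {1}/mm /w gain_weight_id => /le_trans; apply.
  rewrite -sum_psiE; apply: ler_sum => -[k /= kn] _.
  rewrite -/(A u n k); have Ak := hC k n kn; have pk := hD k n kn.
  have A2 : A u n k ^+ 2 <= C * (D * harmonic k).
    by rewrite (le_trans Ak)// ler_wpM2l.
  have A1 : A u n k <= Num.sqrt (C * (D * harmonic k)).
    by rewrite -[leLHS]ger0_norm// -sqrtr_sqr ler_wsqrtr.
  have Cpsi : 0 <= C * psi k n by rewrite mulr_ge0.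
  have -> : psi k n * d k = 2^-1 * (C * psi k n * dl k) +
    C * psi k n * (Th ^+ 2 * (C * (D * harmonic k))) +
    C * psi k n * Num.sqrt (C * (D * harmonic k)) by rewrite /d; ring.
  apply: lerD; first apply: lerD.
  - rewrite ler_wpM2l ?invr_ge0// -ExZ; apply: Ex_le => z Vz.
    rewrite sE -sumrB mulr_sumr (le_trans (ler_norm_sum _ _ _))//.
    apply: ler_sum => j _; rewrite -mulrBr normrM ler_wpM2r//.
    by rewrite ger0_norm ?sqr_ge0// (le_trans (al_sq_le u n k j)).
  - apply: (@le_trans _ _ (s u n k ^+ 2)).
      rewrite exprMn ler_piMr ?sqr_ge0//; lra.
    apply: (@le_trans _ _ ((A u n k ^+ 2 * Th) ^+ 2)).
      by rewrite ler_sqr ?nnegrE// ?mulr_ge0// ?sqr_ge0// s_le.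
    rewrite exprMn mulrC [leRHS]mulrCA ler_wpM2l ?sqr_ge0//.
    by rewrite [leLHS]expr2 ler_pM ?sqr_ge0.
  - by rewrite exprSr ler_pM ?sqr_ge0.
have F_cvg : F @ \oo --> expR (- (bform S u u / 2)) * cos phi.
  apply: cvgM.
    apply: (continuous_cvg _ (@continuous_expR R _)); apply: cvgN.
    have := gain_covariance_cvg eps0 Q1 Qd QT kap0 (u := u) S_lyapunov.
    move=> h; apply: cvg_trans (cvgM h (cvg_cst (2^-1 : R))); apply: near_eq_cvg; apply: nearW => n.
    by rewrite /s /= -mulr_suml -mulr_suml.
  apply: (continuous_cvg _ (@continuous_cos R _)).
  rewrite -[X in _ --> X](add0r phi); apply: cvgD; first exact: start_cvg0.
  exact: cvg_cst.
have E0 : (fun n => Ex n (fun z => cos ((U n z *m u^T) 0 0 / Num.sqrt (n%:R : R) + phi)) - F n)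
    @ \oo --> (0 : R).
  apply/norm_cvg0P; apply: (@squeeze_cvgr _ _ _ _ (cst 0) _ _ _ _ _ wm); last exact: cvg_cst.
  by apply: nearW => n; rewrite normr_ge0 /=.
rewrite -[X in _ --> X]add0r.
have -> : (fun n : nat => Ex n (fun z => cos ((U n z *m u^T) 0 0 / Num.sqrt (n%:R : R) + phi))) =
  (fun n : nat => Ex n (fun z => cos ((U n z *m u^T) 0 0 / Num.sqrt (n%:R : R) + phi)) - F n + F n).
  by apply/funext => n; rewrite subrK.
exact: cvgD.
Qed.

End linear_recursion_clt.

(** * The urn dynamics as a linear recursion *)

Section urn_drift.
Context {R : realType} (p q : nat) (e : rel 'I_(p + q)) (m alpha beta : nat).
Context (W0 B0 : 'I_(p + q) -> nat).
Hypothesis m_gt0 : (0 < m)%N.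
Hypothesis T0_ge1 : forall i, (1 <= W0 i + B0 i)%N.
Hypothesis indegF : forall i : 'I_p, (0 < indeg e (lshift q i))%N.

Let At := scaled_adj R e.
Let a : R := alpha%:R / m%:R.
Let b : R := beta%:R / m%:R.
Let c : R := a + b - 1.

Definition urn_offset (i : 'I_p) : R :=
  (W0 (lshift q i) + B0 (lshift q i))%:R / (m * indeg e (lshift q i))%:R.

Definition urn_deviation (zstar : 'rV[R]_p) (t : nat) (z : 'rV[R]_(p + q)) : 'rV[R]_p :=
  \row_i ((t%:R + urn_offset i) * (lsubmx z 0 i - zstar 0 i)).

Lemma urn_offset_gt0 i : 0 < urn_offset i.
Proof. by rewrite divr_gt0// ltr0n ?T0_ge1// muln_gt0 m_gt0 indegF. Qed.

Lemma urn_total_offset t i :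
  (urn_total e m W0 B0 t (lshift q i))%:R =
  (m * indeg e (lshift q i))%:R * (t%:R + urn_offset i) :> R.
Proof.
have D0 : (m * indeg e (lshift q i))%:R != 0 :> R.
  by rewrite pnatr_eq0 -lt0n muln_gt0 m_gt0 indegF.
rewrite /urn_total natrD natrM /urn_offset mulrDr [_ * (_ / _)]mulrC divfK//.
by rewrite addrC [t%:R * _]mulrC.
Qed.

Lemma scaled_adj_col_sum i : \sum_j At j (lshift q i) = 1.
Proof.
under eq_bigr do rewrite mxE.
rewrite -big_mkcond /= sumr_const -[RHS](@mulVf _ (indeg e (lshift q i))%:R).
  by rewrite mulr_natr.
by rewrite pnatr_eq0 -lt0n indegF.
Qed.

Lemma mulmx_lsubmx (z : 'rV[R]_(p + q)) (A : 'M[R]_(p + q)) :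
  z *m lsubmx A = lsubmx z *m ulsubmx A + rsubmx z *m dlsubmx A.
Proof.
apply/rowP => i; rewrite !mxE big_split_ord /=; congr (_ + _);
  by apply: eq_bigr => j _; rewrite !mxE.
Qed.

Lemma ulsubmx_congr (A D : 'M[R]_(p + q)) :
  ulsubmx (A^T *m D *m A) = (lsubmx A)^T *m D *m lsubmx A.
Proof.
apply/matrixP => i j; rewrite !mxE; apply: eq_bigr => k _; rewrite !mxE; congr (_ * _).
by apply: eq_bigr => l _; rewrite !mxE.
Qed.

Lemma urn_next_offset t z y i :
  (t.+1%:R + urn_offset i) * urn_next e m alpha beta W0 B0 t z y 0 (lshift q i) =
  (t%:R + urn_offset i) * z 0 (lshift q i) + (1 - b) +
  c * \sum_j (y j)%:R * At j (lshift q i).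
Proof.
have m0 : m%:R != 0 :> R by rewrite pnatr_eq0 -lt0n.
have D0 : (indeg e (lshift q i))%:R != 0 :> R by rewrite pnatr_eq0 -lt0n indegF.
have k0 s : s%:R + urn_offset i != 0 by rewrite gt_eqF// ltr_wpDl// urn_offset_gt0.
rewrite mxE !urn_total_offset natrM.
have -> : 1 - b = (1 - b) * \sum_j At j (lshift q i) by rewrite scaled_adj_col_sum mulr1.
have -> : \sum_(j | e j (lshift q i)) (alpha%:R * (y j)%:R + (m%:R - beta%:R) * (1 - (y j)%:R)) =
    (m%:R * (indeg e (lshift q i))%:R) * ((1 - b) * (\sum_j At j (lshift q i)) +
       c * \sum_j (y j)%:R * At j (lshift q i)) :> R.
  rewrite !mulr_sumr -big_split /= mulr_sumr big_mkcond /=; apply: eq_bigr => j _.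
  rewrite mxE; case: ifP => _; last by rewrite !mulr0 addr0 mulr0.
  by rewrite /c /a /b; field; rewrite ?m0 ?D0.
move: (k0 t.+1); move: (t.+1%:R + urn_offset i) => x x0.
by field; rewrite ?m0 ?D0 ?x0.
Qed.

(** The fixed point equation for [zstar] cancels the affine part of the drift, namely [(1 - b)] and
    the contribution of the source urns, whose proportions keep their initial values. *)
Lemma urn_deviation_next (zstar : 'rV[R]_p) (Z0 : 'rV[R]_(p + q)) t z y :
  zstar *m urn_H e c = (1 - b) *: const_mx 1 + c *: (rsubmx Z0 *m dlsubmx At) ->
  rsubmx z = rsubmx Z0 ->
  urn_deviation zstar t.+1 (urn_next e m alpha beta W0 B0 t z y) =
  urn_deviation zstar t z *m gain urn_offset (c *: ulsubmx At) t +
    (\row_j ((y j)%:R - z 0 j)) *m (c *: lsubmx At).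
Proof.
move=> zH zS.
pose y' : 'rV[R]_(p + q) := \row_j (y j)%:R.
have -> : \row_j ((y j)%:R - z 0 j) = y' - z by apply/rowP => j; rewrite !mxE.
have -> : urn_deviation zstar t z *m gain urn_offset (c *: ulsubmx At) t =
    urn_deviation zstar t z + (lsubmx z - zstar) *m (c *: ulsubmx At).
  rewrite /gain mulmxDr mulmx1 mulmxA; congr (_ + _ *m _).
  rewrite mul_mx_diag; apply/rowP => i; rewrite !mxE mulrC mulKf//.
  by rewrite gt_eqF// ltr_wpDl// urn_offset_gt0.
have yE i : (y' *m lsubmx At) 0 i = \sum_j (y j)%:R * At j (lshift q i).
  by rewrite !mxE; apply: eq_bigr => j _; rewrite !mxE.
have -> : (lsubmx z - zstar) *m (c *: ulsubmx At) =
    c *: (lsubmx z *m ulsubmx At) - c *: (zstar *m ulsubmx At).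
  by rewrite mulmxBl -!scalemxAr.
have -> : (y' - z) *m (c *: lsubmx At) = c *: (y' *m lsubmx At) -
    c *: (lsubmx z *m ulsubmx At + rsubmx Z0 *m dlsubmx At).
  by rewrite -zS -mulmx_lsubmx mulmxBl -!scalemxAr.
move: zH; rewrite /urn_H mulmxBr mulmx1 -scalemxAr -/At => /rowP zH.
apply/rowP => i; move: (zH i) (yE i) (urn_next_offset t z y i).
move: (zstar *m _) (rsubmx Z0 *m _) (lsubmx z *m _) (y' *m _) => P2 P3 P1 YL.
move: (urn_next _ _ _ _ _ _ _ _ _) => z'; rewrite /urn_deviation !mxE => h1 h2 h3.
by rewrite mulrBr h3 -h2; move: h1; lra.
Qed.

(** The two normalisations differ by [urn_offset] times a deviation bounded by 1, over [sqrt n]. *)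
Lemma urn_deviation_scaled (zstar u : 'rV[R]_p) (n : nat) (z : 'rV[R]_(p + q)) : (0 < n)%N ->
  (forall i, 0 <= zstar 0 i <= 1) -> (forall i, 0 <= z 0 i <= 1) ->
  `|((Num.sqrt (n%:R : R) *: (lsubmx z - zstar)) *m u^T) 0 0 -
    (urn_deviation zstar n z *m u^T) 0 0 / Num.sqrt (n%:R : R)| <=
  (\sum_i urn_offset i * `|u 0 i|) / Num.sqrt (n%:R : R).
Proof.
move=> n0 zs01 z01; have sn0 : 0 < Num.sqrt (n%:R : R) by rewrite sqrtr_gt0 ltr0n.
have snE : Num.sqrt (n%:R : R) ^+ 2 = n%:R by rewrite sqr_sqrtr.
rewrite !mxE mulr_suml -sumrB (le_trans (ler_norm_sum _ _ _))// mulr_suml.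
apply: ler_sum => i _; rewrite !mxE.
have -> : Num.sqrt (n%:R : R) * (z 0 (lshift q i) - zstar 0 i) * u 0 i -
  (n%:R + urn_offset i) * (z 0 (lshift q i) - zstar 0 i) * u 0 i / Num.sqrt (n%:R : R) =
  - (urn_offset i * u 0 i * (z 0 (lshift q i) - zstar 0 i) / Num.sqrt (n%:R : R)).
  move: (Num.sqrt _) sn0 snE => s s0 <-; field; exact: lt0r_neq0.
move: (urn_offset i) (ltW (urn_offset_gt0 i)) => k k0.
rewrite normrN !normrM (ger0_norm k0) normfV (gtr0_norm sn0).
rewrite ler_pM2r ?invr_gt0// ler_piMr ?mulr_ge0//.
rewrite ler_norml; have /andP[] := z01 (lshift q i); have /andP[] := zs01 i.
by move=> *; apply/andP; split; lra.
Qed.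

End urn_drift.

(** * Auxiliary estimates and the invertibility of [H] *)

Section urn_auxiliary.
Context {R : realType}.

Lemma cos_lipschitz (x y : R) : `|cos x - cos y| <= `|x - y|.
Proof.
wlog xy : x y / x <= y.
  move=> h; have [|/ltW] := leP x y; first exact: h.
  by move=> yx; rewrite -normrN opprB -[`|x - y|]normrN opprB; exact: h.
have [|t _] := @MVT_segment R cos (fun t => - sin t) x y xy.
  by apply: continuous_subspaceT => t; exact: continuous_cos.
by move=> h; rewrite distrC h normrM [`|y - x|]distrC ler_piMl// normrN sin_max.
Qed.

Lemma norm_rV_le p (x : 'rV[R]_p) (L : R) : 0 <= L -> (forall i, `|x 0 i| <= L) -> `|x| <= L.
Proof.
move=> L0 xL; rewrite [leLHS]/Num.norm /= mx_normrE.
by apply/bigmax_leP; split=> // -[i j] _; rewrite ord1.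
Qed.

(** On a kernel row [x] of [H] the inequality reads [eps Q(x,x) <= - r Q(x,x)], which forces
    [x = 0]. Invertibility is what gives the total function [invmx] its meaning in the definition of
    [zstar]. *)
Lemma gram_unit p (H Q : 'M[R]_p) (eps r : R) : 0 < eps -> 0 <= r ->
  (forall x, bform 1%:M x x <= bform Q x x) ->
  (forall x, eps * bform Q x x <= bform Q (x *m (H - r%:M)) x) -> H \in unitmx.
Proof.
move=> eps0 r0 Q1 Qd; rewrite -row_free_unit -kermx_eq0; apply/eqP/row_matrixP => i.
have : row i (kermx H) *m H = 0 by rewrite -row_mul mulmx_ker row0.
move: (row i _) => x xH.
have x1 : 0 <= bform 1%:M x x.
  rewrite /bform mulmx1 mxE sumr_ge0// => j _; by rewrite mxE -expr2 sqr_ge0.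
have {}x1 : bform 1%:M x x <= 0.
  rewrite (le_trans (Q1 x))//.
  have := Qd x; rewrite mulmxBr xH sub0r mul_mx_scalar -scaleNr bformZl => h.
  have Q0 : 0 <= bform Q x x := le_trans x1 (Q1 x).
  have : eps * bform Q x x <= 0 by rewrite (le_trans h)// mulNr oppr_le0 mulr_ge0.
  by rewrite pmulr_rle0.
move: x1; rewrite /bform mulmx1 mxE.
have sq0 j : 0 <= x 0 j * x^T j 0 by rewrite mxE -expr2 sqr_ge0.
move=> x1; have /eqP : \sum_j x 0 j * x^T j 0 = 0 by apply/le_anti; rewrite x1 sumr_ge0.
rewrite psumr_eq0// => /allP x0; rewrite row0; apply/rowP => j; rewrite [RHS]mxE.
have := x0 j (mem_index_enum j); rewrite /= mxE mulf_eq0 => /orP[] /eqP //.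
Qed.

End urn_auxiliary.

Section expectation_finite_valued.
Context {R : realType} d (S : measurableType d) (P : probability S R).

Lemma finite_valued_integrable (T : choiceType) (X : S -> T) (f : T -> R) :
  finite_valued X -> P.-integrable setT (EFin \o (fun w => f (X w))).
Proof.
move=> fX; have [[s Xs] _] := fX.
apply: (@bounded_integrable _ _ _ P _ (\sum_(x <- s) `|f x|)) => [|w].
  exact: (finite_valued_measurable f fX).
by rewrite (big_rem (X w))//= lerDl sumr_ge0.
Qed.

Lemma finite_valued_prob (T : choiceType) (X : S -> T) (A : pred T) : finite_valued X ->
  P [set w | A (X w)] = (\int[P]_w (A (X w))%:R)%:E.
Proof.
move=> fX; have mA : measurable [set w | A (X w)] := finite_valued_preimage [set x | A x] fX.
rewrite /Rintegral -[LHS]fineK ?fin_num_measure//; congr (fine _)%:E.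
transitivity (\int[P]_w (\1_[set w | A (X w)] w)%:E)%E; first by rewrite integral_indic// setIT.
apply: eq_integral => w _.
by rewrite indicE; case: (boolP (A (X w))) => h; [rewrite mem_set|rewrite memNset//; exact/negP].
Qed.

Lemma ae_exists (Q : S -> Prop) : {ae P, forall w, Q w} -> exists w, Q w.
Proof.
move=> [N [mN N0 QN]]; apply: contrapT => /forallNP nQ.
have : (P N = 1)%E.
  by rewrite -(probability_setT P); congr (P _); apply/seteqP; split => // w _; apply: QN; exact: nQ.
by rewrite N0 => /eqP; rewrite eq_sym onee_eq0.
Qed.

End expectation_finite_valued.

(** * The central limit theorem for the urn process *)

Theorem theorem4p3 (R : realType) (p q : nat) (e : rel 'I_(p + q))
  (no_isolated : forall i, ~ (indeg e i = 0%N /\ outdeg e i = 0%N))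
  (F_first : forall i : 'I_(p + q), (0 < indeg e i)%N = (i < p)%N)
  (m alpha beta : nat) (m_gt0 : (0 < m)%N)
  (alpha_le : (alpha <= m)%N) (beta_le : (beta <= m)%N)
  (W0 B0 : 'I_(p + q) -> nat) (T0_ge1 : forall i, (1 <= W0 i + B0 i)%N)
  (d : measure_display) (Omega : measurableType d) (P : probability Omega R)
  (W B : nat -> 'I_(p + q) -> Omega -> nat)
  (Y : nat -> 'I_(p + q) -> Omega -> bool)
  (urnP : urn_process e m alpha beta W0 B0 P W B Y) :
  let a : R := alpha%:R / m%:R in
  let b : R := beta%:R / m%:R in
  let Z0 : 'rV[R]_(p + q) := \row_i white_proportion R (W0 i) (B0 i) in
  let ZF t w : 'rV[R]_p := lsubmx (urn_state R W B t w) in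
  let zstar := urn_limit e a b Z0 in
  let H := urn_H e (a + b - 1) in
  let rho := lambda_min H in
  let Sigma := urn_Sigma e (a + b - 1) zstar Z0 in
  {ae P, forall w, (fun t => ZF t w) @ \oo --> zstar} ->
  2^-1 < rho ->
  cvg_in_law_normal P
    (fun t w => Num.sqrt (t%:R : R) *: (ZF t w - zstar)) 0 Sigma.
Proof.
move=> a b Z0 ZF zstar H rho Sigma ZF_cvg rho_gt.
pose c : R := a + b - 1; pose At := scaled_adj R e.
have indegF (i : 'I_p) : (0 < indeg e (lshift q i))%N by rewrite F_first /=.
have indegS (i : 'I_q) : indeg e (rshift p i) = 0%N.
  by apply/eqP; rewrite -leqn0 leqNgt F_first /= -leqNgt leq_addr.
pose Z t w := urn_state R W B t w.
have Zfin t : finite_valued (Z t) := urn_state_finite alpha_le beta_le T0_ge1 urnP t.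
have Z01 t w i : 0 <= Z t w 0 i <= 1 := urn_state01 alpha_le beta_le T0_ge1 urnP t w i.
have ZS t w : rsubmx (Z t w) = rsubmx Z0.
  by apply/rowP => i; rewrite [LHS]mxE [RHS]mxE [RHS]mxE; exact: (urn_state_source urnP).
have ZZ0 w : Z 0%N w = Z0.
  by apply/rowP => i; rewrite !mxE (urn_W0 urnP) (urn_B0 urnP).
have [Q [eps eps0 [QT Q1 Qd]]] := lyapunov_form_shift rho_gt.
pose K := H - (2^-1)%:M.
have MK : (2^-1)%:M - K = c *: ulsubmx At.
  rewrite /K opprB addrA -raddfD /= (_ : 2^-1 + 2^-1 = 1 :> R); last by lra.
  by rewrite /H /urn_H opprB addrC subrK.
have Hunit : H \in unitmx by apply: (gram_unit eps0 _ Q1 Qd); rewrite invr_ge0.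
have zstarH : zstar *m urn_H e c = (1 - b) *: const_mx 1 + c *: (rsubmx Z0 *m dlsubmx At).
  by rewrite /zstar /urn_limit -/c mulmxKV.
(* A property of full measure holds for at least one sample path, and the limit of a path in the
   unit cube stays there. *)
have zstar01 i : 0 <= zstar 0 i <= 1.
  have [w hw] := ae_exists ZF_cvg.
  have hi := @cvg_coord _ _ _ _ _ _ _ 0 i hw.
  apply/andP; split; [apply: (cvgr_to_ge hi)|apply: (cvgr_to_le hi)];
    by apply: nearW => t; rewrite mxE; have /andP[] := Z01 t w (lshift q i).
pose zz := row_mx zstar (rsubmx Z0).
have zz01 j : 0 <= zz 0 j <= 1.
  have [i ->|i ->] := split_ordP j; first by rewrite /zz row_mxEl.
  rewrite /zz row_mxEr -(ZS 0%N point) mxE; exact: Z01.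
(* [theta] is [Theta] without the factor [c^2], which goes into the two copies of [L]. *)
pose theta : 'rV[R]_(p + q) := \row_j (zz 0 j * (1 - zz 0 j)).
have theta0 j : 0 <= theta 0 j.
  by rewrite mxE mulr_ge0//; have /andP[] := zz01 j; rewrite ?subr_ge0.
pose L := c *: lsubmx At.
pose Gam := ulsubmx (At^T *m urn_Theta c zstar Z0 *m At).
have GamE : Gam = L^T *m diag_mx theta *m L.
  have TE : urn_Theta c zstar Z0 = c ^+ 2 *: diag_mx theta.
    rewrite /urn_Theta -linearZ; congr diag_mx; apply/rowP => j.
    by rewrite [LHS]mxE [RHS]mxE [theta 0 j]mxE -mulrA.
  rewrite /Gam ulsubmx_congr TE /L; move: (lsubmx At) (diag_mx theta) => A D.
  by rewrite [(c *: A)^T]linearZ /= -!scalemxAr -!scalemxAl scalerA -expr2.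
have GamT : Gam^T = Gam by rewrite GamE !trmx_mul trmxK tr_diag_mx mulmxA.
have Gam0 x : 0 <= bform Gam x x.
  have -> : bform Gam x x = \sum_j (x *m L^T) 0 j ^+ 2 * theta 0 j.
    have -> : bform Gam x x = ((x *m L^T) *m diag_mx theta *m (x *m L^T)^T) 0 0.
      by rewrite /bform GamE trmx_mul trmxK !mulmxA.
    move: (x *m L^T) => v; rewrite mul_mx_diag mxE; apply: eq_bigr => j _.
    by rewrite !mxE; ring.
  by apply: sumr_ge0 => j _; rewrite mulr_ge0// sqr_ge0.
have [SE ST S0] := lyapunov_integral eps0 Q1 Qd QT GamT Gam0.
rewrite -[X in K^T *m X + X *m K = _]/Sigma in SE.
rewrite -[X in X^T]/Sigma in ST.
have {}S0 x : 0 <= bform Sigma x x := S0 x.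
have [nu nuN nuC] := multivariate_normal_exists ST S0.
exists nu => //.
pose kap := @urn_offset R p q e m W0 B0.
have kap_gt0 i : 0 < kap i := urn_offset_gt0 m_gt0 T0_ge1 indegF i.
have kap0 i : 0 <= kap i := ltW (kap_gt0 i).
have [ga ga0 [gaQ gac]] := gain_contraction eps0 Q1 Qd QT kap0.
pose Ex t (f : 'rV[R]_(p + q) -> R) := \int[P]_w f (Z t w).
pose V := [set z : 'rV[R]_(p + q) | (forall i, 0 <= z 0 i <= 1) /\ rsubmx z = rsubmx Z0].
have VZ t w : V (Z t w) by split.
have V01 z : V z -> forall i, 0 <= z 0 i <= 1 by case.
have intZ t f := finite_valued_integrable P f (Zfin t).
have ExD t f g : Ex t (fun z => f z + g z) = Ex t f + Ex t g.
  by rewrite /Ex RintegralD.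
have ExZ t r f : Ex t (fun z => r * f z) = r * Ex t f by rewrite /Ex RintegralZl.
have Ex_le t f g : (forall z, V z -> f z <= g z) -> Ex t f <= Ex t g.
  by move=> fg; apply: le_Rintegral => // w _; exact: fg.
have Ex1 t : Ex t (fun=> 1) = 1 by exact: prob_Rintegral_cst.
have ExS t f := urn_expectation_next alpha_le beta_le T0_ge1 urnP t f.
have Ex0 f : Ex 0%N f = f Z0.
  by rewrite /Ex; under eq_Rintegral do rewrite ZZ0; exact: prob_Rintegral_cst.
pose U := @urn_deviation R p q e m W0 B0 zstar.
have U_next k z y : V z -> U k.+1 (urn_next e m alpha beta W0 B0 k z y) =
    U k z *m gain kap ((2^-1)%:M - K) k + (\row_j ((y j)%:R - z 0 j)) *m L.
  by move=> [_ zS]; rewrite MK; exact: (urn_deviation_next m_gt0 T0_ge1 indegF _ _ zstarH zS).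
(* Bounded convergence turns the almost sure limit into convergence in mean of the conditional
   variances; coordinates of source urns are constant. *)
have dl_cvg : (fun k => Ex k (fun z => \sum_j `|z 0 j * (1 - z 0 j) - theta 0 j|)) @ \oo --> (0 : R).
  rewrite -[X in _ --> X](prob_Rintegral_cst P 0).
  apply: (@bounded_dominated_cvg _ _ _ P _ _ (\sum_(j < p + q) 1)) => //.
  - by move=> n; exact: (finite_valued_measurable
      (fun z : 'rV[R]_(p + q) => \sum_j `|z 0 j * (1 - z 0 j) - theta 0 j|) (Zfin n)).
  - move=> n w; rewrite ger0_norm ?sumr_ge0//; apply: ler_sum => j _.
    rewrite [theta 0 j]mxE ler_norml; have /andP[] := Z01 n w j; have /andP[] := zz01 j.
    move: (Z n w 0 j) (zz 0 j) => x y y0 y1 x0 x1.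
    have x2 : 0 <= x * (1 - x) by rewrite mulr_ge0// subr_ge0.
    have y2 : 0 <= y * (1 - y) by rewrite mulr_ge0// subr_ge0.
    have x3 : x * (1 - x) <= 1 by rewrite mulr_ile1 ?subr_ge0// gerBl.
    have y3 : y * (1 - y) <= 1 by rewrite mulr_ile1 ?subr_ge0// gerBl.
    by apply/andP; split; lra.
  - apply: filterS ZF_cvg => w hw; rewrite -[X in _ --> X](_ : \sum_(j < p + q) (0 : R) = _); last by rewrite big1.
    apply: cvg_sumr => j _; apply/norm_cvg0P.
    have cj : (fun n => Z n w 0 j) @ \oo --> zz 0 j.
      have [i ->|i ->] := split_ordP j; rewrite /zz ?row_mxEl ?row_mxEr.
        have hi := @cvg_coord _ _ _ _ _ _ _ 0 i hw.
        have -> : (fun n => Z n w 0 (lshift q i)) = (fun n => ZF n w 0 i).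
          by apply/funext => n; rewrite [RHS]mxE.
        exact: hi.
      rewrite -(ZS 0%N w); apply: cvg_near_cst; apply: nearW => n.
      by rewrite (ZS 0%N w) -(ZS n w) [RHS]mxE.
    rewrite -(subrr (theta 0 j)); apply: cvgB; last exact: cvg_cst.
    by rewrite [theta 0 j]mxE; apply: cvgM => //; apply: cvgB => //; exact: cvg_cst.
pose X n w : 'rV[R]_p := Num.sqrt (n%:R : R) *: (ZF n w - zstar).
pose Cu (u : 'rV[R]_p) : R := \sum_i kap i * `|u 0 i|.
have Cu0 u : 0 <= Cu u by apply: sumr_ge0 => i _; rewrite mulr_ge0.
pose x_ n (z : 'rV[R]_(p + q)) : 'rV[R]_p := Num.sqrt (n%:R : R) *: (lsubmx z - zstar).
have Xdev u n z : (0 < n)%N -> V z ->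
    `|(x_ n z *m u^T) 0 0 - (U n z *m u^T) 0 0 / Num.sqrt (n%:R : R)| <=
    Cu u / Num.sqrt (n%:R : R).
  by move=> n0 [Vz _]; exact: urn_deviation_scaled.
have mX n : measurable_fun setT (X n : Omega -> borel_rV R p).
  exact: (@finite_valued_measurable _ _ _ _ (borel_rV R p) _ (x_ n) (Zfin n)).
apply: (@cvg_in_law_trig _ _ _ _ P (X : nat -> Omega -> borel_rV R p)) => //.
- move=> r r0.
  (* Coordinate [i] is the linear form of [delta_i]; [x^2 <= 2 y^2 + 2 (x - y)^2] passes from the
     rescaled recursion [y] to the true deviation [x]. *)
  have moments i : exists b' : R, forall n, (0 < n)%N -> Ex n (fun z => x_ n z 0 i ^+ 2) <= b'.
    pose u : 'rV[R]_p := delta_mx 0 i.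
    have [b' hb'] := linear_recursion_second_moment V01 ExD ExZ Ex_le Ex1 ExS Ex0 eps0 Q1 ga0
      gaQ gac U_next u.
    exists (2 * b' + 2 * Cu u ^+ 2) => n n0.
    apply: (@le_trans _ _ (Ex n (fun z => 2 * ((U n z *m u^T) 0 0 / Num.sqrt (n%:R : R)) ^+ 2 +
      2 * Cu u ^+ 2 * 1))).
      apply: Ex_le => z Vz; rewrite mulr1.
      have xE : x_ n z 0 i = (x_ n z *m u^T) 0 0.
        by rewrite /u trmx_delta -colE [RHS]mxE.
      have := Xdev u n z n0 Vz; rewrite -xE.
      have : Cu u / Num.sqrt (n%:R : R) <= Cu u.
        rewrite ler_piMr// invf_le1 ?sqrtr_gt0 ?ltr0n//.
        by rewrite -[leLHS]sqrtr1 ler_wsqrtr// ler1n.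
      move: (Cu u) (x_ n z 0 i) ((U n z *m u^T) 0 0 / _) (Cu u / _) (Cu0 u) => C' x y s C'0 sC.
      move=> /le_trans/(_ sC); rewrite ler_norml => /andP[h1 h2].
      have : (x - y) ^+ 2 <= C' ^+ 2.
        by rewrite -real_normK ?num_real// ler_sqr ?nnegrE// ler_norml h1 h2.
      have := sqr_ge0 (x - 2 * y); nra.
    by rewrite ExD !ExZ Ex1 mulr1 lerD2r ler_wpM2l.
  have [b' hb'] := choice moments.
  pose T : R := \sum_i b' i.
  have T0 : 0 <= T.
    apply: sumr_ge0 => i _; rewrite (le_trans _ (hb' i 1%N isT))//.
    by apply: Rintegral_ge0 => w _; exact: sqr_ge0.
  (* Markov's inequality leaves [T / l^2], and [T <= r l <= r l^2] because [l >= 1]. *)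
  pose l : R := 1 + T / r.
  have Tr0 : 0 <= T / r by rewrite divr_ge0// ltW.
  have l1 : 1 <= l by rewrite /l lerDl.
  have l0 : 0 < l by exact: lt_le_trans ltr01 l1.
  exists l => //; exists 1%N => // n /= n0.
  have := finite_valued_prob P (fun z => l < `|x_ n z|) (Zfin n).
  rewrite -[X in P X]/[set w | (l < `|X n w|)%R] => ->; rewrite lee_fin.
  have markov : Ex n (fun z => (l < `|x_ n z|)%R%:R) <=
      Ex n (fun z => (l ^+ 2)^-1 * \sum_i x_ n z 0 i ^+ 2).
    apply: Ex_le => z _; case: ltP => h; last first.
      by rewrite mulr_ge0 ?invr_ge0 ?sqr_ge0// sumr_ge0// => i _; exact: sqr_ge0.
    rewrite mulrC ler_pdivlMr ?exprn_gt0// mul1r.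
    have /existsNP[i /negP hi] : ~ (forall i, `|x_ n z 0 i| <= l).
      by move=> hl; have := norm_rV_le (ltW l0) hl; rewrite leNgt h.
    rewrite (bigD1 i)//= ler_wpDr ?sumr_ge0// => [j _|]; first exact: sqr_ge0.
    rewrite -[leRHS]real_normK ?num_real// ler_sqr ?nnegrE ?(ltW l0)//.
    by rewrite ltW// ltNge.
  refine (le_trans markov _); rewrite ExZ.
  have -> : Ex n (fun z => \sum_i x_ n z 0 i ^+ 2) = \sum_i Ex n (fun z => x_ n z 0 i ^+ 2).
    elim: (index_enum _) => [|i s ih].
      rewrite big_nil -[RHS](mul0r (Ex n (fun=> 0))) -ExZ; congr (Ex n _).
      by apply/funext => z; rewrite big_nil mul0r.
    by rewrite big_cons -ih -ExD; congr (Ex n _); apply/funext => z; rewrite big_cons.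
  rewrite mulrC ler_pdivrMr ?exprn_gt0//.
  apply: (@le_trans _ _ T); first by apply: ler_sum => i _; exact: hb'.
  apply: (@le_trans _ _ (r * l)).
    by rewrite /l mulrDr mulr1 mulrCA divff ?gt_eqF// mulr1 lerDr ltW.
  by rewrite ler_wpM2l ?(ltW r0)// expr2 ler_peMl ?(ltW l0).
- move=> u phi; rewrite nuC.
  have cU := linear_recursion_cos_cvg V01 ExD ExZ Ex_le Ex1 ExS Ex0 eps0 Q1 ga0 gaQ gac U_next
    Qd QT kap0 theta0 (etrans SE GamE) dl_cvg (u := u) (phi := phi).
  pose g n := Ex n (fun z => cos ((x_ n z *m u^T) 0 0 + phi)).
  pose h n := Ex n (fun z => cos ((U n z *m u^T) 0 0 / Num.sqrt (n%:R : R) + phi)).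
  (* The bound in [1 / sqrt n] is written with [2 * harmonic n = 2 / (n + 1)], at least [1 / n] for
     positive [n], to use a known null sequence. *)
  have gh n : (0 < n)%N -> `|g n - h n| <= Cu u * Num.sqrt (2 * harmonic n).
    move=> n0.
    have -> : g n - h n = Ex n (fun z => cos ((x_ n z *m u^T) 0 0 + phi) -
        cos ((U n z *m u^T) 0 0 / Num.sqrt (n%:R : R) + phi)).
      by rewrite /g /h -mulN1r -ExZ -ExD; congr (Ex n _); apply/funext => z; rewrite mulN1r.
    have bd z : V z -> `|cos ((x_ n z *m u^T) 0 0 + phi) -
        cos ((U n z *m u^T) 0 0 / Num.sqrt (n%:R : R) + phi)| <= Cu u * Num.sqrt (2 * harmonic n).
      move=> Vz; apply: le_trans (cos_lipschitz _ _) _.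
      rewrite opprD addrACA subrr addr0; apply: le_trans (Xdev u n z n0 Vz) _.
      rewrite ler_wpM2l// -sqrtrV// ler_wsqrtr// /harmonic ler_pdivlMr ?ltr0n//.
      rewrite mulrC ler_pdivrMr ?ltr0n// -natrM ler_nat; lia.
    have ExC (r : R) : Ex n (fun=> r) = r by exact: prob_Rintegral_cst.
    rewrite ler_norml -[X in X <= _](ExC (- _)); apply/andP; split; last rewrite -[leRHS]ExC.
      by apply: Ex_le => z /bd; rewrite ler_norml => /andP[].
    by apply: Ex_le => z /bd; rewrite ler_norml => /andP[].
  have d0 : (fun n => g n - h n) @ \oo --> (0 : R).
    have s0 : (fun n => Cu u * Num.sqrt (2 * harmonic n)) @ \oo --> (0 : R).
      rewrite -[X in _ --> X](mulr0 (Cu u)); apply: cvgMr.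
      have h2 : (fun n => 2 * harmonic n) @ \oo --> (0 : R).
        by rewrite -[X in _ --> X](mulr0 2); apply: cvgMr; exact: cvg_harmonic.
      by rewrite -[X in _ --> X]sqrtr0; exact: (cvg_comp _ _ h2 (@sqrt_continuous R 0)).
    apply/norm_cvg0P; apply: (@squeeze_cvgr _ _ _ _ (cst 0) _ _ _ _ _ s0); last exact: cvg_cst.
    by exists 1%N => // n /= n0; rewrite normr_ge0 gh.
  rewrite -[X in _ --> X]add0r.
  rewrite (_ : (fun n => _) = (fun n => g n - h n + h n)).
    exact: cvgD.
  by apply/funext => n; rewrite subrK.
Qed.
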